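(* Suppose that $K:\mathbb R\to\mathbb R$ is twice continuously differentiable and has support $[-1,1]$. If $Z$ is bounded, $\varphi$ is positive and continuous at $x$, where $0<x<\infty$, and $b=b_n>0$ satisfies $b_n\to0$ and $nb_n\to\infty$, then, as $n\to\infty$, $$\bigl|\tilde\Psi'_{n,s}(x)-\Psi'_{n,s}(x)\bigr| = O_p\left[\frac{\log n}{n b_n^2}\right].$$
   Context: Setting. $\mathbf X=(X_1,X_2,X_3)$ is a random vector and $Z$ a nonnegative random variable such that the joint law of $(\mathbf X,Z)$ is invariant under orthogonal transformations of $\mathbf X$ and has a density with respect to $\lambda^3\times\nu$, where $\lambda^3$ is Lebesgue measure on $\mathbb R^3$ and $\nu$ is a $\sigma$-finite Borel measure on $[0,\infty)$; thus $P[\mathbf X\in d\mathbf x,\,Z\in dz]=\rho(\|\mathbf x\|,z)\,d\mathbf x\,\nu\{dz\}$ for a nonnegative measurable function $\rho$ on $[0,\infty)^2$. Define $$\varphi(x)=\int_0^\infty z\,\rho(\sqrt x,z)\,\nu\{dz\},\qquad x\ge0 .$$ Sample and estimators. $(X_{i,1},X_{i,2},Z_i)$, $i=1,2,\dots$, are i.i.d. copies of $(X_1,X_2,Z)$ and $Y_i=X_{i,1}^2+X_{i,2}^2$. With $a_+=\max(a,0)$, for $y\ge0$, $$\Psi_n^{\#}(y)=\frac1n\sum_{i\le n:\,Y_i>y}\frac{Z_i}{\sqrt{Y_i-y}},\qquad U_n^{\#}(y)=\int_0^y\Psi_n^{\#}(t)\,dt=\frac1n\sum_{i=1}^n 2Z_i\bigl(\sqrt{Y_i}-\sqrt{(Y_i-y)_+}\bigr);$$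 $\tilde U_n$ is the least concave majorant of $U_n^{\#}$ on $[0,\infty)$, and $\tilde\Psi_n$ is the right derivative of $\tilde U_n$. Extend both functions to $\mathbb R$ by $\Psi_n^{\#}(t)=\Psi_n^{\#}(0)$ and $\tilde\Psi_n(t)=\tilde\Psi_n(0)$ for $t\le0$. For the kernel $K$ and bandwidth $b$ define $$\Psi'_{n,s}(x)=-\int_{-\infty}^\infty\frac1{b^2}K'\Bigl(\frac{t-x}{b}\Bigr)\Psi_n^{\#}(t)\,dt,\qquad \tilde\Psi'_{n,s}(x)=-\int_{-\infty}^\infty\frac1{b^2}K'\Bigl(\frac{t-x}{b}\Bigr)\tilde\Psi_n(t)\,dt$$ (the subscript $s$ stands for ''smooth''). *)

(* Defs.v *)
From HB Require Import structures.
From mathcomp Require Import all_boot all_order all_algebra.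
From mathcomp Require Import all_classical all_reals all_analysis.

Set Implicit Arguments.
Unset Strict Implicit.
Unset Printing Implicit Defensive.

Import Order.TTheory GRing.Theory Num.Theory.
Import numFieldNormedType.Exports.

Local Open Scope classical_set_scope.
Local Open Scope ring_scope.

Section probability_notions.
Context {R : realType}.

Definition same_law d1 d2 d' (T1 : measurableType d1) (T2 : measurableType d2)
    (S : measurableType d') (P1 : probability T1 R) (V1 : T1 -> S)
    (P2 : probability T2 R) (V2 : T2 -> S) : Prop :=
  forall A : set S, measurable A -> P1 (V1 @^-1` A) = P2 (V2 @^-1` A).

Definition mutually_independent d d' (T : measurableType d)
    (S : measurableType d') (P : probability T R) (V : nat -> T -> S) : Prop :=
  forall (J : seq nat) (A : nat -> set S), uniq J ->
    (forall i, measurable (A i)) ->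
    P (\bigcap_(i in [set` J]) (V i @^-1` A i)) =
    (\prod_(i <- J) P (V i @^-1` A i))%E.

(* [W n] is not required to be measurable: the event [C * r n < |W n|] is
   contained in a measurable event of probability at most [eps], which for
   measurable [W n] says that its own probability is at most [eps]. *)
Definition bigO_in_probability d (T : measurableType d) (P : probability T R)
    (W : nat -> T -> R) (r : nat -> R) : Prop :=
  forall eps : R, 0 < eps -> exists2 C : R, 0 < C &
    \forall n \near \oo, exists E : set T,
      [/\ measurable E, (P E <= eps%:E)%E &
          [set w | C * r n < `|W n w|] `<=` E].

End probability_notions.

Section law_of_the_population.
Context {R : realType}.

Definition vec3 (x : 'I_3 -> R) : R * R * R := (x 0, x 1, x 2).

Definition norm3 (x : R * R * R) : R :=
  Num.sqrt (x.1.1 ^+ 2 + x.1.2 ^+ 2 + x.2 ^+ 2).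

Definition orthogonally_invariant d (T : measurableType d)
    (P : probability T R) (X : 'I_3 -> T -> R) (Z : T -> R) : Prop :=
  forall Q : 'M[R]_3, Q *m Q^T = 1%:M ->
    same_law P (fun w => (vec3 (fun i => \sum_j Q i j * X j w), Z w))
             P (fun w => (vec3 (X ^~ w), Z w)).

(* A Borel measure on [0, +oo[ is represented by a measure [nu] on [R] that
   does not charge the negative half-line; only the values of [rho] on
   [0, +oo[ x [0, +oo[ are used. *)
Definition has_radial_density d (T : measurableType d) (P : probability T R)
    (X : 'I_3 -> T -> R) (Z : T -> R)
    (nu : {sigma_finite_measure set R -> \bar R}) (rho : R -> R -> R) : Prop :=
  forall A : set (R * R * R * R), measurable A ->
    P [set w | A (vec3 (X ^~ w), Z w)] =
    (\int[((lebesgue_measure \x lebesgue_measure) \x lebesgue_measure) \x nu]_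
       (p in A `&` [set p | (0 <= p.2)%R]) (rho (norm3 p.1) p.2)%:E)%E.

Definition phi (nu : {sigma_finite_measure set R -> \bar R})
    (rho : R -> R -> R) (x : R) : \bar R :=
  (\int[nu]_(z in `[0%R, +oo[) (z * rho (Num.sqrt x) z)%:E)%E.

End law_of_the_population.

Section concave_majorant.
Context {R : realType}.

(* [g] is concave on [0, +oo[ and majorizes [f] there *)
Definition concave_majorant (f g : R -> R) : Prop :=
  @convex_function R R^o `[0, +oo[ (\- g) /\
  {in `[0, +oo[, forall y, f y <= g y}.

Definition least_concave_majorant (f : R -> R) (y : R) : R :=
  inf [set g y | g in concave_majorant f].

Lemma least_concave_majorantP (f : R -> R) :
  (exists g, concave_majorant f g) ->
  concave_majorant f (least_concave_majorant f) /\
  forall g, concave_majorant f g ->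
    {in `[0, +oo[, forall y, least_concave_majorant f y <= g y}.
Proof.
move=> [g0 cg0].
have hi y : y \in `[0, +oo[ -> has_inf [set g y | g in concave_majorant f].
  move=> y0; split; first by exists (g0 y), g0.
  by exists (f y) => _ [g [_ fg] <-]; exact: fg.
have lb g : concave_majorant f g ->
    {in `[0, +oo[, forall y, least_concave_majorant f y <= g y}.
  by move=> cg y y0; apply: ge_inf; [exact: (hi y y0).2|exists g].
split=> //; split=> [t x y|y y0]; last first.
  apply: lb_le_inf; first exact: (hi y y0).1.
  by move=> _ [g [_ fg] <-]; exact: fg.
rewrite !inE => x0 y0 /=.
have x1 : (x : R) \in `[0, +oo[ by [].
have y1 : (y : R) \in `[0, +oo[ by [].
have convE (u v : R) : @conv _ (convex_lmodType R^o) t u v =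
  t%:num * u + (1 - t%:num) * v by [].
have convNE (u v w : R) : (- w <= @conv _ R^o t (- u) (- v)) =
    (t%:num * u + (1 - t%:num) * v <= w).
  by rewrite convRE !mulrN -opprD lerN2.
have t0 : 0 <= t%:num by [].
have t1 : 0 <= 1 - t%:num by rewrite subr_ge0.
rewrite !convE; set z := _ + _; rewrite convNE.
have z1 : z \in `[0, +oo[.
  move: x1 y1; rewrite !in_itv/= !andbT => x1 y1.
  by rewrite /z addr_ge0// mulr_ge0.
apply: lb_le_inf; first exact: (hi z z1).1.
move=> _ [g cg <-]; have := cg.1 t x y.
rewrite !inE => /(_ x0 y0) /=.
rewrite !convE -/z convNE; apply: le_trans.
exact: (lerD (ler_wpM2l t0 (lb g cg x x1)) (ler_wpM2l t1 (lb g cg y y1))).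
Qed.

End concave_majorant.

(* [Y i] and [Z i], [i < n], are the observed values.  [Psi_sharp] and
   [Psi_tilde] are extended to the negative half-line by their value at 0. *)
Section estimators.
Context {R : realType}.
Implicit Types (Y Z : nat -> R) (n : nat).

Definition right_derivative (f : R -> R) (y : R) : R :=
  lim ((fun h : R => (f (y + h) - f y) / h) @ 0^'+).

Definition Psi_sharp Y Z n (t : R) : R :=
  let y := Num.max t 0 in
  n%:R^-1 * \sum_(i < n | y < Y i) Z i / Num.sqrt (Y i - y).

Definition U_sharp Y Z n (y : R) : R :=
  \int[lebesgue_measure]_(t in `[0, y]) Psi_sharp Y Z n t.

Definition U_tilde Y Z n : R -> R := least_concave_majorant (U_sharp Y Z n).

Definition Psi_tilde Y Z n (t : R) : R :=
  right_derivative (U_tilde Y Z n) (Num.max t 0).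

Definition smoothed_derivative (K : R -> R) (b : R) (f : R -> R) (x : R) : R :=
  - \int[lebesgue_measure]_t (b ^- 2 * K^`()%classic ((t - x) / b) * f t).

End estimators.

(* Main.v *)
Require Import Defs.
From HB Require Import structures.
From mathcomp Require Import all_boot all_order all_algebra.
From mathcomp Require Import all_classical all_reals all_analysis.
From mathcomp Require Import measurable_realfun.
From mathcomp Require Import ring lra.

Set Implicit Arguments.
Unset Strict Implicit.
Unset Printing Implicit Defensive.

Import Order.TTheory GRing.Theory Num.Theory.
Import numFieldNormedType.Exports.

Local Open Scope classical_set_scope.
Local Open Scope ring_scope.

(** Let psi(u) = E[Z / sqrt (Y - u); Y > u] be the mean of Psi_sharp, let U be
    the primitive of psi (whose sample version is U_sharp), and put q = ln n /
    n.

    Reduction. Integrating by parts against the Lipschitz function K' bounds the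
    difference of the two smoothed derivatives at x by C / b^3 times the
    integral of U_tilde - U_sharp over [x - 2b, x + 2b]
    (smoothed_derivative_le); since U_tilde >= U_sharp, no cancellation is
    needed. It remains to show that this integral is O_p(b q).

    Population. Integrating the radial density in planar polar coordinates gives
    psi(u) = kap^2 times the integral of phi over ]u, +oo[ (expect_isq). As phi
    is positive near x, psi decreases there at a positive rate 2c
    (fine_Psi_mean_decr), so that U is strictly concave near x. In addition the
    Z-weighted law of Y has a bounded density near x (expect_local). This
    controls Psi_sharp - psi: a summand Z / sqrt (Y - u) has infinite variance,
    but only logarithmically so. Truncated at distance n^-2 from the singularity
    it has a second moment O(ln n), so the truncated mean deviates from its
    expectation by d1 with E[d1^2] = O(q), while the remainder r has E[r] = O(1
    / n).

    Geometry. U_tilde(t) - U_sharp(t) <= g as soon as the line of slope psi(t)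
    through (t, U_sharp(t) + g) stays above U_sharp (tilde_minus_sharp_le). Near
    x, at distance |u - t| from t, the decrease of psi compensates a deviation
    of Psi_sharp from psi of size 2c |u - t|; hence only the deviations with
    d1(u) >= 2c |u - t| count, and their integral together with that of r, the
    integral of the excess, is an admissible g. Further away from x it is enough
    that a weighted integral of the deviation is small, and beyond a fixed
    neighbourhood of x that U_sharp is uniformly close to U or, at infinity,
    that it grows like a square root.

    Averaging. A deviation d1(u) enters the bound at t only if t lies within
    d1(u) / 2c of u. Integrating over t therefore produces d1(u)^2 / c, whose
    expectation is O(q); this is where the order q, and not the order sqrt q of
    the deviations, comes from (integral_excess_le_sqr). All this is done at the
    scale max(b, L sqrt q), because the weighted integral is small only when the
    scale is a large multiple of sqrt q. If b is smaller than L sqrt q, the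
    bound 4b (d1 + r) integrated over a window of length O(sqrt q) is again O(b
    q). Expectations are turned into an event of probability at least 1 - eps by
    Markov's inequality (good_event). *)

(** * Measures with a density and affine substitutions *)

Section measures_with_density.
Context d (T : measurableType d) (R : realType).
Variables (mu : {measure set T -> \bar R}) (g : T -> R).
Hypotheses (g0 : forall x, 0 <= g x) (mg : measurable_fun setT g).

(** The proofs of positivity and of measurability are arguments because the
    measure structure below has to be inferred from the term alone. *)
Definition mdensity (_ : forall x, 0 <= g x) (_ : measurable_fun setT g)
  (A : set T) : \bar R := (\int[mu]_(x in A) (g x)%:E)%E.

Local Notation m := (mdensity g0 mg).

Let m0 : m set0 = 0%E. Proof. by rewrite /mdensity integral_set0. Qed.

Let m_ge0 A : (0 <= m A)%E.
Proof. by apply: integral_ge0 => x _; rewrite lee_fin. Qed.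

Let m_sigma_additive : semi_sigma_additive m.
Proof.
move=> F mF tF mUF.
rewrite /mdensity ge0_integral_bigcup//; last 2 first.
- by apply/measurable_EFinP; exact: measurable_funTS.
- by move=> x _; rewrite lee_fin.
by apply: is_cvg_ereal_nneg_natsum => n _; apply: integral_ge0 => x _; rewrite lee_fin.
Qed.

HB.instance Definition _ := isMeasure.Build _ _ _ m m0 m_ge0 m_sigma_additive.

Import HBNNSimple.

Let integral_mdensity_nnsfun (h : {nnsfun T >-> R}) :
  (\int[m]_x (h x)%:E = \int[mu]_x ((h x)%:E * (g x)%:E))%E.
Proof.
pose A y := h @^-1` [set y].
have mA y : measurable (A y) by exact: measurable_sfunP.
have mgE : measurable_fun setT (fun x => (g x)%:E) by exact/measurable_EFinP.
have mA1 y : measurable_fun setT (fun x => (\1_(A y) x)%:E * (g x)%:E)%E.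
  by apply: emeasurable_funM => //; apply/measurable_EFinP; exact: measurable_indic.
have hE x : ((h x)%:E * (g x)%:E =
    \sum_(y \in range h) (y%:E * ((\1_(A y) x)%:E * (g x)%:E)))%E.
  rewrite [in LHS](fimfunE h x) -fsumEFin// ge0_mule_fsuml => [|y].
    by apply: eq_fsbigr => y _; rewrite EFinM muleA.
  exact: nnfun_muleindic_ge0.
rewrite integralT_nnsfun sintegralE.
under [RHS]eq_integral do rewrite hE.
have y0 y x : (0 <= y%:E * ((\1_(A y) x)%:E * (g x)%:E))%E.
  rewrite muleA; apply: mule_ge0; last by rewrite lee_fin.
  by rewrite -EFinM; exact: nnfun_muleindic_ge0.
rewrite ge0_integral_fsum//; last by move=> y; exact: emeasurable_funM.
apply: eq_fsbigr => y; rewrite inE => -[x _ <-].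
rewrite ge0_integralZl ?lee_fin//; last by move=> z _; rewrite mule_ge0 ?lee_fin.
congr (_ * _)%E; rewrite [LHS]/= /mdensity [LHS]integral_mkcond epatch_indic.
by apply: eq_integral => z _; rewrite muleC.
Qed.

(** Linearity gives the formula for simple functions, and monotone convergence
    along an increasing sequence of simple functions gives it for f. *)
Lemma ge0_integral_mdensity (f : T -> \bar R) :
  measurable_fun setT f -> (forall x, (0 <= f x)%E) ->
  (\int[m]_x f x = \int[mu]_x (f x * (g x)%:E))%E.
Proof.
move=> mf f0; pose h n (x : T) := (nnsfun_approx measurableT mf n x)%:E.
have mh n : measurable_fun setT (h n) by exact/measurable_EFinP.
have h0 n x : setT x -> (0 <= h n x)%E by rewrite lee_fin.
have hndecr x : setT x -> {homo h^~ x : n p / (n <= p)%N >-> (n <= p)%E}.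
  by move=> _ n p np; rewrite lee_fin; exact/lefP/nd_nnsfun_approx.
have hf x : h n x @[n --> \oo] --> f x.
  exact: (cvg_nnsfun_approx measurableT mf).
have mono (la : {measure set T -> \bar R}) (k : T -> R) : measurable_fun setT k ->
    (forall x, 0 <= k x) -> (\int[la]_x (h n x * (k x)%:E) @[n --> \oo] -->
    \int[la]_x (f x * (k x)%:E))%E.
  move=> mk k0.
  have k0E x : (0 <= (k x)%:E)%E by rewrite lee_fin.
  have lim x : limn (fun n => h n x * (k x)%:E)%E = (f x * (k x)%:E)%E.
    by apply/cvg_lim => //; apply: cvgeZr => //; exact: hf.
  under [X in _ --> X]eq_integral do rewrite -lim.
  apply: cvg_monotone_convergence => //.
  - by move=> n; apply: emeasurable_funM => //; exact/measurable_EFinP.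
  - by move=> n x xT; apply: mule_ge0 => //; exact: h0.
  - by move=> x xT n p np; apply: lee_wpmul2r => //; exact: hndecr.
have one (k : T -> \bar R) : (fun x => k x * ((cst 1 : T -> R) x)%:E)%E = k.
  by apply/funext => x; rewrite mule1.
have := mono m (cst 1) (measurable_cst _) (fun=> ler01); rewrite one => c1.
apply: (cvg_unique _ c1) => //.
rewrite (_ : (fun n => _) = (fun n => \int[mu]_x (h n x * (g x)%:E))%E).
  exact: mono.
by apply/funext => n; rewrite one integral_mdensity_nnsfun.
Qed.

End measures_with_density.

Section lebesgue_substitutions.
Context {R : realType}.
Local Notation mu := (@lebesgue_measure R).
Local Open Scope ereal_scope.
Implicit Types f : R -> \bar R.

(** Lebesgue measure is determined by the lengths of intervals, which the
    translation preserves; the reflection and the dilation below are handled in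
    the same way. *)
Lemma ge0_integral_shift f (a : R) : measurable_fun setT f ->
  (forall t, 0 <= f t) -> \int[mu]_t f (t + a)%R = \int[mu]_t f t.
Proof.
move=> mf f0.
pose T : measurableTypeR R -> measurableTypeR R := (fun t => t + a)%R.
have mT : measurable_fun setT T by exact: measurable_funD.
have := @ge0_integral_pushforward _ _ _ _ R T mT mu setT f
  measurableT mf (fun y _ => f0 y).
rewrite preimage_setT => <-; apply: eq_measure_integral => //= A mA _.
apply/esym/lebesgue_measure_unique => //= _ [[u v]] _ <-.
rewrite /pushforward/=.
rewrite (_ : _ @^-1` _ = `](u - a)%R, (v - a)%R]%classic); last first.
  by apply/seteqP; split => t /=; rewrite !in_itv/= ltrBlDr lerBrDr.
rewrite !lebesgue_measure_itv/= !lte_fin ltrD2r.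
by case: ifP => // _; rewrite -!EFinB; congr EFin; ring.
Qed.

Lemma ge0_integral_reflect f (a : R) : measurable_fun setT f ->
  (forall t, 0 <= f t) -> \int[mu]_t f (a - t)%R = \int[mu]_t f t.
Proof.
move=> mf f0.
pose T : measurableTypeR R -> measurableTypeR R := (fun t => a - t)%R.
have mT : measurable_fun setT T by exact: measurable_funB.
have := @ge0_integral_pushforward _ _ _ _ R T mT mu setT f
  measurableT mf (fun y _ => f0 y).
rewrite preimage_setT => <-; apply: eq_measure_integral => //= A mA _.
apply/esym/lebesgue_measure_unique => //= _ [[u v]] _ <-.
rewrite /pushforward/=.
rewrite (_ : _ @^-1` _ = `[(a - v)%R, (a - u)%R[%classic); last first.
  apply/seteqP; split => t /=; rewrite !in_itv/= => /andP[H1 H2]; apply/andP; split; rewrite /T in H1 H2 *; lra.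
rewrite !lebesgue_measure_itv/= !lte_fin ltrD2l ltrN2.
by case: ifP => // _; rewrite -!EFinB; congr EFin; ring.
Qed.

Lemma ge0_integral_scale f (c : R) : (0 < c)%R -> measurable_fun setT f ->
  (forall t, 0 <= f t) -> c%:E * \int[mu]_t f (c * t)%R = \int[mu]_t f t.
Proof.
move=> c0 mf f0.
pose T : measurableTypeR R -> measurableTypeR R := (fun t => c * t)%R.
have mT : measurable_fun setT T by exact: measurable_funM.
have := @ge0_integral_pushforward _ _ _ _ R T mT mu setT f
  measurableT mf (fun y _ => f0 y).
rewrite preimage_setT => <-.
have /= <- := @ge0_integral_mscale _ _ R (pushforward mu T) setT
  measurableT (NngNum (ltW c0)) f mf (fun y _ => f0 y).
apply: eq_measure_integral => //= A mA _.
apply/esym/lebesgue_measure_unique => //= _ [[u v]] _ <-.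
rewrite /mscale/= /pushforward/=.
rewrite (_ : _ @^-1` _ = `](u / c)%R, (v / c)%R]%classic); last first.
  by apply/seteqP; split => t /=; rewrite !in_itv/= ltr_pdivrMr// ler_pdivlMr//
    /T mulrC.
rewrite !lebesgue_measure_itv/= !lte_fin ltr_pM2r ?invr_gt0//.
case: ifP => // _; last by rewrite mule0.
by rewrite -!EFinB -EFinM; congr EFin; field; rewrite gt_eqF.
Qed.

End lebesgue_substitutions.

(** * The kernel 1 / sqrt and the substitution of a square *)

Lemma measurable_patchT d (T : measurableType d) (R : realType)
    (D : set T) (f : T -> \bar R) : measurable D ->
  measurable_fun setT f -> measurable_fun setT (f \_ D).
Proof.
by move=> mD mf; apply/(measurable_restrictT _ mD); exact: measurable_funTS.
Qed.

(** As both the square root and the inverse send 0 to 0, isq vanishes on ]-oo,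
    0], so that Z * isq (Y - y) already contains the condition Y > y of the
    estimator. *)
Definition isq {R : realType} (s : R) : R := (Num.sqrt s)^-1.

Section square_substitution.
Context {R : realType}.
Local Notation mu := (@lebesgue_measure R).
Implicit Types (f : R -> \bar R) (s t x y : R).

Lemma isq_ge0 s : 0 <= isq s.
Proof. by rewrite invr_ge0 sqrtr_ge0. Qed.

Lemma isq_le0 s : s <= 0 -> isq s = 0.
Proof. by move=> s0; rewrite /isq ler0_sqrtr// invr0. Qed.

Lemma sqr_isq s : 0 < s -> isq s ^+ 2 = s^-1.
Proof. by move=> s0; rewrite /isq exprVn sqr_sqrtr// ltW. Qed.

Lemma isqX x : 0 < x -> isq (x ^+ 2) = x^-1.
Proof. by move=> x0; rewrite /isq sqrtr_sqr gtr0_norm. Qed.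

Lemma isqM s t : 0 <= s -> isq (s * t) = isq s * isq t.
Proof. by move=> s0; rewrite /isq sqrtrM// invfM. Qed.

Lemma isq_nincr s t : 0 < s -> s <= t -> isq t <= isq s.
Proof.
move=> s0 st; rewrite /isq lef_pV2 ?posrE ?sqrtr_gt0 ?(lt_le_trans s0 st)//.
exact: ler_wsqrtr.
Qed.

Lemma measurable_sqrt : measurable_fun setT (@Num.sqrt R).
Proof. by apply: nondecreasing_measurable => // s t; exact: ler_wsqrtr. Qed.

Lemma measurable_isq : measurable_fun setT (@isq R).
Proof.
rewrite (_ : isq = (fun t => t `^ (- 1)) \o @Num.sqrt R); last first.
  by apply/funext => s /=; rewrite powR_inv1// sqrtr_ge0.
by apply: measurableT_comp measurable_sqrt; exact: measurable_powR.
Qed.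

Let g x : R := 2 * x * \1_`]0, +oo[ x.

Let g0 x : 0 <= g x.
Proof.
rewrite /g indicE; case: (boolP (x \in _)) => [|_]; last by rewrite mulr0.
by rewrite inE/= in_itv/= andbT => x0; rewrite mulr1 mulr_ge0 ?(ltW x0).
Qed.

Let mg : measurable_fun setT (g : measurableTypeR R -> R).
Proof. by apply: measurable_funM => //; exact: measurable_funM. Qed.

Let sq : measurableTypeR R -> measurableTypeR R := fun x => x ^+ 2.

Let msq : measurable_fun setT sq.
Proof. exact: exprn_measurable. Qed.

Let FTC_sq (a b : R) : a < b ->
  (\int[mu]_(x in `]a, b]) (2 * x)%:E = (b ^+ 2 - a ^+ 2)%:E)%E.
Proof.
move=> ab.
have c2 : continuous (fun x : R => 2 * x).
  by move=> x; apply: cvgM; [exact: cvg_cst|exact: cvg_id].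
have cX : continuous (fun x : R => x ^+ 2) by exact: exprn_continuous.
have m2 : measurable_fun `]a, b[ (fun x : R => (2 * x)%:E).
  by apply/measurable_EFinP; exact: measurable_funM.
rewrite integral_itv_bndoo// -(integral_itv_bndoo true false)//.
rewrite (@continuous_FTC2 _ _ (fun x => x ^+ 2))//.
- exact: continuous_subspaceT.
- split=> [x _||]; first exact: exprn_derivable.
  + by apply: cvg_at_right_filter; exact: cX.
  + by apply: cvg_at_left_filter; exact: cX.
- by move=> x _; rewrite derive1E exp_derive expr1 scaler_nat mulr_natl /GRing.scale/= mulr1.
Qed.

Let pushforward_sq_itv (a b : R) : a < b ->
  pushforward (mdensity mu g0 mg) sq `]a, b]%classic =
  (Num.max b 0 - Num.max a 0)%:E.
Proof.
move=> ab; rewrite /pushforward/= /mdensity.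
have sqr_max (c : R) : Num.sqrt c ^+ 2 = Num.max c 0.
  by case: (lerP c 0) => c0; [rewrite ler0_sqrtr// expr0n|rewrite sqr_sqrtr// ltW].
transitivity (\int[mu]_(x in `](Num.sqrt a), (Num.sqrt b)]) (2 * x)%:E)%E.
  rewrite integral_mkcond [RHS]integral_mkcond; apply: eq_integral => x _.
  rewrite !patchE /g indicE.
  have [x0|x0] := leP x 0.
    rewrite [X in _ = if X then _ else _]memNset; last first.
      rewrite /= in_itv/= => /andP[/(le_lt_trans (sqrtr_ge0 _))].
      by rewrite ltNge x0.
    rewrite (memNset (A := `]0, +oo[)) ?mulr0 ?if_same//=.
    by rewrite in_itv/= andbT ltNge x0.
  rewrite (_ : x \in `]0, +oo[%classic = true) ?mulr1; last first.
    by apply/mem_set; rewrite /= in_itv/= x0.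
  congr (if _ then _ else _).
  have xE : x = Num.sqrt (x ^+ 2) by rewrite sqrtr_sqr gtr0_norm.
  have x2 : 0 < x ^+ 2 by rewrite exprn_gt0.
  have h1 : (Num.sqrt a < x) = (a < x ^+ 2) by rewrite {1}xE ltr_sqrt.
  have h2 : (x <= Num.sqrt b) = (x ^+ 2 <= b).
    have [b0|b0] := ltP b 0; last by rewrite {1}xE ler_sqrt.
    by rewrite ltr0_sqrtr// leNgt x0 leNgt (lt_trans b0 x2).
  by apply/idP/idP; rewrite !inE/= !in_itv/= /sq h1 h2.
have := sqrtr_ge0 b; rewrite le_eqVlt => /predU1P[b0|b0].
  rewrite set_itv_ge ?integral_set0 -?leNgt ?bnd_simp -?b0 ?sqrtr_ge0//.
  have/eqP := esym b0; rewrite sqrtr_eq0 => b0'.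
  by rewrite !max_r ?subrr// (le_trans (ltW ab)).
rewrite FTC_sq ?sqr_max// ltr_sqrt//.
by move: b0; rewrite sqrtr_gt0.
Qed.

Let mI : measurable (`]-oo, 0] : set (measurableTypeR R)).
Proof. by []. Qed.

Let lebesgue_sqE (A : set R) : measurable A -> A `<=` `]0, +oo[ ->
  mu A = pushforward (mdensity mu g0 mg) sq A.
Proof.
move=> mA A0.
(* Uniqueness applies to measures on the whole line, hence the sum with the
   restriction of Lebesgue measure to the negative half-line. *)
rewrite (@lebesgue_measure_unique _
  (measure_add (mrestr mu mI) (pushforward (mdensity mu g0 mg) sq)))//; last first.
  move=> _ [[a b] _ <-]; rewrite [RHS]measure_addE /mrestr/=.
  have [ab|ba] := ltP a b; last first.
    rewrite (_ : `]a, b]%classic = set0) ?set0I ?measure0 ?adde0//.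
    by rewrite set_itv_ge// bnd_simp -leNgt.
  rewrite pushforward_sq_itv//.
  rewrite [X in (mu X + _)%E](_ : _ = `]a, (Num.min b 0)]%classic); last first.
    apply/seteqP; split => x /=; rewrite !in_itv/= le_min.
      by move=> [/andP[-> ->] ->].
    by move=> /and3P[-> -> ->].
  rewrite !lebesgue_measure_itv/= !lte_fin ab lt_min ab/=.
  case: ifPn => a0; rewrite -?EFinD -?EFinN ?add0e; congr EFin.
    by rewrite (max_r (ltW a0)); case: (leP b 0); lra.
  move: a0; rewrite -leNgt => a0.
  by rewrite !max_l ?(le_trans a0 (ltW ab))// add0r.
rewrite [LHS]measure_addE /mrestr/= [X in (mu X + _)%E](_ : _ = set0).
  by rewrite measure0 add0e.
apply/seteqP; split => // x [/A0]/=; rewrite !in_itv/= andbT => x0.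
by rewrite leNgt x0.
Qed.

(** The image under squaring of the measure 2 x dx on ]0, +oo[ gives ]a, b] the
    mass b - a, by the fundamental theorem of calculus, hence is Lebesgue
    measure there. *)
Lemma ge0_integral_sqr_pos f : measurable_fun setT f ->
  (forall s, (0 <= f s)%E) ->
  (\int[mu]_(s in `]0%R, +oo[) f s =
   \int[mu]_x (f (x ^+ 2)%R * (2 * x * \1_`]0, +oo[ x)%:E))%E.
Proof.
move=> mf f0.
transitivity (\int[pushforward (mdensity mu g0 mg) sq]_(s in `]0%R, +oo[) f s)%E.
  by apply: eq_measure_integral => A mA A0; exact: lebesgue_sqE.
rewrite integral_mkcond ge0_integral_pushforward//; last 2 first.
- exact: measurable_patchT.
- by move=> y _; rewrite erestrict_ge0.
rewrite preimage_setT ge0_integral_mdensity//; last 2 first.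
- apply: measurableT_comp => //.
  exact: measurable_patchT.
- by move=> y; rewrite /= erestrict_ge0.
apply: eq_integral => x _; rewrite /= patchE /g /sq.
have [x0|x0] := leP x 0.
  rewrite indicE (_ : (x \in `]0, +oo[%classic) = false).
    by rewrite !mulr0 !mule0.
  by apply: memNset; rewrite /= in_itv/= andbT ltNge x0.
by rewrite mem_set//= in_itv/= andbT exprn_gt0.
Qed.

End square_substitution.

Section arcsine_kernel.
Context {R : realType}.
Local Notation mu := (@lebesgue_measure R).
Implicit Types (f F : R -> \bar R) (s t x y : R).
Local Open Scope ereal_scope.

Lemma integral_isq_pos f : measurable_fun setT f -> (forall s, 0 <= f s) ->
  \int[mu]_s (f s * (isq s)%:E) =
  \int[mu]_x (f (x ^+ 2)%R * (2 * \1_`]0%R, +oo[ x)%:E).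
Proof.
move=> mf f0.
transitivity (\int[mu]_(s in `]0%R, +oo[) (f s * (isq s)%:E)).
  rewrite [RHS]integral_mkcond; apply: eq_integral => s _; rewrite patchE.
  case: ifPn => //; rewrite notin_setE/= in_itv/= andbT => /negP.
  by rewrite -leNgt => s0; rewrite isq_le0// mule0.
rewrite ge0_integral_sqr_pos//; last 2 first.
- by apply: emeasurable_funM => //; apply/measurable_EFinP; exact: measurable_isq.
- by move=> s; rewrite mule_ge0// lee_fin isq_ge0.
apply: eq_integral => x _; rewrite -muleA -EFinM; congr (_ * _%:E).
have [x0|x0] := leP x 0%R.
  rewrite indicE (_ : (x \in `]0%R, +oo[%classic) = false) ?mulr0//.
  by apply: memNset; rewrite /= in_itv/= andbT ltNge x0.
by rewrite isqX// mulrA mulrCA mulVf ?mulr1// gt_eqF.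
Qed.

(** Both square roots of s contribute, which turns the factor 2 of the previous
    lemma into an integral over the whole line. *)
Lemma integral_isq f : measurable_fun setT f -> (forall s, 0 <= f s) ->
  \int[mu]_s (f s * (isq s)%:E) = \int[mu]_x f (x ^+ 2)%R.
Proof.
move=> mf f0; rewrite integral_isq_pos//.
pose h x := f (x ^+ 2)%R * (\1_`]0%R, +oo[ x)%:E.
have mfX : measurable_fun setT (fun x => f (x ^+ 2)%R).
  by apply: measurableT_comp => //; exact: exprn_measurable.
have mh : measurable_fun setT h.
  by apply: emeasurable_funM => //; apply/measurable_EFinP.
have h0 x : 0 <= h x by rewrite mule_ge0// lee_fin.
have hE x : f (x ^+ 2)%R * (2 * \1_`]0%R, +oo[ x)%:E = h x + h x.
  by rewrite mulr_natl mulr2n EFinD ge0_muleDr// lee_fin.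
under eq_integral do rewrite hE.
rewrite ge0_integralD// -{2}(@ge0_integral_reflect _ h 0%R)//.
rewrite -ge0_integralD//; last first.
  by apply: measurableT_comp => //; exact: measurable_funB.
apply: ae_eq_integral => //.
- apply: emeasurable_funD => //.
  by apply: measurableT_comp => //; exact: measurable_funB.
- exists [set 0%R]; split => //; first exact: lebesgue_measure_set1.
  move=> x /= hx; apply/eqP/negPn/negP => x0; apply: hx => _.
  rewrite /h sub0r sqrrN !indicE.
  have [x1|x1] := ltP x 0%R.
    rewrite memNset/=; last by rewrite in_itv/= andbT ltNge (ltW x1).
    by rewrite mule0 add0e mem_set ?mule1//= in_itv/= andbT oppr_gt0.
  have x2 : (0 < x)%R by rewrite lt_neqAle eq_sym x0.
  rewrite mem_set/=; last by rewrite in_itv/= andbT.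
  by rewrite mule1 memNset ?mule0 ?adde0//= in_itv/= andbT oppr_gt0 ltNge (ltW x2).
Qed.

Lemma integral_isq_itv (c s t : R) : (s <= t)%R ->
  \int[mu]_(u in `]s, t[) (isq (c - u))%:E =
  (2 * (Num.sqrt (c - s) - Num.sqrt (c - t)))%:E.
Proof.
move=> st.
have mi : measurable_fun setT (fun v : R => \1_`]s, t[ (c - v)%R : R).
  have : measurable_fun setT (fun v : R => c - v)%R by exact: measurable_funB.
  by move/(measurableT_comp (@measurable_indic _ _ R setT `]s, t[ (@measurable_itv _ _)));apply.
have mi' : measurable_fun setT (fun v : R => (\1_`]s, t[ (c - v)%R : R)%:E).
  exact/measurable_EFinP.
transitivity (\int[mu]_v ((\1_`]s, t[ (c - v)%R)%:E * (isq v)%:E)).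
  rewrite -[RHS](@ge0_integral_reflect _ _ c)//; last 2 first.
  - apply: emeasurable_funM; first exact/measurable_EFinP.
    by apply/measurable_EFinP; exact: measurable_isq.
  - by move=> v; rewrite mule_ge0 ?lee_fin ?isq_ge0.
  rewrite integral_mkcond epatch_indic; apply: eq_integral => u _ /=.
  by rewrite subKr muleC.
rewrite integral_isq_pos//.
set a := Num.sqrt (c - t); set b := Num.sqrt (c - s).
have ab : (a <= b)%R by apply: ler_wsqrtr; rewrite lerD2l lerN2.
transitivity (\int[mu]_(x in `]a, b[) 2%:E); last first.
  rewrite integral_cst//= lebesgue_measure_itv/= lte_fin.
  move: ab; rewrite le_eqVlt => /predU1P[->|ab]; first by rewrite ltxx subrr mule0 mulr0.
  by rewrite ab -EFinB -EFinM.
rewrite [RHS]integral_mkcond epatch_indic; apply: eq_integral => x _ /=.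
rewrite -!EFinM !indicE; congr EFin.
have [x0|x0] := leP x 0%R.
  rewrite (_ : x \in `]0%R, +oo[%classic = false); last first.
    by apply: memNset; rewrite /= in_itv/= andbT ltNge x0.
  rewrite mulr0 mulr0 memNset ?mulr0//= in_itv/= => /andP[+ _].
  by rewrite ltNge (le_trans x0)// sqrtr_ge0.
rewrite (_ : x \in `]0%R, +oo[%classic = true) ?mulr1; last first.
  by apply/mem_set; rewrite /= in_itv/= x0.
rewrite mulrC; congr (_ * (nat_of_bool _)%:R)%R.
have xE : x = Num.sqrt (x ^+ 2) by rewrite sqrtr_sqr gtr0_norm.
have x2 : (0 < x ^+ 2)%R by rewrite exprn_gt0.
have h1 : (a < x)%R = (c - x ^+ 2 < t)%R.
  by rewrite /a {1}xE ltr_sqrt// !ltrBlDr addrC.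
have h2 : (x < b)%R = (s < c - x ^+ 2)%R.
  have [b0|b0] := leP (c - s)%R 0%R.
    rewrite /b ler0_sqrtr// !ltNge (ltW x0)/=; apply/esym/negbTE; rewrite negbK; lra.
  by rewrite /b {1}xE ltr_sqrt// !ltrBrDr addrC.
by apply/idP/idP; rewrite !inE/= !in_itv/= h1 h2 andbC.
Qed.

(** The arcsine integral over ]-1, 1[, whose value is pi. *)
Definition kap : \bar R := \int[mu]_x (isq (1 - x ^+ 2))%:E.

Let misq1 : measurable_fun setT (fun x : R => isq (1 - x ^+ 2)).
Proof.
apply: measurableT_comp; first exact: measurable_isq.
by apply: measurable_funB => //; exact: exprn_measurable.
Qed.

Lemma kap_gt0 : 0 < kap.
Proof.
(* The integrand is at least 1 on ]0, 1[. *)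
have : \int[mu]_(x in `]0%R, 1%R[) 1 <= kap.
  rewrite integral_mkcond; apply: ge0_le_integral => //.
  - by move=> x _; rewrite erestrict_ge0.
  - by apply: measurable_patchT.
  - by apply/measurable_EFinP.
  - move=> x _; rewrite patchE; case: ifPn; last by rewrite lee_fin isq_ge0.
    rewrite inE/= in_itv/= => /andP[x0 x1]; rewrite lee_fin.
    have xx : (0 < 1 - x ^+ 2)%R by rewrite subr_gt0 expr_lt1// ltW.
    rewrite /isq -[leLHS]invr1 lef_pV2 ?posrE ?sqrtr_gt0//.
    rewrite -[leRHS]sqrtr1; apply: ler_wsqrtr.
    by rewrite gerBl sqr_ge0.
apply: lt_le_trans; rewrite integral_cst//= lebesgue_measure_itv/= lte_fin ltr01.
by rewrite oppr0 addr0 mul1e lte_fin.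
Qed.

End arcsine_kernel.

Section radial_integrals.
Context {R : realType}.
Local Notation mu := (@lebesgue_measure R).
Local Notation kap := (@kap R).
Implicit Types (f F : R -> \bar R) (s t x y : R).
Local Open Scope ereal_scope.

(** As x^2 <= |x| on ]-1, 1[, the integrand is at most the value of isq at 1 -
    |x|, and the integral of the latter is known explicitly. *)
Lemma kap_lty : kap < +oo.
Proof.
have mi1 : measurable_fun setT (fun x : R => (isq (1 - x))%:E).
  apply/measurable_EFinP; apply: measurableT_comp; first exact: measurable_isq.
  exact: measurable_funB.
pose h := (fun x : R => (isq (1 - x))%:E) \_ `](-1)%R, 1%R[.
have mh : measurable_fun setT h by exact: measurable_patchT.
have h0 x : 0 <= h x by apply: erestrict_ge0 => y _; rewrite lee_fin isq_ge0.
have hi : \int[mu]_x h x < +oo.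
  by rewrite -integral_mkcond integral_isq_itv ?ltry// lerNl; lra.
have mhN : measurable_fun setT (fun x => h (0 - x)%R).
  by apply: measurableT_comp => //; exact: measurable_funB.
apply: (@le_lt_trans _ _ (\int[mu]_x (h x + h (0 - x)%R))); last first.
  by rewrite ge0_integralD// ge0_integral_reflect// lte_add_pinfty.
apply: ge0_le_integral => //.
- by move=> x _; rewrite lee_fin isq_ge0.
- apply/measurable_EFinP; apply: measurableT_comp; first exact: measurable_isq.
  by apply: measurable_funB => //; exact: exprn_measurable.
- exact: emeasurable_funD.
- move=> x _.
  have [x1|x1] := leP 1%R (x ^+ 2)%R.
    by rewrite isq_le0 ?adde_ge0// subr_le0.
  have {}x1 : (`|x| < 1)%R by rewrite -sqrtr_sqr -[ltRHS]sqrtr1 ltr_sqrt.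
  have xin : x \in `](-1)%R, 1%R[%classic by rewrite inE/= in_itv/= -ltr_norml.
  have xinN : (- x)%R \in `](-1)%R, 1%R[%classic.
    by rewrite inE/= in_itv/= -ltr_norml normrN.
  rewrite /h !patchE sub0r xin xinN opprK -EFinD lee_fin.
  have key (z : R) : (0 <= z)%R -> (z < 1)%R -> (isq (1 - z ^+ 2) <= isq (1 - z))%R.
    move=> z0 z1; apply: isq_nincr; first lra.
    by rewrite lerD2l lerN2 expr2 ler_piMl// ltW.
  have [x0|x0] := leP 0%R x.
    rewrite -[leLHS]addr0; apply: lerD; last exact: isq_ge0.
    by apply: key => //; rewrite -(ger0_norm x0).
  rewrite -[leLHS]add0r; apply: lerD; first exact: isq_ge0.
  have := key (- x)%R; rewrite sqrrN opprK; apply.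
    by rewrite oppr_ge0 ltW.
  by rewrite -(ltr0_norm x0).
Qed.

Lemma kap_fin : kap \is a fin_num.
Proof. by rewrite ge0_fin_numE ?kap_lty// ltW// kap_gt0. Qed.

(** By the substitution x = sqrt t * y the integral does not depend on t > 0. *)
Lemma integral_isq_subX t : \int[mu]_x (isq (t - x ^+ 2))%:E =
  if (0 < t)%R then kap else 0.
Proof.
have [t0|t0] := ltP 0%R t; last first.
  rewrite (eq_integral (cst 0)) ?integral0// => x _.
  by rewrite isq_le0// subr_le0 (le_trans t0)// sqr_ge0.
have st : (0 < Num.sqrt t)%R by rewrite sqrtr_gt0.
rewrite -(@ge0_integral_scale _ _ (Num.sqrt t))//; last 2 first.
- apply/measurable_EFinP; apply: measurableT_comp; first exact: measurable_isq.
  by apply: measurable_funB => //; exact: exprn_measurable.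
- by move=> x; rewrite lee_fin isq_ge0.
under eq_integral.
  move=> x _; rewrite exprMn sqr_sqrtr ?(ltW t0)//.
  rewrite -[X in (X - _)%R]mulr1 -mulrBr isqM ?(ltW t0)// EFinM.
  over.
rewrite ge0_integralZl//.
- by rewrite muleA -EFinM /isq divff ?gt_eqF// mul1e.
- apply/measurable_EFinP; apply: measurableT_comp; first exact: measurable_isq.
  by apply: measurable_funB => //; exact: exprn_measurable.
- by move=> x _; rewrite lee_fin isq_ge0.
- by rewrite lee_fin isq_ge0.
Qed.

(** The substitution y^2 = t - x^2 moves F out of the inner integral after an
    exchange of the order of integration; what remains is an arcsine integral. *)
Lemma integral_sqrD F : measurable_fun setT F -> (forall t, 0 <= F t) ->
  \int[mu]_x \int[mu]_y F (x ^+ 2 + y ^+ 2)%R =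
  kap * \int[mu]_(t in `]0%R, +oo[) F t.
Proof.
move=> mF F0.
pose k (p : R * R) := F p.2 * (isq (p.2 - p.1 ^+ 2))%:E.
have mk : measurable_fun setT k.
  apply: emeasurable_funM; first exact: measurableT_comp.
  apply/measurable_EFinP; apply: measurableT_comp; first exact: measurable_isq.
  apply: measurable_funB; first exact: measurable_snd.
  by apply: measurable_funX; exact: measurable_fst.
have k0 p : 0 <= k p by rewrite mule_ge0 ?lee_fin ?isq_ge0.
transitivity (\int[mu]_x \int[mu]_t k (x, t)).
  apply: eq_integral => x _.
  rewrite -(@ge0_integral_shift _ (fun t => k (x, t)) (x ^+ 2))//; last first.
    exact: measurableT_comp.
  rewrite -(@integral_isq _ (fun s => F (x ^+ 2 + s)%R))//; last first.
    by apply: measurableT_comp => //; exact: measurable_funD.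
  by apply: eq_integral => s _; rewrite /k/= addrK addrC.
rewrite (@fubini_tonelli _ _ _ _ _ mu mu k)//.
rewrite [in RHS]integral_mkcond -ge0_integralZl//; last 3 first.
- by apply: measurable_patchT.
- by move=> t _; exact: erestrict_ge0.
- by rewrite ltW// kap_gt0.
apply: eq_integral => t _; rewrite /k/= ge0_integralZl//; last 2 first.
- apply/measurable_EFinP; apply: measurableT_comp; first exact: measurable_isq.
  by apply: measurable_funB => //; exact: exprn_measurable.
- by move=> x _; rewrite lee_fin isq_ge0.
rewrite integral_isq_subX patchE muleC; case: ifPn => t0.
  by rewrite mem_set//= in_itv/= t0.
by rewrite memNset ?mule0 ?mul0e//= in_itv/= andbT; exact/negP.
Qed.

End radial_integrals.

(** * The law of the population *)

Section sigma_finite_product.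
Local Open Scope ereal_scope.
Context d1 d2 (T1 : measurableType d1) (T2 : measurableType d2) (R : realType).
Variable m1 : {sigma_finite_measure set T1 -> \bar R}.
Variable m2 : {sigma_finite_measure set T2 -> \bar R}.

Let sigma_finite_product : sigma_finite setT (m1 \x m2).
Proof.
have /sigma_finiteP[F [FT ndF Fy]] := sigma_finiteT m1.
have /sigma_finiteP[G [GT ndG Gy]] := sigma_finiteT m2.
exists (fun n => F n `*` G n); last first.
  move=> n; have [mF Foo] := Fy n; have [mG Goo] := Gy n.
  split; first exact: measurableX.
  by rewrite product_measure1E// lte_mul_pinfty// ge0_fin_numE.
apply/seteqP; split => // -[u v] _.
have [i _ Fu] : (\bigcup_i F i) u by rewrite -FT.
have [j _ Gv] : (\bigcup_i G i) v by rewrite -GT.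
exists (maxn i j) => //; split => /=.
- by move: u Fu; apply/subsetPset/ndF; rewrite leq_maxl.
- by move: v Gv; apply/subsetPset/ndG; rewrite leq_maxr.
Qed.

(** Applying the theorem of Fubini and Tonelli to an iterated product requires
    the product measure together with its sigma-finiteness. *)
Definition sigma_finite_prod :
    {sigma_finite_measure set (T1 * T2)%type -> \bar R} :=
  HB.pack_for (sigma_finite_measure (T1 * T2)%type R) (m1 \x m2)
    (Measure_isSigmaFinite.Build _ _ _ (m1 \x m2) sigma_finite_product).

End sigma_finite_product.

Section population_law.
Context {R : realType} d0 (T0 : measurableType d0) (P0 : probability T0 R).
Variables (X : 'I_3 -> {RV P0 >-> R}) (Z : {RV P0 >-> R}).
Hypothesis Z_ge0 : forall w, 0 <= Z w.
Variables (nu : {sigma_finite_measure set R -> \bar R}) (rho : R -> R -> R).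
Hypothesis rho_ge0 : forall r z : R, 0 <= r -> 0 <= z -> 0 <= rho r z.
Hypothesis rho_measurable :
  measurable_fun [set p : R * R | 0 <= p.1 /\ 0 <= p.2]
    (fun p : R * R => rho p.1 p.2).
Hypothesis XZ_density : has_radial_density P0 X Z nu rho.

Local Notation mu := (@lebesgue_measure R).
Local Notation phi := (phi nu rho).
Local Notation Y w := (X 0 w ^+ 2 + X 1 w ^+ 2).

Let Q : set (R * R) := [set p | 0 <= p.1 /\ 0 <= p.2].

Let mQ : measurable Q.
Proof.
rewrite (_ : Q = (fst @^-1` `[0, +oo[) `&` (snd @^-1` `[0, +oo[)).
  apply: measurableI; rewrite -[X in measurable X]setTI.
    by apply: measurable_fst.
  by apply: measurable_snd.
by apply/seteqP; split => p; rewrite /Q /= !in_itv/= !andbT.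
Qed.

Let rhoQ : R * R -> R := (fun p => rho p.1 p.2) \_ Q.

Let mrhoQ : measurable_fun setT rhoQ.
Proof. exact/(measurable_restrictT _ mQ). Qed.

Let rhoQ_ge0 p : 0 <= rhoQ p.
Proof.
rewrite /rhoQ patchE; case: ifPn => //; rewrite inE => -[? ?].
exact: rho_ge0.
Qed.

Let Vec (w : T0) : R * R * R * R := (vec3 (X ^~ w), Z w).

Let mVec : measurable_fun setT Vec.
Proof.
by apply: measurable_fun_pair => //; apply: measurable_fun_pair => //;
  exact: measurable_fun_pair.
Qed.

Let mnorm3 : measurable_fun setT (@norm3 R).
Proof.
apply: measurableT_comp; first exact: measurable_sqrt.
by apply: measurable_funD; [apply: measurable_funD|]; apply: measurable_funX;
  [apply: measurableT_comp|apply: measurableT_comp|].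
Qed.

Let g (p : R * R * R * R) := rhoQ (norm3 p.1, p.2).

Let mg : measurable_fun setT g.
Proof.
apply: measurableT_comp => //; apply: measurable_fun_pair => //.
exact: measurableT_comp.
Qed.

Let g0 p : 0 <= g p. Proof. exact: rhoQ_ge0. Qed.

Let lam4 := (((mu \x mu) \x mu) \x nu)%E.

Let expect_density (f : R * R * R * R -> \bar R) : measurable_fun setT f ->
  (forall p, (0 <= f p)%E) ->
  (\int[P0]_w f (Vec w) = \int[lam4]_p (f p * (g p)%:E))%E.
Proof.
move=> mf f0.
rewrite -(ge0_integral_mdensity lam4 g0 mg)//.
pose S4 : measurableType _ :=
  (measurableTypeR R * measurableTypeR R * measurableTypeR R * R)%type.
have mVecS : measurable_fun setT (Vec : T0 -> S4) by exact: mVec.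
have := @ge0_integral_pushforward _ _ _ S4 R _ mVecS P0 setT f
  measurableT mf (fun y _ => f0 y).
rewrite preimage_setT => <-.
apply: eq_measure_integral => A mA _.
rewrite /pushforward.
rewrite [LHS](XZ_density mA) /= /mdensity integral_mkcondr.
apply: eq_integral => p _; rewrite patchE /g /rhoQ patchE.
case: ifPn => p2.
  rewrite mem_set//; split => /=; first exact: sqrtr_ge0.
  by move: p2; rewrite inE.
by rewrite memNset// => -[_ /= p20]; move/negP: p2; apply; rewrite inE.
Qed.

(** An integrand for phi which is measurable and nonnegative on the whole plane,
    although rho is controlled only on the quadrant. *)
Let phi_kernel (q : R * R) : R := Num.max q.2 0 * rhoQ (Num.sqrt q.1, q.2).

Let phi_kernel_ge0 q : 0 <= phi_kernel q.
Proof. by rewrite mulr_ge0// le_max lexx orbT. Qed.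

Let mphi_kernel : measurable_fun setT phi_kernel.
Proof.
apply: measurable_funM; first exact: measurable_maxr.
apply: measurableT_comp => //; apply: measurable_fun_pair => //.
by apply: measurableT_comp => //; exact: measurable_sqrt.
Qed.

Let phiE v : phi v = (\int[nu]_z (phi_kernel (v, z))%:E)%E.
Proof.
rewrite /Defs.phi integral_mkcond; apply: eq_integral => z _.
rewrite patchE /phi_kernel /rhoQ patchE/=.
case: ifPn => z0.
  have {}z0 : 0 <= z by move: z0; rewrite inE/= in_itv/= andbT.
  by rewrite max_l// mem_set//; split => //; exact: sqrtr_ge0.
rewrite memNset ?mulr0// => -[_/= z1].
by move/negP: z0; apply; rewrite inE/= in_itv/= z1.
Qed.

Lemma phi_ge0 v : (0 <= phi v)%E.
Proof. by rewrite phiE; apply: integral_ge0 => z _; rewrite lee_fin. Qed.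

Lemma measurable_phi : measurable_fun setT phi.
Proof.
rewrite (_ : phi = fubini_F nu (EFin \o phi_kernel)); last first.
  by apply/funext => v; rewrite phiE.
by apply: measurable_fun_fubini_tonelli_F => //; exact/measurable_EFinP.
Qed.

(** Integrating out z turns the density into phi at the squared norm x1^2 + x2^2
    + s^2; the integral over (x1, x2) is then one over v = x1^2 + x2^2. *)
Lemma expect_radial (k : R -> \bar R) : measurable_fun setT k ->
  (forall t, (0 <= k t)%E) ->
  (\int[P0]_w ((Z w)%:E * k (Y w)%R) =
   kap * \int[mu]_(v in `]0%R, +oo[) (k v * \int[mu]_s phi (v + s ^+ 2)%R))%E.
Proof.
move=> mk k0.
pose k3 (q : R * R * R) := k (q.1.1 ^+ 2 + q.1.2 ^+ 2).
have mk3 : measurable_fun setT k3.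
  apply: measurableT_comp => //; apply: measurable_funD; apply: measurable_funX;
   by apply: measurableT_comp.
pose f (p : R * R * R * R) := ((Num.max p.2 0)%:E * k3 p.1)%E.
have mf : measurable_fun setT f.
  apply: emeasurable_funM; last exact: measurableT_comp.
  by apply/measurable_EFinP; exact: measurable_maxr.
have f0 p : (0 <= f p)%E.
  by rewrite mule_ge0// ?lee_fin ?le_max ?lexx ?orbT//; exact: k0.
transitivity (\int[P0]_w f (Vec w))%E.
  apply: eq_integral => w _; rewrite /f/= max_l//.
rewrite (expect_density mf f0).
have mfg : measurable_fun setT (fun p => (f p * (g p)%:E)%E).
  by apply: emeasurable_funM => //; exact/measurable_EFinP.
have fg0 p : (0 <= f p * (g p)%:E)%E by rewrite mule_ge0// lee_fin.
transitivity (\int[(mu \x mu) \x mu]_q \int[nu]_z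
    (f (q, z) * (g (q, z))%:E))%E.
  exact: (@fubini_tonelli1 _ _ _ _ R
    (sigma_finite_prod (sigma_finite_prod mu mu) mu) nu _ mfg fg0).
pose nn (q : R * R * R) := q.1.1 ^+ 2 + q.1.2 ^+ 2 + q.2 ^+ 2.
transitivity (\int[(mu \x mu) \x mu]_q (k3 q * phi (nn q)))%E.
  apply: eq_integral => q _; rewrite phiE -ge0_integralZl//; last 3 first.
  - by apply/measurable_EFinP; exact: measurableT_comp.
  - by move=> z _; rewrite lee_fin.
  - exact: k0.
  apply: eq_integral => z _; rewrite /f/= /phi_kernel/= /g/= [RHS]muleC.
  by rewrite EFinM muleAC.
have mphin : measurable_fun setT (fun q : R * R * R => phi (nn q)).
  apply: measurableT_comp; first exact: measurable_phi.
  apply: measurable_funD; last exact: measurable_funX.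
  by apply: measurable_funD; apply: measurable_funX; apply: measurableT_comp.
have mk3phi : measurable_fun setT (fun q => (k3 q * phi (nn q))%E).
  exact: emeasurable_funM.
have k3phi0 q : (0 <= k3 q * phi (nn q))%E.
  by rewrite mule_ge0 ?phi_ge0//; exact: k0.
transitivity (\int[mu \x mu]_p \int[mu]_s (k3 (p, s) * phi (nn (p, s))))%E.
  exact: (@fubini_tonelli1 _ _ _ _ R (sigma_finite_prod mu mu) mu _ mk3phi k3phi0).
pose G (v : R) := (\int[mu]_s phi (v + s ^+ 2)%R)%E.
have G0 v : (0 <= G v)%E by apply: integral_ge0 => s _; exact: phi_ge0.
have mG : measurable_fun setT G.
  have m1 : measurable_fun setT (fun q : R * R => phi (q.1 + q.2 ^+ 2)).
    apply: measurableT_comp; first exact: measurable_phi.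
    by apply: measurable_funD => //; exact: measurable_funX.
  exact: (measurable_fun_fubini_tonelli_F (m2 := mu) _ m1 (fun q => phi_ge0 _)).
transitivity (\int[mu \x mu]_p (fun v => k v * G v)%E (p.1 ^+ 2 + p.2 ^+ 2)%R)%E.
  apply: eq_integral => p _; rewrite /= -ge0_integralZl//.
  - apply: measurableT_comp; first exact: measurable_phi.
    by apply: measurable_funD => //; exact: measurable_funX.
  - by move=> s _; exact: phi_ge0.
have mkG : measurable_fun setT (fun v => k v * G v)%E by exact: emeasurable_funM.
have mkG2 : measurable_fun setT
    (fun p : R * R => (fun v => k v * G v)%E (p.1 ^+ 2 + p.2 ^+ 2)).
  apply: (@measurableT_comp _ _ _ _ _ _ (fun v => k v * G v)%E) => //.
  by apply: measurable_funD; exact: measurable_funX.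
have kG0 (p : R * R) : (0 <= (fun v => k v * G v) (p.1 ^+ 2 + p.2 ^+ 2)%R)%E.
  by rewrite mule_ge0.
transitivity (\int[mu]_x \int[mu]_y
    (fun v => k v * G v)%E (x ^+ 2 + y ^+ 2)%R)%E.
  exact: (@fubini_tonelli1 _ _ _ _ R mu mu _ mkG2 kG0).
rewrite (@integral_sqrD _ (fun v => k v * G v)%E)//.
by move=> t; rewrite mule_ge0.
Qed.

(** The kernel isq (v - u) substitutes v = u + s'^2, and (s, s') is once more a
    planar variable with a radial integrand. *)
Lemma expect_isq u : 0 <= u ->
  (\int[P0]_w (Z w * isq (Y w - u))%:E =
   kap * (kap * \int[mu]_(t in `]u, +oo[) phi t))%E.
Proof.
move=> u0.
have mi : measurable_fun setT (fun v : R => (isq (v - u))%:E).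
  apply/measurable_EFinP; apply: measurableT_comp; first exact: measurable_isq.
  exact: measurable_funB.
under eq_integral do rewrite EFinM.
rewrite (@expect_radial (fun v => (isq (v - u))%:E))//; last first.
  by move=> v; rewrite lee_fin isq_ge0.
congr (_ * _)%E.
pose G (v : R) := (\int[mu]_s phi (v + s ^+ 2)%R)%E.
have G0 v : (0 <= G v)%E by apply: integral_ge0 => s _; exact: phi_ge0.
have mG : measurable_fun setT G.
  have m1 : measurable_fun setT (fun q : R * R => phi (q.1 + q.2 ^+ 2)).
    apply: measurableT_comp; first exact: measurable_phi.
    by apply: measurable_funD => //; exact: measurable_funX.
  exact: (measurable_fun_fubini_tonelli_F (m2 := mu) _ m1 (fun q => phi_ge0 _)).
have mGu : measurable_fun setT (fun s : R => G (s + u)).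
  by apply: measurableT_comp => //; exact: measurable_funD.
transitivity (\int[mu]_s (G (s + u)%R * (isq s)%:E))%E.
  pose f v := ((isq (v - u))%:E * G v)%E.
  have mf : measurable_fun setT f by exact: (emeasurable_funM mi mG).
  have mf0 : measurable_fun setT (f \_ `]0%R, +oo[) by exact: measurable_patchT.
  have f0 t : (0 <= (f \_ `]0%R, +oo[) t)%E.
    by apply: erestrict_ge0 => v _; rewrite mule_ge0// lee_fin isq_ge0.
  transitivity (\int[mu]_t (f \_ `]0%R, +oo[) (t + u)%R)%E.
    by rewrite integral_mkcond; exact/esym/ge0_integral_shift.
  apply: eq_integral => s _; rewrite patchE /f addrK muleC.
  case: ifPn => //; rewrite notin_setE/= in_itv/= andbT => /negP.
  rewrite -leNgt => s0; rewrite isq_le0 ?mule0//.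
  by rewrite (le_trans _ s0)// lerDl.
rewrite (integral_isq mGu (fun s => G0 (s + u)%R)).
have mphiu : measurable_fun setT (fun t : R => phi (t + u)).
  by apply: measurableT_comp; [exact: measurable_phi|exact: measurable_funD].
transitivity (\int[mu]_x \int[mu]_y (fun t => phi (t + u)%R) (x ^+ 2 + y ^+ 2)%R)%E.
  by apply: eq_integral => x _; apply: eq_integral => y _; rewrite addrAC.
rewrite (@integral_sqrD _ (fun t => phi (t + u)%R) mphiu (fun t => phi_ge0 _)).
suff -> : (\int[mu]_(t in `]u, +oo[) phi t =
  \int[mu]_(t in `]0%R, +oo[) phi (t + u)%R)%E by [].
apply/esym.
rewrite integral_mkcond.
rewrite [in RHS]integral_mkcond.
have mpu : measurable_fun setT (phi \_ `]u, +oo[).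
  by apply: measurable_patchT => //; exact: measurable_phi.
have pu0 t : (0 <= (phi \_ `]u, +oo[) t)%E.
  by apply: erestrict_ge0 => v _; exact: phi_ge0.
transitivity (\int[mu]_t (phi \_ `]u, +oo[) (t + u)%R)%E; last first.
  exact: ge0_integral_shift.
apply: eq_integral => t _; rewrite !patchE; congr (if _ then _ else _).
by apply/idP/idP; rewrite !inE/= !in_itv/= !andbT ltrDr.
Qed.

End population_law.

(** * The population mean of the estimator and its primitive *)

Lemma integral_cst_itv (R : realType) (p q al : R) : p <= q ->
  (\int[@lebesgue_measure R]_(u in `]p, q[) (cst al%:E u) = (al * (q - p))%:E)%E.
Proof.
move=> pq; rewrite integral_cst//= lebesgue_measure_itv/= lte_fin.
move: pq; rewrite le_eqVlt => /predU1P[->|->]; last by rewrite -EFinB EFinM.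
by rewrite ltxx subrr mulr0 mule0.
Qed.

Section population_regularity.
Context {R : realType} d0 (T0 : measurableType d0) (P0 : probability T0 R).
Variables (X : 'I_3 -> {RV P0 >-> R}) (Z : {RV P0 >-> R}).
Hypothesis Z_ge0 : forall w, 0 <= Z w.
Variables (nu : {sigma_finite_measure set R -> \bar R}) (rho : R -> R -> R).
Hypothesis rho_ge0 : forall r z : R, 0 <= r -> 0 <= z -> 0 <= rho r z.
Hypothesis rho_measurable :
  measurable_fun [set p : R * R | 0 <= p.1 /\ 0 <= p.2]
    (fun p : R * R => rho p.1 p.2).
Hypothesis XZ_density : has_radial_density P0 X Z nu rho.
Variable M : R.
Hypothesis M_gt0 : 0 < M.
Hypothesis Z_bounded : {ae P0, forall w, Z w <= M}.

Local Notation mu := (@lebesgue_measure R).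
Local Notation phi := (phi nu rho).
Local Notation Y w := (X 0 w ^+ 2 + X 1 w ^+ 2).
Local Notation kap := (@kap R).

Definition Psi_mean (u : R) := (\int[P0]_w (Z w * isq (Y w - u))%:E)%E.

Let phi0 v : (0 <= phi v)%E. Proof. exact: phi_ge0. Qed.

Let mphi : measurable_fun setT phi. Proof. exact: measurable_phi. Qed.

Let mY : measurable_fun setT (fun w => Y w).
Proof. by apply: measurable_funD; apply: measurable_funX. Qed.

Lemma integral_isq_itv0 (e : R) : 0 <= e ->
  (\int[mu]_(t in `]0%R, e[) (isq t)%:E = (2 * Num.sqrt e)%:E)%E.
Proof.
move=> e0; have := integral_isq_itv e e0.
rewrite subrr sqrtr0 !subr0 => <-.
rewrite integral_mkcond [RHS]integral_mkcond.
rewrite -(@ge0_integral_reflect _ _ e); last 2 first.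
- apply: measurable_patchT => //; apply/measurable_EFinP; exact: measurable_isq.
- by move=> t; apply: erestrict_ge0 => v _; rewrite lee_fin isq_ge0.
apply: eq_integral => t _; rewrite !patchE; congr (if _ then _ else _).
by apply/idP/idP; rewrite !inE/= !in_itv/= => /andP[t0 te]; apply/andP; split; lra.
Qed.

(** The primitive of isq (y - u) in u is explicit, and the expectation commutes
    with the integral of nonnegative functions. *)
Lemma integral_Psi_mean_itv (s t : R) : s <= t ->
  (\int[mu]_(u in `]s, t[) Psi_mean u =
   \int[P0]_w (Z w * (2 * (Num.sqrt (Y w - s) - Num.sqrt (Y w - t))))%:E)%E.
Proof.
move=> st.
pose k (p : R * T0) : \bar R :=
  ((Z p.2)%:E * (isq (Y p.2 - p.1) * \1_`]s, t[ p.1)%:E)%E.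
have mk : measurable_fun setT k.
  apply: emeasurable_funM; first by apply/measurable_EFinP; exact: measurableT_comp.
  apply/measurable_EFinP; apply: measurable_funM.
    apply: measurableT_comp; first exact: measurable_isq.
    by apply: measurable_funB => //; exact: (measurableT_comp mY).
  by apply: measurableT_comp => //; exact: measurable_indic.
have k0 p : (0 <= k p)%E.
  by rewrite mule_ge0 ?lee_fin// mulr_ge0 ?isq_ge0.
transitivity (\int[mu]_u \int[P0]_w k (u, w))%E.
  rewrite integral_mkcond epatch_indic; apply: eq_integral => u _ /=.
  rewrite /Psi_mean -ge0_integralZr//.
  - by apply: eq_integral => w _; rewrite /k/= -!EFinM mulrA.
  - apply/measurable_EFinP; apply: measurable_funM => //.
    apply: measurableT_comp; first exact: measurable_isq.
    exact: measurable_funB.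
  - by move=> w _; rewrite lee_fin mulr_ge0 ?isq_ge0.
rewrite (@fubini_tonelli _ _ _ _ _ mu P0 k)//.
apply: eq_integral => w _; rewrite /k/= ge0_integralZl//.
- rewrite EFinM -integral_isq_itv// [in RHS]integral_mkcond epatch_indic.
  by congr (_ * _)%E; apply: eq_integral => u _; rewrite EFinM.
- apply/measurable_EFinP; apply: measurable_funM => //.
  by apply: measurableT_comp; [exact: measurable_isq|exact: measurable_funB].
- by move=> u _; rewrite lee_fin mulr_ge0 ?isq_ge0.
- by rewrite lee_fin.
Qed.

Lemma sqrtr_holder (y s t : R) : s <= t ->
  Num.sqrt (y - s) - Num.sqrt (y - t) <= Num.sqrt (t - s).
Proof.
move=> st; rewrite lerBlDr.
have a0 := sqrtr_ge0 (t - s); have b0 := sqrtr_ge0 (y - t).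
rewrite -[leRHS]ger0_norm ?addr_ge0// -sqrtr_sqr; apply: ler_wsqrtr.
rewrite sqrrD sqr_sqrtr ?subr_ge0//.
have [yt|yt] := leP t y; first rewrite sqr_sqrtr ?subr_ge0//.
  have : 0 <= Num.sqrt (t - s) * Num.sqrt (y - t) by rewrite mulr_ge0.
  lra.
rewrite (ler0_sqrtr (_ : y - t <= 0)); lra.
Qed.

Let tail (u : R) := (\int[mu]_(t in `]u, +oo[) phi t)%E.

Lemma Psi_meanE u : 0 <= u -> Psi_mean u = (kap * (kap * tail u))%E.
Proof.
exact: (expect_isq Z_ge0 rho_ge0 rho_measurable XZ_density).
Qed.

Lemma tail_nincr (s t : R) : s <= t -> (tail t <= tail s)%E.
Proof.
move=> st; apply: (@ge0_subset_integral _ _ _ mu).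
- by [].
- by [].
- exact: measurable_funTS.
- by move=> v _.
- by move=> u /=; rewrite !in_itv/= !andbT; exact: le_lt_trans.
Qed.

Lemma Psi_mean_nincr (s t : R) : 0 <= s -> s <= t -> (Psi_mean t <= Psi_mean s)%E.
Proof.
move=> s0 st; rewrite (Psi_meanE s0) (Psi_meanE (le_trans s0 st)).
have k0 : (0 <= kap)%E by rewrite ltW// kap_gt0.
by do 2 apply: (lee_wpmul2l k0); exact: tail_nincr.
Qed.

Lemma Psi_mean_ge0 u : (0 <= Psi_mean u)%E.
Proof. by apply: integral_ge0 => w _; rewrite lee_fin mulr_ge0 ?isq_ge0. Qed.

Lemma measurable_Psi_mean : measurable_fun setT Psi_mean.
Proof.
have mf : measurable_fun setT
    (fun p : R * T0 => (Z p.2 * isq (Y p.2 - p.1))%:E).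
  apply/measurable_EFinP; apply: measurable_funM; first exact: measurableT_comp.
  apply: measurableT_comp; first exact: measurable_isq.
  by apply: measurable_funB => //; exact: (measurableT_comp mY).
apply: (measurable_fun_fubini_tonelli_F (m2 := P0) _ mf) => p.
by rewrite lee_fin mulr_ge0 ?isq_ge0.
Qed.

Lemma expect_Z_le (h : R -> \bar R) : measurable_fun setT h ->
  (forall t, (0 <= h t)%E) ->
  (\int[P0]_w ((Z w)%:E * h (Y w)) <= M%:E * \int[P0]_w h (Y w))%E.
Proof.
move=> mh h0.
have mhY : measurable_fun setT (fun w => h (Y w)) by exact: measurableT_comp.
rewrite -ge0_integralZl//; last by rewrite lee_fin ltW.
apply: ae_ge0_le_integral => //.
- by move=> w _; rewrite mule_ge0 ?lee_fin.
- by apply: emeasurable_funM => //; exact/measurable_EFinP.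
- by move=> w _; rewrite mule_ge0// lee_fin ltW.
- exact: emeasurable_funM.
- by apply: filterS Z_bounded => w ZM _; rewrite lee_wpmul2r// lee_fin.
Qed.

Lemma expect_le_cst (f : T0 -> \bar R) (c : R) : measurable_fun setT f ->
  (forall w, (0 <= f w)%E) -> (forall w, (f w <= c%:E)%E) ->
  (\int[P0]_w f w <= c%:E)%E.
Proof.
move=> mf f0 fc; apply: (@le_trans _ _ (\int[P0]_w (cst c%:E w))%E).
  by apply: ge0_le_integral => // w _; rewrite (le_trans (f0 w)).
by rewrite integral_cst// [X in (_ * X)%E]probability_setT mule1.
Qed.

(** A nonincreasing function is, at u, at most its average over ]0, u[, and the
    primitive of Psi_mean is bounded because Z is. *)
Lemma Psi_mean_lty (u : R) : 0 < u -> (Psi_mean u < +oo)%E.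
Proof.
move=> u0.
have : (u%:E * Psi_mean u <= M%:E * (2 * Num.sqrt u)%:E)%E.
  apply: (@le_trans _ _ (\int[mu]_(v in `]0%R, u[) Psi_mean v)%E).
    have -> : (u%:E * Psi_mean u = \int[mu]_(v in `]0%R, u[) Psi_mean u)%E.
      rewrite integral_cst//= lebesgue_measure_itv/= lte_fin u0.
      by rewrite oppr0 addr0 muleC.
    apply: ge0_le_integral => //.
    - move=> v _; apply: integral_ge0 => w _.
      by rewrite lee_fin mulr_ge0 ?isq_ge0.
    - apply: measurable_funTS; exact: measurable_Psi_mean.
    - by move=> v /=; rewrite in_itv/= => /andP[v0 vu]; apply: Psi_mean_nincr; exact: ltW.
  rewrite integral_Psi_mean_itv ?(ltW u0)//.
  pose h (v : R) := (2 * (Num.sqrt (v - 0) - Num.sqrt (v - u)))%:E.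
  have mh : measurable_fun setT h.
    apply/measurable_EFinP; apply: measurable_funM => //.
    by apply: measurable_funB; apply: measurableT_comp;
      [exact: measurable_sqrt|exact: measurable_funB
      |exact: measurable_sqrt|exact: measurable_funB].
  have h0 v : (0 <= h v)%E.
    rewrite lee_fin mulr_ge0// subr_ge0; apply: ler_wsqrtr.
    by rewrite lerD2l lerN2 ltW.
  apply: (@le_trans _ _ (\int[P0]_w ((Z w)%:E * h (Y w)))%E).
    by under eq_integral do rewrite EFinM.
  apply: le_trans (expect_Z_le mh h0) _; apply: lee_wpmul2l.
    by rewrite lee_fin ltW.
  apply: expect_le_cst => [|w|w]; first exact: measurableT_comp.
    exact: h0.
  by rewrite lee_fin ler_pM2l// -[in leRHS](subr0 u); apply: sqrtr_holder; exact: ltW.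
move=> le; rewrite ltey; apply/eqP => py; move: le; rewrite py.
by rewrite gt0_muley ?lte_fin// -EFinM leNgt ltry.
Qed.

Lemma tail_lty (u : R) : 0 < u -> (tail u < +oo)%E.
Proof.
move=> u0; have := Psi_mean_lty u0; rewrite (Psi_meanE (ltW u0)) !ltey; apply: contra => /eqP ->.
by rewrite gt0_muley ?kap_gt0// gt0_muley ?kap_gt0.
Qed.

Variables (x dl pl pu : R).
Hypotheses (dl_gt0 : 0 < dl) (dl_le : 3 * dl <= x) (pl_gt0 : 0 < pl).
Hypothesis phi_near : forall v, `|v - x| < 3 * dl ->
  (pl%:E <= phi v)%E /\ (phi v <= pu%:E)%E.

(** The drop of Psi_mean over ]u, v] is kap^2 times the integral of phi over
    that interval, where phi >= pl. *)
Lemma Psi_mean_decr (u v : R) : x - 3 * dl < u -> u <= v -> v < x + 3 * dl ->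
  (kap * (kap * (pl * (v - u))%:E) + Psi_mean v <= Psi_mean u)%E.
Proof.
move=> xu uv vx.
have u0 : 0 < u by move: dl_gt0 dl_le; lra.
have k0 : (0 <= kap)%E by rewrite ltW// kap_gt0.
have t0 w : (0 <= tail w)%E by exact: integral_ge0.
rewrite (Psi_meanE (ltW u0)) (Psi_meanE (le_trans (ltW u0) uv)).
have pl0 : (0 <= (pl * (v - u))%:E)%E.
  by rewrite lee_fin mulr_ge0 ?subr_ge0 ?(ltW pl_gt0).
rewrite -(ge0_muleDr kap); [|exact: mule_ge0|exact: mule_ge0].
apply: (lee_wpmul2l k0).
rewrite -(ge0_muleDr kap); [|by []|by []].
apply: (lee_wpmul2l k0).
have -> : (pl * (v - u))%:E = (\int[mu]_t (cst pl%:E \_ `]u, v]) t)%E.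
  rewrite -integral_mkcond integral_cst//= lebesgue_measure_itv/= lte_fin.
  move: uv; rewrite le_eqVlt => /predU1P[->|->]; last by rewrite -EFinB EFinM.
  by rewrite ltxx subrr mulr0 mule0.
rewrite /tail [X in (_ + X)%E]integral_mkcond [leRHS]integral_mkcond.
have mc : measurable_fun setT ((cst pl%:E : R -> \bar R) \_ `]u, v]).
  exact: measurable_patchT.
have mv : measurable_fun setT (phi \_ `]v, +oo[) by exact: measurable_patchT.
have mu' : measurable_fun setT (phi \_ `]u, +oo[) by exact: measurable_patchT.
have c0 t : (0 <= ((cst pl%:E : R -> \bar R) \_ `]u, v]) t)%E.
  by apply: erestrict_ge0 => ? _; rewrite lee_fin ltW.
have v0 t : (0 <= (phi \_ `]v, +oo[) t)%E by apply: erestrict_ge0.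
have u0' t : (0 <= (phi \_ `]u, +oo[) t)%E by apply: erestrict_ge0.
rewrite -(ge0_integralD mu measurableT (fun t _ => c0 t) mc (fun t _ => v0 t) mv).
apply: ge0_le_integral => //.
- by move=> t _; apply: adde_ge0.
- exact: emeasurable_funD.
- move=> t _; rewrite !patchE !mem_setE !in_itv/= !andbT.
  have [vt|tv] := ltP v t; first by rewrite andbF (le_lt_trans uv vt) add0e.
  rewrite andbT; case: ifPn => ut; last by rewrite add0e.
  rewrite adde0; apply: (phi_near _).1.
  by rewrite ltr_norml; apply/andP; split; move: dl_gt0 dl_le; lra.
Qed.

Let G (v : R) := (\int[mu]_s phi (v + s ^+ 2)%R)%E.

Let C0 := (2 * pu * Num.sqrt dl + isq dl * fine (tail (x - dl)))%R.

Let G_le v : x - dl < v -> v < x + 2 * dl -> (G v <= C0%:E)%E.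
Proof.
move=> xv vx.
have mphiv : measurable_fun setT (fun t : R => phi (v + t)).
  by apply: measurableT_comp => //; exact: measurable_funD.
have -> : G v = (\int[mu]_t (phi (v + t)%R * (isq t)%:E))%E.
  by rewrite (integral_isq mphiv (fun t => phi0 _)).
have pu0 : 0 <= pu.
  have [|a b] := @phi_near x; first by rewrite subrr normr0 mulr_gt0.
  by rewrite -lee_fin (le_trans _ b).
(* Substituting s^2 = t: next to the singularity t = 0 the local bound on phi
   is used, and for t >= dl the kernel is bounded and phi is integrable. *)
pose f1 := (fun t : R => pu%:E * (isq t)%:E)%E \_ `]0%R, dl[.
pose f2 := (fun t : R => (isq dl)%:E * phi (v + t)%R)%E \_ `]0, +oo[.
have misqE : measurable_fun setT (fun t : R => (isq t)%:E).
  by apply/measurable_EFinP; exact: measurable_isq.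
have mf1 : measurable_fun setT f1.
  by apply: measurable_patchT => //; exact: emeasurable_funM.
have mf2 : measurable_fun setT f2.
  by apply: measurable_patchT => //; exact: emeasurable_funM.
have f10 t : (0 <= f1 t)%E.
  by apply: erestrict_ge0 => w _; rewrite mule_ge0 ?lee_fin ?isq_ge0.
have f20 t : (0 <= f2 t)%E.
  by apply: erestrict_ge0 => w _; rewrite mule_ge0 ?lee_fin ?isq_ge0.
apply: (@le_trans _ _ (\int[mu]_t (f1 t + f2 t))%E).
  apply: ge0_le_integral => //.
  - by move=> t _; rewrite mule_ge0 ?lee_fin ?isq_ge0.
  - exact: emeasurable_funM.
  - exact: emeasurable_funD.
  - move=> t _; have [t0|t0] := leP t 0.
      by rewrite isq_le0// mule0 adde_ge0.
    have [td|td] := ltP t dl.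
      rewrite -[leLHS]adde0; apply: leeD; last exact: f20.
      rewrite /f1 patchE mem_set/= ?in_itv/= ?t0//; apply: lee_wpmul2r.
        by rewrite lee_fin isq_ge0.
      by apply: (phi_near _).2; rewrite ltr_norml; apply/andP; split; move: dl_gt0 dl_le; lra.
    rewrite -[leLHS]add0e; apply: leeD; first exact: f10.
    rewrite /f2 patchE mem_set/= ?in_itv/= ?t0// muleC; apply: lee_wpmul2r => //.
    by rewrite lee_fin; exact: isq_nincr.
rewrite (ge0_integralD mu measurableT (fun t _ => f10 t) mf1 (fun t _ => f20 t) mf2).
rewrite /C0 EFinD; apply: leeD.
  rewrite /f1 -integral_mkcond ge0_integralZl//.
  - by rewrite integral_isq_itv0 ?(ltW dl_gt0)// -EFinM lee_fin mulrCA mulrA.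
  - exact: measurable_funTS.
  - by move=> t _; rewrite lee_fin isq_ge0.
rewrite EFinM fineK; last first.
  by rewrite ge0_fin_numE ?integral_ge0// tail_lty//; move: dl_gt0 dl_le; lra.
have isq0 : (0 <= (isq dl)%:E)%E by rewrite lee_fin isq_ge0.
have mD : measurable (`]0, +oo[%classic : set (measurableTypeR R)) by [].
have mphiv0 : measurable_fun (`]0, +oo[%classic : set (measurableTypeR R)) (fun t : R => phi (v + t)).
  exact: measurable_funTS.
rewrite /f2 -integral_mkcond.
rewrite (ge0_integralZl mu mD mphiv0 (fun t _ => phi0 _) isq0).
- apply: lee_wpmul2l; first by rewrite lee_fin isq_ge0.
  have -> : (\int[mu]_(t in `]0%R, +oo[) phi (v + t)%R = tail v)%E.
    rewrite /tail integral_mkcond [in RHS]integral_mkcond.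
    have mt : measurable_fun setT (phi \_ `]v, +oo[) by exact: measurable_patchT.
    rewrite -(ge0_integral_shift v mt (fun t => erestrict_ge0 (fun t _ => phi0 t) t)).
    apply: eq_integral => t _; rewrite !patchE !mem_setE !in_itv/= !andbT.
    by rewrite ltrDr addrC.
  exact: tail_nincr (ltW xv).
Qed.

(** A bound on the density kap * G of the Z-weighted law of Y on ]x - dl, x + 2
    dl[. The interval extends further to the right because the truncated kernels
    at u in [x - dl, x + dl] charge ]u, u + dl[. *)
Definition weighted_density_bound := fine kap * C0.

(** By expect_radial the Z-weighted law of Y has the density kap * G. *)
Lemma expect_local (k : R -> \bar R) : measurable_fun setT k ->
  (forall t, (0 <= k t)%E) ->
  (forall t, ~ (x - dl < t < x + 2 * dl) -> k t = 0%E) ->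
  (\int[P0]_w ((Z w)%:E * k (Y w)) <=
   weighted_density_bound%:E * \int[mu]_v k v)%E.
Proof.
move=> mk k0 ksupp.
rewrite (expect_radial Z_ge0 rho_ge0 rho_measurable XZ_density mk k0).
rewrite /weighted_density_bound EFinM fineK ?kap_fin// -muleA.
apply: lee_wpmul2l; first by rewrite ltW// kap_gt0.
have C00 : (0 <= C0%:E)%E.
  apply: le_trans (G_le (v := x) _ _); [exact: integral_ge0|move: dl_gt0; lra|move: dl_gt0; lra].
have mG : measurable_fun setT G.
  have m1 : measurable_fun setT (fun q : R * R => phi (q.1 + q.2 ^+ 2)).
    apply: measurableT_comp; first exact: measurable_phi.
    by apply: measurable_funD => //; exact: measurable_funX.
  exact: (measurable_fun_fubini_tonelli_F (m2 := mu) _ m1 (fun q => phi0 _)).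
have G0 v : (0 <= G v)%E by exact: integral_ge0.
rewrite -(ge0_integralZl mu measurableT mk (fun t _ => k0 t) C00) [leLHS]integral_mkcond.
have mkG := emeasurable_funM mk mG.
apply: ge0_le_integral => //.
- by move=> v _; apply: erestrict_ge0 => w _; apply: mule_ge0; [exact: k0|exact: G0].
- exact: measurable_patchT.
- exact: emeasurable_funM.
- move=> v _; rewrite patchE; case: ifPn => _; last first.
    by apply: mule_ge0; [exact: C00|exact: k0].
  have [vin|vnin] := pselect (x - dl < v < x + 2 * dl).
    rewrite muleC; apply: lee_wpmul2r; first exact: k0.
    by case/andP: vin => ? ?; exact: G_le.
  by rewrite ksupp// mul0e mule0.
Qed.

End population_regularity.

Section population_curves.
Context {R : realType} d0 (T0 : measurableType d0) (P0 : probability T0 R).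
Variables (X : 'I_3 -> {RV P0 >-> R}) (Z : {RV P0 >-> R}).
Hypothesis Z_ge0 : forall w, 0 <= Z w.
Variable M : R.
Hypothesis M_gt0 : 0 < M.
Hypothesis Z_bounded : {ae P0, forall w, Z w <= M}.

Local Notation mu := (@lebesgue_measure R).
Local Notation Y w := (X 0 w ^+ 2 + X 1 w ^+ 2).

Definition U_weight (s y : R) : R := 2 * (Num.sqrt y - Num.sqrt (y - s)).

Definition U_mean (s : R) : R := fine (\int[P0]_w (Z w * U_weight s (Y w))%:E)%E.

Lemma measurable_U_weight s : measurable_fun setT (U_weight s).
Proof.
apply: measurable_funM => //; apply: measurable_funB; first exact: measurable_sqrt.
by apply: measurableT_comp; [exact: measurable_sqrt|exact: measurable_funB].
Qed.

Lemma U_weight_ge0 s y : 0 <= s -> 0 <= U_weight s y.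
Proof.
by move=> s0; rewrite mulr_ge0// subr_ge0; apply: ler_wsqrtr; rewrite lerBlDr lerDl.
Qed.

Let mY : measurable_fun setT (fun w => Y w).
Proof. by apply: measurable_funD; apply: measurable_funX. Qed.

Let U_increment_lt (s t : R) : 0 <= s -> s <= t ->
  (\int[P0]_w (Z w * (U_weight t (Y w) - U_weight s (Y w)))%:E <=
   (2 * M * Num.sqrt (t - s))%:E)%E.
Proof.
move=> s0 st.
pose h (y : R) := (U_weight t y - U_weight s y)%:E.
have mh : measurable_fun setT h.
  by apply/measurable_EFinP; apply: measurable_funB; exact: measurable_U_weight.
have hE y : U_weight t y - U_weight s y = 2 * (Num.sqrt (y - s) - Num.sqrt (y - t)).
  by rewrite /U_weight; ring.
have h0 y : (0 <= h y)%E.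
  rewrite lee_fin hE mulr_ge0// subr_ge0; apply: ler_wsqrtr.
  by rewrite lerD2l lerN2.
apply: (@le_trans _ _ (\int[P0]_w ((Z w)%:E * h (Y w)))%E).
  by under eq_integral do rewrite EFinM.
apply: le_trans (expect_Z_le X Z_ge0 M_gt0 Z_bounded mh h0) _.
rewrite (_ : 2 * M * _ = M * (2 * Num.sqrt (t - s)))%R; last by ring.
rewrite EFinM; apply: lee_wpmul2l; first by rewrite lee_fin ltW.
apply: expect_le_cst => [|w|w]; first exact: measurableT_comp.
  exact: h0.
by rewrite lee_fin hE ler_pM2l//; exact: sqrtr_holder.
Qed.

Lemma U_meanE s : 0 <= s ->
  (\int[P0]_w (Z w * U_weight s (Y w))%:E = (U_mean s)%:E)%E.
Proof.
move=> s0; rewrite fineK// ge0_fin_numE; last first.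
  by apply: integral_ge0 => w _; rewrite lee_fin mulr_ge0 ?U_weight_ge0.
have /= := U_increment_lt (lexx 0) s0.
have U0 y : U_weight 0 y = 0 by rewrite /U_weight subr0 subrr mulr0.
under eq_integral do rewrite U0 subr0.
by move=> /le_lt_trans; apply; exact: ltry.
Qed.

Let mZU s : measurable_fun setT (fun w => (Z w * U_weight s (Y w))%:E).
Proof.
apply/measurable_EFinP; apply: measurable_funM => //.
by apply: measurableT_comp mY; exact: measurable_U_weight.
Qed.

Lemma U_mean_increment s t : 0 <= s -> s <= t ->
  (\int[mu]_(u in `]s, t[) Psi_mean X Z u = (U_mean t - U_mean s)%:E)%E.
Proof.
move=> s0 st; rewrite integral_Psi_mean_itv// EFinB -(U_meanE (le_trans s0 st)).
rewrite [X in _ = (X - _)%E](_ : _ = \int[P0]_w (Z w * (2 *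
    (Num.sqrt (Y w - s) - Num.sqrt (Y w - t))))%:E + (U_mean s)%:E)%E ?addeK//.
rewrite -(U_meanE s0) -ge0_integralD//.
- by apply: eq_integral => w _; rewrite -EFinD /U_weight; congr EFin; ring.
- move=> w _; rewrite lee_fin mulr_ge0// mulr_ge0// subr_ge0; apply: ler_wsqrtr.
  by rewrite lerD2l lerN2.
- apply/measurable_EFinP; apply: measurable_funM => //; apply: measurable_funM => //.
  by apply: measurable_funB; apply: measurableT_comp;
     [exact: measurable_sqrt|exact: measurable_funB
     |exact: measurable_sqrt|exact: measurable_funB].
- by move=> w _; rewrite lee_fin mulr_ge0 ?U_weight_ge0.
Qed.

Lemma U_mean_holder s t : 0 <= s -> s <= t ->
  0 <= U_mean t - U_mean s <= 2 * M * Num.sqrt (t - s).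
Proof.
move=> s0 st; apply/andP; split; rewrite -lee_fin -U_mean_increment//.
  by apply: integral_ge0 => u _; exact: Psi_mean_ge0.
rewrite integral_Psi_mean_itv//; apply: le_trans (U_increment_lt s0 st).
rewrite le_eqVlt; apply/orP; left; apply/eqP; apply: eq_integral => w _.
by rewrite /U_weight; congr (_%:E); ring.
Qed.

Variables (nu : {sigma_finite_measure set R -> \bar R}) (rho : R -> R -> R).
Hypothesis rho_ge0 : forall r z : R, 0 <= r -> 0 <= z -> 0 <= rho r z.
Hypothesis rho_measurable :
  measurable_fun [set p : R * R | 0 <= p.1 /\ 0 <= p.2]
    (fun p : R * R => rho p.1 p.2).
Hypothesis XZ_density : has_radial_density P0 X Z nu rho.

Local Notation psi u := (fine (Psi_mean X Z u)).

Lemma Psi_meanK u : 0 < u -> Psi_mean X Z u = (psi u)%:E.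
Proof.
move=> u0; rewrite fineK// ge0_fin_numE ?Psi_mean_ge0//.
exact: (Psi_mean_lty Z_ge0 rho_ge0 rho_measurable XZ_density M_gt0 Z_bounded).
Qed.

Lemma fine_Psi_mean_ge0 u : 0 <= psi u.
Proof. by apply: fine_ge0; exact: Psi_mean_ge0. Qed.

Let nincr := Psi_mean_nincr Z_ge0 rho_ge0 rho_measurable XZ_density.

Let mPsi (s t : R) : measurable_fun (`]s, t[%classic : set R) (Psi_mean X Z).
Proof. by apply: measurable_funTS; exact: measurable_Psi_mean. Qed.

Lemma U_mean_increment_le s t : 0 < s -> s <= t ->
  U_mean t - U_mean s <= psi s * (t - s).
Proof.
move=> s0 st; rewrite -lee_fin -integral_cst_itv// -U_mean_increment ?(ltW s0)//.
apply: ge0_le_integral => //.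
- by move=> u _; exact: Psi_mean_ge0.
- exact: mPsi.
- move=> u /=; rewrite in_itv/= => /andP[su _].
  by rewrite -Psi_meanK//; apply: nincr; exact: ltW.
Qed.

Lemma U_mean_increment_ge s t : 0 <= s -> s <= t -> 0 < t ->
  psi t * (t - s) <= U_mean t - U_mean s.
Proof.
move=> s0 st t0; rewrite -lee_fin -integral_cst_itv// -U_mean_increment//.
apply: ge0_le_integral => //.
- by move=> u _; rewrite lee_fin fine_Psi_mean_ge0.
- exact: mPsi.
- move=> u /=; rewrite in_itv/= => /andP[su ut].
  by rewrite -Psi_meanK//; apply: nincr; [exact: le_trans (ltW su)|exact: ltW].
Qed.

Variables (x e pl pu : R).
Hypotheses (e_gt0 : 0 < e) (e_le : 3 * e <= x) (pl_gt0 : 0 < pl).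
Hypothesis phi_near : forall v, `|v - x| < 3 * e ->
  (pl%:E <= phi nu rho v)%E /\ (phi nu rho v <= pu%:E)%E.

(** Psi_mean decreases at a rate of at least twice this number near x. *)
Definition slope : R := fine (@kap R) ^+ 2 * pl / 2.

Lemma slope_gt0 : 0 < slope.
Proof.
rewrite divr_gt0// mulr_gt0// exprn_gt0// -lte_fin fineK ?kap_fin//.
exact: kap_gt0.
Qed.

Lemma fine_Psi_mean_decr u v : x - e <= u -> u <= v -> v <= x + e ->
  2 * slope * (v - u) <= psi u - psi v.
Proof.
move=> xu uv vx; have e0 := e_gt0; have ex := e_le.
have u0 : 0 < u by lra.
have v0 : 0 < v by exact: lt_le_trans uv.
have xu' : x - 3 * e < u by lra.
have vx' : v < x + 3 * e by lra.
have := Psi_mean_decr Z_ge0 rho_ge0 rho_measurable XZ_density e_gt0 e_le pl_gt0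
  phi_near xu' uv vx'.
rewrite (Psi_meanK u0) (Psi_meanK v0) -(fineK (@kap_fin R)) -!EFinM -EFinD lee_fin.
move=> H; rewrite lerBrDr; apply: le_trans H.
by rewrite lerD2r /slope le_eqVlt; apply/orP; left; apply/eqP; field.
Qed.

Let c := slope.

(** The function psi is nonincreasing everywhere and strictly decreasing near x.
    Between t, within e / 2 of x, and s, beyond distance e, lies the point at
    distance 3 e / 4; past it psi has moved away from psi(t) by at least c e /
    2, and this persists over a length of at least e / 4. *)
Lemma U_mean_below be s t : 4 * be <= e -> 0 <= s -> e < `|s - x| ->
  `|t - x| <= 2 * be ->
  U_mean s - U_mean t - psi t * (s - t) <= - (2 * (c * e ^+ 2 / 16)).
Proof.
move=> bee s0 se; rewrite ler_norml => /andP[t1 t2].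
have e0 := e_gt0; have ex := e_le; have c0 : 0 < c := slope_gt0.
have main a b : e / 4 <= a -> e / 4 <= b -> c * e ^+ 2 / 8 <= 2 * c * a * b.
  move=> ha hb; have : (e / 4) * (e / 4) <= a * b by apply: ler_pM => //; lra.
  move=> /(ler_wpM2l (_ : 0 <= 2 * c)); rewrite (_ : 2 * c * (_ * _) = c * e ^+ 2 / 8); last by field.
  by rewrite -(mulrA (2 * c)); apply; lra.
move: se; rewrite lter_normr => /orP[] se.
  pose m := x + 3 * e / 4.
  have h1 : U_mean s - U_mean m <= psi m * (s - m).
    by apply: U_mean_increment_le; rewrite /m; lra.
  have h2 : U_mean m - U_mean t <= psi t * (m - t).
    by apply: U_mean_increment_le; rewrite /m; lra.
  have h3 : 2 * c * (m - t) <= psi t - psi m.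
    by apply: fine_Psi_mean_decr; rewrite /m; lra.
  have h4 : c * e ^+ 2 / 8 <= 2 * c * (m - t) * (s - m).
    by apply: main; rewrite /m; lra.
  have h5 : 2 * c * (m - t) * (s - m) <= (psi t - psi m) * (s - m).
    by apply: ler_wpM2r h3; rewrite /m; lra.
  lra.
pose m := x - 3 * e / 4.
have h1 : psi m * (m - s) <= U_mean m - U_mean s.
  by apply: U_mean_increment_ge; rewrite /m; lra.
have h2 : psi t * (t - m) <= U_mean t - U_mean m.
  by apply: U_mean_increment_ge; rewrite /m; lra.
have h3 : 2 * c * (t - m) <= psi m - psi t.
  by apply: fine_Psi_mean_decr; rewrite /m; lra.
have h4 : c * e ^+ 2 / 8 <= 2 * c * (t - m) * (m - s).
  by apply: main; rewrite /m; lra.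
have h5 : 2 * c * (t - m) * (m - s) <= (psi m - psi t) * (m - s).
  by apply: ler_wpM2r h3; rewrite /m; lra.
lra.
Qed.

(** Since psi(t) >= psi(t) - psi(x + e) >= c e, the line of slope psi(t)
    outgrows the square root once s >= 2 t and sqrt s >= 4 M / (c e). *)
Lemma far_bound_below be s t : 4 * be <= e -> 4 * x <= s ->
  (4 * M / (c * e)) ^+ 2 <= s -> `|t - x| <= 2 * be ->
  2 * M * Num.sqrt s <= psi t * (s - t).
Proof.
move=> bee xs Ms; rewrite ler_norml => /andP[t1 t2].
have e0 := e_gt0; have ex := e_le; have c0 : 0 < c := slope_gt0.
have s0 : 0 <= s by lra.
have h1 : 2 * c * (x + e - t) <= psi t - psi (x + e).
  by apply: fine_Psi_mean_decr; lra.
have h2 := fine_Psi_mean_ge0 (x + e).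
have h3 : c * e <= psi t.
  have te : e / 2 <= x + e - t by lra.
  have : c * e <= 2 * c * (x + e - t).
    rewrite (_ : c * e = 2 * c * (e / 2)); last by field.
    by apply: ler_wpM2l te; lra.
  lra.
have ce0 : 0 < c * e by rewrite mulr_gt0.
have h4 : c * e * (s / 2) <= psi t * (s - t).
  by apply: ler_pM; [exact: ltW|lra|exact: h3|lra].
apply: le_trans h4.
have h5 : 4 * M / (c * e) <= Num.sqrt s.
  rewrite -(@ler_pXn2r _ 2)// ?nnegrE ?sqrtr_ge0 ?sqr_sqrtr//.
  by rewrite divr_ge0 ?(ltW ce0)// mulr_ge0// ltW.
rewrite ler_pdivrMr// in h5.
have : 4 * M * Num.sqrt s <= Num.sqrt s * (c * e) * Num.sqrt s.
  by rewrite ler_wpM2r ?sqrtr_ge0.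
rewrite (_ : Num.sqrt s * (c * e) * Num.sqrt s = (c * e) * Num.sqrt s ^+ 2); last by ring.
by rewrite sqr_sqrtr//; lra.
Qed.

End population_curves.

(** * Means over an independent sample *)

Section transfer.
Context d d' (T : measurableType d) (S : measurableType d') (R : realType).
Local Open Scope ereal_scope.

Lemma same_law_integral d0 (T0 : measurableType d0)
    (P : probability T R) (V : T -> S) (P0 : probability T0 R) (V0 : T0 -> S)
    (h : S -> \bar R) :
  measurable_fun setT V -> measurable_fun setT V0 -> same_law P V P0 V0 ->
  measurable_fun setT h -> (forall s, 0 <= h s) ->
  \int[P]_w h (V w) = \int[P0]_w h (V0 w).
Proof.
move=> mV mV0 VV0 mh h0.
have := @ge0_integral_pushforward _ _ _ _ _ _ mV P setT h
  measurableT mh (fun y _ => h0 y).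
have := @ge0_integral_pushforward _ _ _ _ _ _ mV0 P0 setT h
  measurableT mh (fun y _ => h0 y).
rewrite !preimage_setT => <- <-; apply: eq_measure_integral => A mA _.
exact: VV0.
Qed.

(** The measure with density w has, as its image under V, the multiple by c of
    the law of V. *)
Lemma weighted_integral (P : probability T R) (V : T -> S) (w : T -> R) (c : R)
    (h : S -> \bar R) : (0 <= c)%R ->
  measurable_fun setT V -> measurable_fun setT w -> (forall t, (0 <= w t)%R) ->
  (forall A, measurable A ->
    \int[P]_(t in V @^-1` A) (w t)%:E = c%:E * P (V @^-1` A)) ->
  measurable_fun setT h -> (forall s, 0 <= h s) ->
  \int[P]_t (h (V t) * (w t)%:E) = c%:E * \int[P]_t h (V t).
Proof.
move=> c0 mV mw w0 wE mh h0.
rewrite -(@ge0_integral_mdensity _ _ _ P w w0 mw (h \o V)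
  (measurableT_comp mh mV) (fun t => h0 (V t))).
have := @ge0_integral_pushforward _ _ _ _ _ _ mV (mdensity P w0 mw) setT h
  measurableT mh (fun y _ => h0 y).
have := @ge0_integral_pushforward _ _ _ _ _ _ mV P setT h
  measurableT mh (fun y _ => h0 y).
rewrite !preimage_setT => <- <-.
have /= <- := @ge0_integral_mscale _ _ R (pushforward P V) setT
  measurableT (NngNum c0) h mh (fun y _ => h0 y).
by apply: eq_measure_integral => A mA _; exact: wE.
Qed.

End transfer.

Section independent_pair.
Context d d1 d2 (T : measurableType d) (S1 : measurableType d1)
  (S2 : measurableType d2) (R : realType) (P : probability T R).
Local Open Scope ereal_scope.

(** The previous lemma, with c = E[f (V1)], reduces the product formula to the
    integrals of f (V1) over events of V2; on such an event it applies a second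
    time, with an indicator as the weight. *)
Lemma independent_pair_integral (V1 : T -> S1) (V2 : T -> S2)
    (f : S1 -> R) (g : S2 -> R) :
  measurable_fun setT V1 -> measurable_fun setT V2 ->
  (forall A B, measurable A -> measurable B ->
    P (V1 @^-1` A `&` V2 @^-1` B) = P (V1 @^-1` A) * P (V2 @^-1` B)) ->
  measurable_fun setT f -> measurable_fun setT g ->
  (forall s, (0 <= f s)%R) -> (forall s, (0 <= g s)%R) ->
  \int[P]_t (f (V1 t))%:E < +oo ->
  \int[P]_t (f (V1 t) * g (V2 t))%:E =
  \int[P]_t (f (V1 t))%:E * \int[P]_t (g (V2 t))%:E.
Proof.
move=> mV1 mV2 VV mf mg f0 g0 fy.
have mpre d' (S : measurableType d') (V : T -> S) B :
    measurable_fun setT V -> measurable B -> measurable (V @^-1` B).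
  by move=> mV mB; rewrite -[X in measurable X]setTI; exact: mV.
have mfV : measurable_fun setT (fun t => f (V1 t)) by exact: measurableT_comp.
set c := \int[P]_t (f (V1 t))%:E in fy *.
have c0 : 0 <= c by apply: integral_ge0 => t _; rewrite lee_fin.
have cE : c = (fine c)%:E by rewrite fineK// ge0_fin_numE.
transitivity (\int[P]_t ((g (V2 t))%:E * (f (V1 t))%:E)).
  by apply: eq_integral => t _; rewrite muleC -EFinM.
rewrite cE (@weighted_integral _ _ _ _ _ P V2 (f \o V1) (fine c) (EFin \o g))//.
- exact: fine_ge0.
- by move=> t; exact: f0.
- move=> B mB; rewrite -cE /=.
  have mB' := mpre _ _ _ _ mV2 mB.
  have := @weighted_integral _ _ _ _ _ P V1 \1_(V2 @^-1` B)
    (fine (P (V2 @^-1` B))) (EFin \o f).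
  rewrite fineK ?fin_num_measure//= -/c muleC => <-//.
  + by rewrite integral_mkcond epatch_indic.
  + exact: fine_ge0.
  + move=> A mA; have mA' := mpre _ _ _ _ mV1 mA.
    rewrite integral_indic//.
    by have := VV A B mA mB; rewrite setIC muleC.
  + exact/measurable_EFinP.
- exact/measurable_EFinP.
Qed.

End independent_pair.

Section sample_mean.
Context d d' d0 (T : measurableType d) (S : measurableType d')
  (T0 : measurableType d0) (R : realType).
Variables (P : probability T R) (V : nat -> T -> S).
Variables (P0 : probability T0 R) (V0 : T0 -> S).
Hypothesis mV : forall i, measurable_fun setT (V i).
Hypothesis mV0 : measurable_fun setT V0.
Hypothesis law : forall i, same_law P (V i) P0 V0.
Hypothesis indep : mutually_independent P V.
Local Open Scope ereal_scope.

Definition sample_mean (f : S -> R) n w := (n%:R^-1 * \sum_(i < n) f (V i w))%R.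

Let pair_indep i j A B : i != j -> measurable A -> measurable B ->
  P (V i @^-1` A `&` V j @^-1` B) = P (V i @^-1` A) * P (V j @^-1` B).
Proof.
move=> ij mA mB.
have := indep (J := [:: i; j]) (A := fun k => if k == i then A else B).
rewrite /= inE ij => /(_ isT); rewrite !big_cons big_nil eqxx mule1.
rewrite (eq_sym j i) (negbTE ij) => <-; last by move=> k; case: ifP.
congr (P _); apply/seteqP; split => w /=.
  move=> [wi wj] k /=; rewrite !inE => /orP[/eqP->|/eqP->]; first by rewrite eqxx.
  by rewrite eq_sym (negbTE ij).
move=> h; split.
  by have := h i; rewrite /= !inE eqxx /=; apply.
by have := h j; rewrite /= !inE eqxx orbT /= eq_sym (negbTE ij); apply.
Qed.

Let integral_sum (I : Type) (r : seq I) (F : I -> T -> R) :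
  (forall i, measurable_fun setT (F i)) -> (forall i w, (0 <= F i w)%R) ->
  \int[P]_w (\sum_(i <- r) F i w)%:E = \sum_(i <- r) \int[P]_w (F i w)%:E.
Proof.
move=> mF F0; under eq_integral do rewrite -sumEFin.
rewrite ge0_integral_sum//.
- by move=> i; apply/measurable_EFinP.
- by move=> i w _; rewrite lee_fin.
Qed.

Variables (f : S -> R) (m : R).
Hypothesis mf : measurable_fun setT f.
Hypothesis f0 : forall s, (0 <= f s)%R.
Hypothesis fm : \int[P0]_w (f (V0 w))%:E = m%:E.

Let mfV i : measurable_fun setT (fun w => f (V i w)).
Proof. exact: measurableT_comp. Qed.

Let expect_f i : \int[P]_w (f (V i w))%:E = m%:E.
Proof.
rewrite -fm.
apply: (@same_law_integral _ _ _ _ _ _ _ P (V i) P0 V0 (EFin \o f)) => //.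
exact/measurable_EFinP.
Qed.

Lemma sample_mean_ge0 n w : (0 <= sample_mean f n w)%R.
Proof. by rewrite mulr_ge0// ?invr_ge0// sumr_ge0. Qed.

Let m_ge0 : (0 <= m)%R.
Proof. by rewrite -lee_fin -fm integral_ge0// => w _; rewrite lee_fin. Qed.

Let expect_sum n : \int[P]_w (\sum_(i < n) f (V i w))%:E = (n%:R * m)%:E.
Proof.
rewrite [LHS](@integral_sum _ _ (fun (i : 'I_n) w => f (V i w)))//.
rewrite (eq_bigr (fun=> m%:E)); last by move=> i _; exact: expect_f.
by rewrite sumEFin sumr_const card_ord mulr_natl.
Qed.

Lemma sample_mean_expectation n : (0 < n)%N ->
  \int[P]_w (sample_mean f n w)%:E = m%:E.
Proof.
move=> n0; under eq_integral do rewrite EFinM.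
rewrite ge0_integralZl//.
- by rewrite expect_sum -EFinM mulKf// pnatr_eq0 -lt0n.
- by apply/measurable_EFinP; exact: measurable_sum.
- by move=> w _; rewrite lee_fin sumr_ge0.
Qed.

(** The cross terms of the expanded square equal m^2 by independence and the
    diagonal terms are at most s. *)
Lemma sample_mean_variance (s : R) n : (0 < n)%N ->
  \int[P0]_w (f (V0 w) ^+ 2)%:E <= s%:E ->
  \int[P]_w ((sample_mean f n w - m) ^+ 2)%:E <= (n%:R^-1 * s)%:E.
Proof.
move=> n0 fs.
pose Sn w := (\sum_(i < n) f (V i w))%R.
have mSn : measurable_fun setT Sn by exact: measurable_sum.
have Sn0 w : (0 <= Sn w)%R by rewrite sumr_ge0.
have nR : (n%:R != 0 :> R)%R by rewrite pnatr_eq0 -lt0n.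
have expect_ff (i j : 'I_n) : \int[P]_w (f (V i w) * f (V j w))%:E <=
    ((i == j)%:R * s + m ^+ 2)%:E.
  have [->|ij] := eqVneq i j.
    apply: (@le_trans _ _ s%:E); last by rewrite mul1r lee_fin lerDl sqr_ge0.
    apply: le_trans fs; rewrite le_eqVlt; apply/orP; left; apply/eqP.
    rewrite (@same_law_integral _ _ _ _ _ _ _ P (V j) P0 V0
      (fun s => (f s * f s)%:E))//.
    - by apply/measurable_EFinP; exact: measurable_funM.
    - by move=> t; rewrite lee_fin mulr_ge0.
  rewrite mul0r add0r independent_pair_integral//.
  - by rewrite !expect_f -EFinM -expr2.
  - by move=> A B mA mB; exact: pair_indep.
  - by rewrite expect_f ltry.
have expect_Sn2 : \int[P]_w (Sn w ^+ 2)%:E <= (n%:R * s + n%:R ^+ 2 * m ^+ 2)%:E.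
  rewrite (_ : (fun w => _) =
    (fun w => (\sum_(i < n) \sum_(j < n) f (V i w) * f (V j w))%:E)); last first.
    apply/funext => w; rewrite expr2 /Sn mulr_suml.
    by congr EFin; apply: eq_bigr => i _; rewrite mulr_sumr.
  rewrite [leLHS](@integral_sum _ _
    (fun (i : 'I_n) w => \sum_(j < n) f (V i w) * f (V j w))%R).
  - apply: (@le_trans _ _ (\sum_(i < n) (s + n%:R * m ^+ 2)%:E)); last first.
      rewrite sumEFin sumr_const card_ord lee_fin -mulr_natl; lra.
    apply: lee_sum => i _.
    rewrite [leLHS](@integral_sum _ _ (fun (j : 'I_n) w => f (V i w) * f (V j w))%R).
    + apply: (@le_trans _ _ (\sum_(j < n) ((i == j)%:R * s + m ^+ 2)%:E)).
        by apply: lee_sum => j _; exact: expect_ff.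
      rewrite sumEFin lee_fin big_split/= sumr_const card_ord.
      rewrite (bigD1 i)//= eqxx mul1r big1 ?addr0 ?mulr_natl// => j ji.
      by rewrite eq_sym (negbTE ji) mul0r.
    + by move=> j; exact: measurable_funM.
    + by move=> j w; rewrite mulr_ge0.
  - by move=> i; apply: measurable_sum => j; exact: measurable_funM.
  - by move=> i w; apply: sumr_ge0 => j _; rewrite mulr_ge0.
pose v := \int[P]_w ((Sn w - n%:R * m) ^+ 2)%:E.
have mv : measurable_fun setT (fun w => (Sn w - n%:R * m) ^+ 2)%R.
  by apply: measurable_funX; exact: measurable_funB.
(* The identity (S - n m)^2 + 2 n m S = S^2 + (n m)^2 has nonnegative terms
   only, so that it can be integrated without discussing integrability. *)
have v_eq : v + (2 * (n%:R * m) * (n%:R * m))%:E <=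
    (n%:R * s + n%:R ^+ 2 * m ^+ 2)%:E + ((n%:R * m) ^+ 2)%:E.
  have nm0 : (0 <= 2 * (n%:R * m))%R by rewrite !mulr_ge0.
  apply: (@le_trans _ _ (\int[P]_w ((Sn w ^+ 2)%:E + ((n%:R * m) ^+ 2)%:E))).
    have -> : (2 * (n%:R * m) * (n%:R * m))%:E =
        \int[P]_w ((2 * (n%:R * m)) * Sn w)%:E.
      under eq_integral do rewrite EFinM.
      rewrite ge0_integralZl//; first by rewrite expect_sum -EFinM.
        exact/measurable_EFinP.
      by move=> w _; rewrite lee_fin.
    rewrite /v -ge0_integralD//.
    - apply: ge0_le_integral => //.
      + by move=> w _; rewrite -EFinD lee_fin addr_ge0 ?sqr_ge0// mulr_ge0.
      + by apply: emeasurable_funD; apply/measurable_EFinP => //;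
          exact: measurable_funM.
      + by apply: emeasurable_funD => //; apply/measurable_EFinP; exact: measurable_funX.
      + by move=> w _; rewrite -!EFinD lee_fin; lra.
    - by move=> w _; rewrite lee_fin sqr_ge0.
    - exact/measurable_EFinP.
    - by move=> w _; rewrite lee_fin mulr_ge0.
    - by apply/measurable_EFinP; exact: measurable_funM.
  rewrite ge0_integralD//.
  - by rewrite integral_cst//= probability_setT mule1 leeD2r.
  - by move=> w _; rewrite lee_fin sqr_ge0.
  - by apply/measurable_EFinP; exact: measurable_funX.
  - by move=> w _; rewrite lee_fin sqr_ge0.
have v_le : v <= (n%:R * s)%:E.
  have : v <= (n%:R * s + n%:R ^+ 2 * m ^+ 2 + (n%:R * m) ^+ 2
    - 2 * (n%:R * m) * (n%:R * m))%:E.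
    by rewrite EFinB leeBrDr// EFinD.
  by move=> /le_trans; apply; rewrite lee_fin; lra.
apply: (@le_trans _ _ ((n%:R ^- 2)%:E * v)).
  rewrite /v -ge0_integralZl//.
  - rewrite le_eqVlt; apply/orP; left; apply/eqP; apply: eq_integral => w _.
    rewrite -EFinM; congr EFin.
    by rewrite -exprVn -exprMn mulrBr mulKf.
  - exact/measurable_EFinP.
  - by move=> w _; rewrite lee_fin sqr_ge0.
apply: (@le_trans _ _ ((n%:R ^- 2)%:E * (n%:R * s)%:E)).
  by apply: lee_wpmul2l v_le; rewrite lee_fin invr_ge0 exprn_ge0.
by rewrite -EFinM lee_fin mulrA expr2 invfM mulfVK.
Qed.

End sample_mean.

(** * The unconstrained estimator and its primitive *)

Section sharp_estimator.
Context {R : realType}.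
Local Notation mu := (@lebesgue_measure R).
Variables (Y Z : nat -> R) (n : nat) (M : R).
Hypotheses (Z_ge0 : forall i, 0 <= Z i) (Z_le : forall i, Z i <= M).
Hypothesis n_gt0 : (0 < n)%N.

Local Notation Ps := (Psi_sharp Y Z n).
Local Notation Us := (U_sharp Y Z n).

Let M_ge0 : 0 <= M. Proof. exact: le_trans (Z_le 0). Qed.

Lemma Psi_sharpE t : 0 <= t ->
  Ps t = n%:R^-1 * \sum_(i < n) Z i * isq (Y i - t).
Proof.
move=> t0; rewrite /Psi_sharp max_l//; congr (_ * _).
rewrite big_mkcond; apply: eq_bigr => i _; case: ltP => // Yt.
by rewrite isq_le0 ?mulr0// subr_le0.
Qed.

Lemma Psi_sharp_ge0 t : 0 <= t -> 0 <= Ps t.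
Proof.
move=> t0; rewrite Psi_sharpE// mulr_ge0 ?invr_ge0// sumr_ge0// => i _.
by rewrite mulr_ge0 ?isq_ge0.
Qed.

Lemma measurable_Psi_sharp : measurable_fun setT Ps.
Proof.
rewrite (_ : Ps = (fun t => n%:R^-1 *
    \sum_(i < n) Z i * isq (Y i - Num.max t 0))); last first.
  apply/funext => t; rewrite -Psi_sharpE ?le_max ?lexx ?orbT//.
  by rewrite /Psi_sharp /= (max_l (_ : 0 <= Num.max t 0))// le_max lexx orbT.
apply: measurable_funM => //; apply: measurable_sum => i.
apply: measurable_funM => //; apply: measurableT_comp; first exact: measurable_isq.
by apply: measurable_funB => //; exact: measurable_maxr.
Qed.

Let F (y : R) := n%:R^-1 * \sum_(i < n) Z i * (2 * (Num.sqrt (Y i) - Num.sqrt (Y i - y))).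

Let integral_Psi_sharp_F s t : 0 <= s -> s <= t ->
  (\int[mu]_(u in `]s, t[) (Ps u)%:E = (F t - F s)%:E)%E.
Proof.
move=> s0 st.
have mi (i : nat) : measurable_fun `]s, t[ (fun u : R => (isq (Y i - u))%:E).
  apply/measurable_EFinP; apply: measurableT_comp; first exact: measurable_isq.
  exact: measurable_funB.
transitivity (\int[mu]_(u in `]s, t[)
    ((n%:R^-1)%:E * \sum_(i < n) ((Z i)%:E * (isq (Y i - u))%:E)))%E.
  apply: eq_integral => u; rewrite inE/= in_itv/= => /andP[su _].
  rewrite Psi_sharpE ?(le_trans s0 (ltW su))// EFinM -sumEFin.
  by congr (_ * _)%E; apply: eq_bigr => i _; rewrite EFinM.
rewrite ge0_integralZl//; last 2 first.
- apply: (emeasurable_sum _ (h := fun (i : 'I_n) (u : measurableTypeR R) =>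
    ((Z i)%:E * (isq (Y i - u))%:E)%E)) => i.
  by apply: (emeasurable_funM (measurable_cst _) (mi i)).
- by move=> u _; apply: sume_ge0 => i _; rewrite mule_ge0 ?lee_fin ?isq_ge0.
rewrite ge0_integral_sum//; last 2 first.
- by move=> i; apply: (emeasurable_funM (measurable_cst _) (mi i)).
- by move=> i u _; rewrite mule_ge0 ?lee_fin ?isq_ge0.
transitivity ((n%:R^-1)%:E * \sum_(i < n)
    (Z i * (2 * (Num.sqrt (Y i - s) - Num.sqrt (Y i - t))))%:E)%E.
  congr (_ * _)%E; apply: eq_bigr => i _; rewrite ge0_integralZl//.
  - by rewrite integral_isq_itv// -EFinM.
  - exact: mi.
  - by move=> u _; rewrite lee_fin isq_ge0.
  - by rewrite lee_fin.
rewrite sumEFin -EFinM /F -mulrBr -sumrB; congr (_ * _)%:E.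
by apply: eq_bigr => i _; ring.
Qed.

Lemma U_sharpE y : 0 <= y -> Us y = F y.
Proof.
move=> y0; rewrite /U_sharp /Rintegral integral_itv_bndoo; last first.
  by apply/measurable_EFinP; apply: measurable_funTS; exact: measurable_Psi_sharp.
have F0 : F 0 = 0 by rewrite /F big1 ?mulr0// => i _; rewrite subr0 subrr !mulr0.
by rewrite integral_Psi_sharp_F//= F0 subr0.
Qed.

Lemma integral_Psi_sharp s t : 0 <= s -> s <= t ->
  (\int[mu]_(u in `]s, t[) (Ps u)%:E = (Us t - Us s)%:E)%E.
Proof.
by move=> s0 st; rewrite integral_Psi_sharp_F// !U_sharpE// (le_trans s0).
Qed.

Lemma U_sharp0 : Us 0 = 0.
Proof.
rewrite U_sharpE// /F big1 ?mulr0// => i _.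
by rewrite subr0 subrr !mulr0.
Qed.

Lemma U_sharp_holder s t : 0 <= s -> s <= t ->
  Us t - Us s <= 2 * M * Num.sqrt (t - s).
Proof.
move=> s0 st; rewrite !U_sharpE ?(le_trans s0)// /F -mulrBr -sumrB.
rewrite mulrC ler_pdivrMr ?ltr0n//.
apply: (@le_trans _ _ (\sum_(i < n) 2 * M * Num.sqrt (t - s))); last first.
  by rewrite sumr_const card_ord mulr_natr.
apply: ler_sum => i _; have := sqrtr_holder (Y i) st.
have : Num.sqrt (Y i - t) <= Num.sqrt (Y i - s).
  by apply: ler_wsqrtr; rewrite lerD2l lerN2.
set a := Num.sqrt (Y i - s); set b := Num.sqrt (Y i - t).
set e := Num.sqrt (t - s) => ba h.
rewrite (_ : _ - _ = 2 * (Z i * (a - b))); last by ring.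
by rewrite -mulrA ler_pM2l//; apply: ler_pM; rewrite ?subr_ge0.
Qed.

Lemma U_sharp_ndecr s t : 0 <= s -> s <= t -> Us s <= Us t.
Proof.
move=> s0 st; rewrite -subr_ge0 -lee_fin -integral_Psi_sharp//.
apply: integral_ge0 => u /=; rewrite in_itv/= => /andP[su _].
by rewrite lee_fin Psi_sharp_ge0// (le_trans s0)// ltW.
Qed.

Lemma U_sharp_ge0 s : 0 <= s -> 0 <= Us s.
Proof. by move=> s0; rewrite -U_sharp0; apply: U_sharp_ndecr. Qed.

Lemma U_sharp_le s : 0 <= s -> Us s <= 2 * M * Num.sqrt s.
Proof.
by move=> s0; have := U_sharp_holder (lexx 0) s0; rewrite U_sharp0 !subr0.
Qed.

End sharp_estimator.

(** * Slopes of the least concave majorant *)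

Section concave_functions.
Context {R : realType}.
Implicit Types f g : R -> R.

Lemma affine_concave_majorant f (a c : R) :
  (forall s, 0 <= s -> f s <= a + c * s) ->
  concave_majorant f (fun s => a + c * s).
Proof.
move=> fac; split; last by move=> y; rewrite in_itv/= andbT; exact: fac.
move=> t u v _ _ /=.
have convE (p q : R) : @conv _ (convex_lmodType R^o) t p q =
  t%:num * p + (1 - t%:num) * q by [].
have convE' (p q : R) : @conv _ R^o t p q =
  t%:num * p + (1 - t%:num) * q by [].
by rewrite !convE convE' le_eqVlt; apply/orP; left; apply/eqP; ring.
Qed.

Lemma concave_chord g (r s t : R) :
  @convex_function R R^o `[0, +oo[ (\- g) -> 0 <= r -> r < s -> s < t ->
  (t - s) * g r + (s - r) * g t <= (t - r) * g s.
Proof.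
move=> cg r0 rs st.
have rt : 0 < t - r by lra.
have p0 : 0 <= (t - s) / (t - r) by rewrite divr_ge0; lra.
have p1 : (t - s) / (t - r) <= 1 by rewrite ler_pdivrMr// mul1r; lra.
pose p : {i01 R} := Itv01 p0 p1.
have := cg p r t; rewrite !inE/= !in_itv/= !andbT => /(_ r0).
have convE (u v : R) : @conv _ (convex_lmodType R^o) p u v =
  p%:num * u + (1 - p%:num) * v by [].
have convE' (u v : R) : @conv _ R^o p u v =
  p%:num * u + (1 - p%:num) * v by [].
rewrite !convE convE' /=.
have -> : (t - s) / (t - r) * r + (1 - (t - s) / (t - r)) * t = s.
  by field; rewrite gt_eqF.
have t0 : 0 <= t by lra.
move=> /(_ t0).
rewrite -(ler_pM2l rt).
rewrite [leRHS](_ : _ = - ((t - s) * g r + (s - r) * g t)); last first.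
  by field; rewrite gt_eqF.
by rewrite mulrN lerN2.
Qed.

(** An affine function is concave, hence competes with the least concave
    majorant. *)
Lemma lcm_le_affine f (a c : R) : (forall s, 0 <= s -> f s <= a + c * s) ->
  forall s, 0 <= s -> least_concave_majorant f s <= a + c * s.
Proof.
move=> fac s s0; have cm := affine_concave_majorant fac.
by apply: (least_concave_majorantP (ex_intro _ _ cm)).2 cm _ _; rewrite in_itv/= s0.
Qed.

Definition difference_quotient (g : R -> R) (h t : R) := (g (t + h) - g t) / h.

Section slopes.
Variables (f : R -> R) (a0 c0 : R).
Hypothesis f_ge0 : forall s, 0 <= s -> 0 <= f s.
Hypothesis f_le : forall s, 0 <= s -> f s <= a0 + c0 * s.
Local Notation g := (least_concave_majorant f).

Let cg : concave_majorant f g.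
Proof.
apply: (least_concave_majorantP _).1.
by exists (fun s => a0 + c0 * s); exact: affine_concave_majorant.
Qed.

Lemma le_lcm s : 0 <= s -> f s <= g s.
Proof. by move=> s0; apply: cg.2; rewrite in_itv/= s0. Qed.

Lemma lcm_ge0 s : 0 <= s -> 0 <= g s.
Proof. by move=> s0; exact: le_trans (f_ge0 s0) (le_lcm s0). Qed.

Lemma lcm_chord (r s t : R) : 0 <= r -> r < s -> s < t ->
  (t - s) * g r + (s - r) * g t <= (t - r) * g s.
Proof. exact: concave_chord cg.1. Qed.

(** A concave function which decreases somewhere is eventually negative. *)
Lemma lcm_ndecr s t : 0 <= s -> s <= t -> g s <= g t.
Proof.
move=> s0; rewrite le_eqVlt => /predU1P[->//|st].
rewrite leNgt; apply/negP => gts.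
set d := g s - g t; have d0 : 0 < d by rewrite subr_gt0.
(* At t + e the line through the points at s and t has the value - d / (t - s)
   < 0. *)
pose e := (t - s) * g t / d + 1.
have gt0 : 0 <= g t by rewrite lcm_ge0// (le_trans s0)// ltW.
have e0 : 0 < e by rewrite ltr_wpDl// divr_ge0 ?(ltW d0)// mulr_ge0// subr_ge0 ltW.
have tT : t < t + e by rewrite ltrDl.
have := lcm_chord s0 st tT.
have gT : 0 <= g (t + e) by rewrite lcm_ge0//; lra.
have ed : e * d = (t - s) * g t + d by rewrite /e; field; rewrite gt_eqF.
rewrite addrAC subrr add0r.
have h1 : 0 <= (t - s) * g (t + e) by rewrite mulr_ge0//; lra.
rewrite /d in ed d0 => h2.
have : (t + e - s) * g t = e * g t + (t - s) * g t by ring.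
lra.
Qed.

Lemma lcm_quotient_ge0 h t : 0 < h -> 0 <= t -> 0 <= difference_quotient g h t.
Proof.
move=> h0 t0; rewrite divr_ge0 ?(ltW h0)// subr_ge0; apply: lcm_ndecr => //.
by rewrite lerDl ltW.
Qed.

(** By concavity the slope to the right of t is at most that of the chord from 0
    to t. *)
Lemma lcm_quotient_le h t : 0 < h -> 0 < t ->
  difference_quotient g h t <= g t / t.
Proof.
move=> h0 t0; rewrite ler_pdivrMr// mulrAC ler_pdivlMr//.
have th : t < t + h by rewrite ltrDl.
have := lcm_chord (lexx 0) t0 th.
have := lcm_ge0 (lexx 0); rewrite !subr0 => g0.
have : 0 <= h * g 0 by rewrite mulr_ge0// ltW.
have -> : t + h - t = h by ring.
lra.
Qed.

Lemma lcm_quotient_nincr h k t : 0 <= t -> 0 < h -> h <= k ->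
  difference_quotient g k t <= difference_quotient g h t.
Proof.
move=> t0 h0; rewrite le_eqVlt => /predU1P[->//|hk].
have k0 : 0 < k by exact: lt_trans hk.
rewrite ler_pdivrMr// mulrAC ler_pdivlMr//.
have th : t < t + h by rewrite ltrDl.
have thk : t + h < t + k by rewrite ltrD2l.
have := lcm_chord t0 th thk.
have -> : t + k - (t + h) = k - h by ring.
have -> : t + h - t = h by ring.
have -> : t + k - t = k by ring.
lra.
Qed.

(** The difference quotients of a concave function are monotone in h and
    bounded, so that the limit defining the right derivative exists; along the
    sequence u it is reached. *)
Lemma cvg_right_derivative_lcm (u : R^nat) t : 0 < t ->
  (forall m, 0 < u m) -> u m @[m --> \oo] --> 0 ->
  difference_quotient g (u m) t @[m --> \oo] --> right_derivative g t.
Proof.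
move=> t0 u_gt0 u_cvg.
have cv : cvg ((fun h : R => (g (t + h) - g t) / h) @ 0^'+).
  apply: nonincreasing_at_right_is_cvgr.
    near=> k => h h'; rewrite !in_itv/= => /andP[h0 _] /andP[h'0 _] hh'.
    by apply: (lcm_quotient_nincr (ltW t0)).
  near=> k; exists (g t / t); apply/ubP => y [h /=].
  by rewrite in_itv/= => /andP[h0 _] <-; exact: lcm_quotient_le.
by have /cvg_at_rightP/(_ u) := cv; apply.
Unshelve. all: by end_near. Qed.

Lemma measurable_lcm : measurable_fun (`[0, +oo[%classic : set R) g.
Proof.
pose g' s := g (Num.max s 0).
have mg' : measurable_fun setT g'.
  apply: nondecreasing_measurable => // s t st; apply: lcm_ndecr.
    by rewrite le_max lexx orbT.
  by rewrite ge_max !le_max st lexx /= orbT.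
apply: (eq_measurable_fun g'); last exact: measurable_funTS.
by move=> s; rewrite inE/= in_itv/= andbT => s0; rewrite /g' max_l.
Qed.

End slopes.
End concave_functions.

(** * Smoothing a derivative by a Lipschitz kernel *)

Section smoothing_bound.
Context {R : realType}.
Local Notation mu := (@lebesgue_measure R).

Lemma integral_shift (f : R -> \bar R) (a : R) : measurable_fun setT f ->
  (\int[mu]_t f (t + a)%R = \int[mu]_t f t)%E.
Proof.
move=> mf; rewrite integralE [RHS]integralE; congr (_ - _)%E.
- under eq_integral do rewrite funeposE -funeposE.
  apply: (@ge0_integral_shift _ (f^\+)%E a _ (funepos_ge0 f)).
  exact: measurable_funepos.
- under eq_integral do rewrite funenegE -funenegE.
  apply: (@ge0_integral_shift _ (f^\-)%E a _ (funeneg_ge0 f)).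
  exact: measurable_funeneg.
Qed.

Lemma integrable_bounded_support (f : R -> R) (lo hi C : R) :
  measurable_fun setT f -> (forall t, `|f t| <= C) ->
  (forall t, ~~ (lo <= t <= hi) -> f t = 0) ->
  mu.-integrable setT (EFin \o f).
Proof.
move=> mf fC f0.
rewrite (_ : EFin \o f = (EFin \o f) \_ `[lo, hi]); last first.
  apply/funext => t; rewrite patchE; case: ifPn => //.
  by rewrite notin_setE/= in_itv/= => /negP /f0 ->.
have mD : measurable (`[lo, hi]%classic : set (measurableTypeR R)) by [].
apply/(@integrable_mkcond _ _ R mu _ (EFin \o f) mD).
apply: measurable_bounded_integrable => //.
- by rewrite /= lebesgue_measure_itv/=; case: ifP => _; rewrite ?ltry// -EFinB ltry.
- exact: measurable_funTS.
- exists C; split; first exact: num_real.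
  by move=> z Cz t _ /=; rewrite (le_trans (fC t))// ltW.
Qed.

Variables (x b L : R) (k : R -> R).
Hypotheses (b_gt0 : 0 < b) (mk : measurable_fun setT k).
Hypothesis k_out : forall t, b <= `|t - x| -> k t = 0.
Hypothesis k_lip : forall s t, `|k s - k t| <= L * `|s - t|.

Local Notation D := (`[x - b, x + b]%classic : set R).
Local Notation E := (`[x - 2 * b, x + 2 * b]%classic : set R).

Let L_ge0 : 0 <= L.
Proof.
by have := le_trans (normr_ge0 _) (k_lip 1 0); rewrite subr0 normr1 mulr1.
Qed.

Let k_le t : `|k t| <= L * (2 * b).
Proof.
have [h|h] := leP b `|t - x|.
  by rewrite k_out// normr0 !mulr_ge0// ltW.
have := k_lip t (x + b).
rewrite (k_out (t := x + b)) ?subr0; last first.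
  by rewrite addrAC subrr add0r ger0_norm// ltW.
move=> /le_trans; apply; rewrite ler_wpM2l// ltW//.
move: h; rewrite !ltr_norml => /andP[? ?]; apply/andP; split; lra.
Qed.

Let k_outD t : ~~ (x - b <= t <= x + b) -> k t = 0.
Proof.
move=> tD; apply: k_out; rewrite leNgt; apply: contra tD.
by rewrite ltr_norml => /andP[? ?]; apply/andP; split; lra.
Qed.

Variables (V1 V2 f1 f2 g : R -> R) (h : nat -> R) (B A : R).
Hypotheses (mV1 : measurable_fun E V1)
  (mV2 : measurable_fun E V2).
Hypotheses (V1B : forall t, E t -> `|V1 t| <= B)
  (V2B : forall t, E t -> `|V2 t| <= B).
Hypotheses (h_gt0 : forall m, 0 < h m) (h_le : forall m, h m <= b).
Hypothesis cvg1 : forall t, D t ->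
  difference_quotient V1 (h m) t @[m --> \oo] --> f1 t.
Hypothesis cvg2 : forall t, D t ->
  difference_quotient V2 (h m) t @[m --> \oo] --> f2 t.
Hypothesis dom1 : forall t m, D t ->
  `|difference_quotient V1 (h m) t| <= g t.
Hypothesis dom2 : forall t m, D t ->
  `|difference_quotient V2 (h m) t| <= g t.
Hypothesis ig : mu.-integrable D (EFin \o g).
Hypothesis V21 : forall t, E t -> V2 t <= V1 t.
Hypothesis intA : (\int[mu]_(t in E) (V1 t - V2 t)%:E <= A%:E)%E.

Let shiftE t m : D t -> E (t + h m).
Proof.
rewrite /= !in_itv/= => /andP[? ?]; have := h_gt0 m; have := h_le m => ? ?.
by apply/andP; split; lra.
Qed.

Let subDE t : D t -> E t.
Proof. by rewrite /= !in_itv/= => /andP[? ?]; apply/andP; split; lra. Qed.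

Let measurable_quotient V m : measurable_fun E V ->
  measurable_fun D (difference_quotient V (h m)).
Proof.
move=> mV; apply: measurable_funM => //; apply: measurable_funB.
  apply: (measurable_comp (F := E)) => //.
    by move=> _ [t tD <-]; exact: shiftE.
  by apply: measurable_funD.
by apply: measurable_funS mV => // t; exact: subDE.
Qed.

Let smoothed_cvg V f : measurable_fun E V ->
  (forall t, D t -> difference_quotient V (h m) t @[m --> \oo] --> f t) ->
  (forall t m, D t -> `|difference_quotient V (h m) t| <= g t) ->
  \int[mu]_(t in D) (k t * difference_quotient V (h m) t) @[m --> \oo] -->
    \int[mu]_t (k t * f t).
Proof.
move=> mV cV dV.
have mq m : measurable_fun D
    (fun t => (k t * difference_quotient V (h m) t)%:E).
  apply/measurable_EFinP; apply: measurable_funM; first exact: measurable_funTS.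
  exact: measurable_quotient.
have cq t : D t ->
    ((k t * difference_quotient V (h m) t)%:E @[m --> \oo] --> (k t * f t)%:E)%E.
  move=> tD; apply: cvg_EFin; first by near=> m.
  by apply: cvgM; [exact: cvg_cst|exact: cV].
have mf : measurable_fun D (fun t => (k t * f t)%:E).
  by apply: (emeasurable_fun_cvg _ _ mq) => t tD; exact: cq.
have [] := @dominated_convergence _ _ _ mu D (measurable_itv _)
  (fun m t => (k t * difference_quotient V (h m) t)%:E)
  (fun t => (k t * f t)%:E) (fun t => (L * (2 * b) * g t)%:E) mq mf.
- by apply: aeW => t /cq.
- rewrite (_ : (fun t => _) = (fun t => (L * (2 * b))%:E * (g t)%:E)%E).
    exact: integrableZl.
  by apply/funext => t; rewrite EFinM.
- apply: aeW => t m tD; rewrite lee_fin normrM; apply: ler_pM => //.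
  exact: dV.
move=> ikf _ cvgI.
have -> : \int[mu]_t (k t * f t) = \int[mu]_(t in D) (k t * f t).
  rewrite [RHS]Rintegral_mkcond; congr fine; apply: eq_integral => t _.
  rewrite patchE; case: ifPn => //; rewrite notin_setE/= in_itv/= => /negP tD.
  by rewrite k_outD// mul0r.
by apply: fine_cvg; rewrite fineK ?integrable_fin_num.
Unshelve. all: by end_near. Qed.

Let G := (V1 \- V2) \_ E.

Let mG : measurable_fun setT G.
Proof.
apply/(measurable_restrictT _ (measurable_itv _)).
exact: measurable_funB.
Qed.

Let G_ge0 t : 0 <= G t.
Proof.
rewrite /G patchE; case: ifPn => // tE.
by rewrite /= subr_ge0 V21//; move: tE; rewrite inE.
Qed.

Let G_le t : G t <= 2 * B.
Proof.
rewrite /G patchE; case: ifPn => tE.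
  have {}tE : E t by move: tE; rewrite inE.
  have := V1B tE; have := V2B tE; rewrite !ler_norml /= => /andP[? ?] /andP[? ?].
  lra.
have xE : E x by rewrite /= in_itv/=; apply/andP; split; move: b_gt0; lra.
by rewrite mulr_ge0// (le_trans _ (V1B xE)).
Qed.

Let G_out t : ~~ (x - 2 * b <= t <= x + 2 * b) -> G t = 0.
Proof.
move=> tE; rewrite /G patchE memNset//= in_itv/=.
exact/negP.
Qed.

Let smoothed_le m :
  `|\int[mu]_(t in D) (k t * difference_quotient V1 (h m) t)
    - \int[mu]_(t in D) (k t * difference_quotient V2 (h m) t)| <= L * A.
Proof.
pose c1 t := k t * G (t + h m).
pose c2 t := k t * G t.
pose c3 t := k (t - h m) * G t.
have kG (s t : R) : `|k s * G t| <= L * (2 * b) * (2 * B).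
  by rewrite normrM; apply: ler_pM => //; rewrite ger0_norm.
have mGh : measurable_fun setT (fun t : R => G (t + h m)).
  by apply: measurableT_comp => //; exact: measurable_funD.
have mkh : measurable_fun setT (fun t : R => k (t - h m)).
  by apply: measurableT_comp => //; exact: measurable_funB.
have mc1 : measurable_fun setT c1 by exact: measurable_funM.
have mc2 : measurable_fun setT c2 by exact: measurable_funM.
have mc3 : measurable_fun setT c3 by exact: measurable_funM.
have ic1 : mu.-integrable setT (EFin \o c1).
  apply: (@integrable_bounded_support _ (x - b) (x + b) _ mc1 (fun t => kG _ _)).
  by move=> t tD; rewrite /c1 k_outD ?mul0r.
have ic2 : mu.-integrable setT (EFin \o c2).
  apply: (@integrable_bounded_support _ (x - b) (x + b) _ mc2 (fun t => kG _ _)).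
  by move=> t tD; rewrite /c2 k_outD ?mul0r.
have ic3 : mu.-integrable setT (EFin \o c3).
  apply: (@integrable_bounded_support _ (x - 2 * b) (x + 2 * b) _ mc3 (fun t => kG _ _)).
  by move=> t tE; rewrite /c3 G_out ?mulr0.
have iG : mu.-integrable setT (EFin \o G).
  apply: (@integrable_bounded_support _ (x - 2 * b) (x + 2 * b) (2 * B)) => //.
  by move=> t; rewrite ger0_norm.
have hm0 := h_gt0 m; have hm_neq0 : h m != 0 by rewrite gt_eqF.
have -> : \int[mu]_(t in D) (k t * difference_quotient V1 (h m) t)
    - \int[mu]_(t in D) (k t * difference_quotient V2 (h m) t) =
    \int[mu]_t ((h m)^-1 * (c1 t - c2 t)).
  have iq V : measurable_fun E V ->
      (forall t m, D t -> `|difference_quotient V (h m) t| <= g t) ->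
      mu.-integrable D (EFin \o (fun t => k t * difference_quotient V (h m) t)).
    move=> mV dV; have ig' : mu.-integrable D (fun t => (L * (2 * b))%:E * (g t)%:E)%E.
      exact: integrableZl.
    apply: le_integrable ig' => //.
      apply/measurable_EFinP; apply: measurable_funM; first exact: measurable_funTS.
      exact: measurable_quotient.
    move=> t tD; rewrite /= lee_fin normrM; apply: le_trans (ler_norm _).
    by apply: ler_pM => //; exact: dV.
  rewrite -RintegralB//; [|exact: iq|exact: iq].
  rewrite Rintegral_mkcond; congr fine; apply: eq_integral => t _.
  rewrite patchE /c1 /c2; case: ifPn => tD; last first.
    by rewrite k_outD ?mul0r ?subrr ?mulr0//; move: tD; rewrite notin_setE/= in_itv/= => /negP.
  have {}tD : D t by move: tD; rewrite inE.
  rewrite /G !patchE !mem_set//=; [|exact: subDE|exact: shiftE].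
  by rewrite /difference_quotient; congr EFin; field.
have icB : mu.-integrable setT (EFin \o (fun t => c1 t - c2 t)).
  exact: (integrableB measurableT ic1 ic2).
rewrite RintegralZl//.
rewrite (@RintegralB _ _ _ mu setT c1 c2)//.
(* The translation by h m moves the increment from G to k. *)
have -> : \int[mu]_t c1 t = \int[mu]_t c3 t.
  congr fine; rewrite -(integral_shift (h m) (f := EFin \o c3)).
    by apply: eq_integral => t _; rewrite /c3 /c1 /= addrK.
  exact/measurable_EFinP.
rewrite -RintegralB// -RintegralZl//; last exact: (integrableB measurableT ic3 ic2).
have icc : mu.-integrable setT (EFin \o (fun t => (h m)^-1 * (c3 t - c2 t))).
  have := integrableZl measurableT (h m)^-1 (integrableB measurableT ic3 ic2).
  by apply: eq_integrable => // t _ /=.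
apply: le_trans (le_normr_Rintegral measurableT icc) _.
apply: (@le_trans _ _ (\int[mu]_t (L * G t))).
  apply: le_Rintegral => //.
  - exact: (integrable_norm icc).
  - exact: (integrableZl measurableT L iG).
  - move=> t _; rewrite /c3 /c2 -mulrBl normrM normrM (ger0_norm (G_ge0 t)).
    rewrite ger0_norm ?invr_ge0 ?(ltW hm0)// mulrA ler_wpM2r//.
    rewrite mulrC ler_pdivrMr//; apply: le_trans (k_lip _ _) _.
    by rewrite ler_wpM2l// addrAC subrr add0r normrN ger0_norm// ltW.
rewrite RintegralZl// ler_wpM2l//.
rewrite -lee_fin /Rintegral fineK ?integrable_fin_num//.
apply: le_trans intA; rewrite le_eqVlt; apply/orP; left; apply/eqP.
rewrite [RHS]integral_mkcond; apply: eq_integral => t _.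
by rewrite /G !patchE; case: ifP.
Qed.

(** In a difference quotient the increment of V1 - V2 can be moved to the kernel
    by a translation, where it is at most L h; the integral of V1 - V2 over the
    doubled window then bounds the smoothed quotient uniformly in h. The
    quotients tend to f1 and f2 and are dominated by g, hence so do their
    smoothed versions. *)
Lemma smoothing_le :
  `|\int[mu]_t (k t * f1 t) - \int[mu]_t (k t * f2 t)| <= L * A.
Proof.
have c1 := smoothed_cvg mV1 cvg1 dom1.
have c2 := smoothed_cvg mV2 cvg2 dom2.
have c12 : `|\int[mu]_(t in D) (k t * difference_quotient V1 (h m) t)
    - \int[mu]_(t in D) (k t * difference_quotient V2 (h m) t)| @[m --> \oo] -->
    `|\int[mu]_t (k t * f1 t) - \int[mu]_t (k t * f2 t)|.
  by apply: cvg_norm; exact: cvgB c1 c2.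
have <- := cvg_lim (@Rhausdorff R) c12.
apply: limr_le; first by apply/cvg_ex; eexists; exact: c12.
by apply: nearW => m; exact: smoothed_le.
Qed.

End smoothing_bound.

Section sharp_quotients.
Context {R : realType}.
Local Notation mu := (@lebesgue_measure R).

(** The bound sqrt a - sqrt (a - h) <= h / sqrt a is twice the derivative; it
    dominates the difference quotients of U_sharp uniformly in h. *)
Lemma sqrt_increment_le (a h : R) : 0 < h ->
  2 * (Num.sqrt a - Num.sqrt (a - h)) <= h * (2 * isq a).
Proof.
move=> h0; rewrite mulrCA ler_pM2l//.
have [a0|a0] := leP a 0.
  by rewrite isq_le0// mulr0 !ler0_sqrtr ?subrr//; lra.
have s0 : 0 < Num.sqrt a by rewrite sqrtr_gt0.
rewrite /isq ler_pdivlMr// mulrBl -expr2 sqr_sqrtr ?(ltW a0)//.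
have [ah|ah] := leP a h.
  by rewrite (@ler0_sqrtr _ (a - h)) ?subr_le0// mul0r subr0.
have : (a - h) <= Num.sqrt (a - h) * Num.sqrt a; last by lra.
have ah0 : 0 <= a - h by lra.
rewrite -{1}(sqr_sqrtr ah0) expr2.
by rewrite ler_wpM2l ?sqrtr_ge0//; apply: ler_wsqrtr; lra.
Qed.

Lemma cvg_sqrt_quotient (a : R) (u : R^nat) : (forall m, 0 < u m) ->
  u m @[m --> \oo] --> 0 ->
  2 * (Num.sqrt a - Num.sqrt (a - u m)) / u m @[m --> \oo] --> isq a.
Proof.
move=> u0 uc.
have [a0|a0] := leP a 0.
  rewrite isq_le0//; apply: cvg_near_cst; apply: nearW => m.
  rewrite !ler0_sqrtr ?subrr ?mulr0 ?mul0r//.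
  by have := u0 m; lra.
have s0 : 0 < Num.sqrt a by rewrite sqrtr_gt0.
have cs : Num.sqrt (a - u m) @[m --> \oo] --> Num.sqrt a.
  apply: continuous_cvg; first exact: sqrt_continuous.
  by rewrite -[X in _ --> X]subr0; apply: cvgB => //; exact: cvg_cst.
have : 2 * (Num.sqrt a + Num.sqrt (a - u m))^-1 @[m --> \oo] --> isq a.
  rewrite (_ : isq a = 2 * (Num.sqrt a + Num.sqrt a)^-1); last first.
    rewrite /isq; have sa := lt0r_neq0 s0; field.
    by rewrite sa ?(gt_eqF (addr_gt0 s0 s0)).
  apply: cvgM; first exact: cvg_cst.
  apply: cvgV; first by rewrite gt_eqF// addr_gt0.
  by apply: cvgD => //; exact: cvg_cst.
apply: cvg_trans; apply: near_eq_cvg; near=> m.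
have um := u0 m.
have ua : u m < a by near: m; exact: (cvgr_lt 0).
have r0 := sqrtr_ge0 (a - u m).
have sr : Num.sqrt a + Num.sqrt (a - u m) != 0 by rewrite gt_eqF// ltr_pwDl.
have um0 : u m != 0 by rewrite gt_eqF.
have E1 : (Num.sqrt a - Num.sqrt (a - u m)) * (Num.sqrt a + Num.sqrt (a - u m)) = u m.
  rewrite -subr_sqr !sqr_sqrtr; [lra|lra|exact: ltW].
have -> : Num.sqrt a - Num.sqrt (a - u m) = u m / (Num.sqrt a + Num.sqrt (a - u m)).
  by apply: (mulIf sr); rewrite mulfVK.
by field; rewrite sr um0.
Unshelve. all: by end_near. Qed.

Lemma cvg_sumr (I : Type) (r : seq I) (F : I -> R^nat) (l : I -> R) :
  (forall i, F i m @[m --> \oo] --> l i) ->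
  \sum_(i <- r) F i m @[m --> \oo] --> \sum_(i <- r) l i.
Proof.
move=> Fl; elim: r => [|i r ih].
  by rewrite big_nil; under eq_fun do rewrite big_nil; exact: cvg_cst.
by rewrite big_cons; under eq_fun do rewrite big_cons; exact: cvgD.
Qed.

End sharp_quotients.

Section estimator_smoothing.
Context {R : realType}.
Local Notation mu := (@lebesgue_measure R).
Variables (Y Z : nat -> R) (n : nat) (M : R).
Hypotheses (Z_ge0 : forall i, 0 <= Z i) (Z_le : forall i, Z i <= M).
Hypothesis n_gt0 : (0 < n)%N.
Local Notation Ps := (Psi_sharp Y Z n).
Local Notation Us := (U_sharp Y Z n).
Local Notation Ut := (U_tilde Y Z n).

Let quotient_sharpE h t : 0 < h -> 0 <= t ->
  difference_quotient Us h t = n%:R^-1 * \sum_(i < n) Z i *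
    (2 * (Num.sqrt (Y i - t) - Num.sqrt (Y i - t - h)) / h).
Proof.
move=> h0 t0; rewrite /difference_quotient !U_sharpE//; last by rewrite addr_ge0// ltW.
rewrite -mulrBr -sumrB -mulrA mulr_suml; congr (_ * _).
by apply: eq_bigr => i _; rewrite opprD addrA; field; rewrite gt_eqF.
Qed.

Lemma cvg_quotient_sharp t (u : R^nat) : 0 <= t -> (forall m, 0 < u m) ->
  u m @[m --> \oo] --> 0 ->
  difference_quotient Us (u m) t @[m --> \oo] --> Ps t.
Proof.
move=> t0 u0 uc; rewrite Psi_sharpE//.
under eq_cvg => m do rewrite quotient_sharpE//.
apply: cvgM; first exact: cvg_cst.
apply: cvg_sumr => i; apply: cvgM; first exact: cvg_cst.
exact: cvg_sqrt_quotient.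
Qed.

Lemma quotient_sharp_ge0 h t : 0 < h -> 0 <= t ->
  0 <= difference_quotient Us h t.
Proof.
move=> h0 t0; rewrite divr_ge0 ?(ltW h0)// subr_ge0.
by apply: U_sharp_ndecr => //; rewrite lerDl ltW.
Qed.

Lemma quotient_sharp_le h t : 0 < h -> 0 <= t ->
  difference_quotient Us h t <= 2 * Ps t.
Proof.
move=> h0 t0; rewrite quotient_sharpE// Psi_sharpE// [leRHS]mulrCA ler_wpM2l ?invr_ge0//.
rewrite mulr_sumr; apply: ler_sum => i _; rewrite [leRHS]mulrCA ler_wpM2l//.
rewrite ler_pdivrMr// [leRHS]mulrC; exact: sqrt_increment_le.
Qed.

Let sqrt_le_affine s : 0 <= s -> Us s <= 2 * M + 2 * M * s.
Proof.
move=> s0; apply: le_trans (U_sharp_le Y Z_ge0 Z_le n_gt0 s0) _.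
have M0 : 0 <= M by exact: le_trans (Z_ge0 0) (Z_le 0).
rewrite -{1}[2 * M in leRHS]mulr1 -mulrDr ler_wpM2l ?mulr_ge0//.
have r0 := sqrtr_ge0 s; rewrite -{2}(sqr_sqrtr s0).
have := sqr_ge0 (Num.sqrt s - 1); lra.
Qed.

Lemma U_tilde_le_affine (a c : R) : (forall s, 0 <= s -> Us s <= a + c * s) ->
  forall s, 0 <= s -> Ut s <= a + c * s.
Proof. exact: lcm_le_affine. Qed.

Lemma U_sharp_le_tilde s : 0 <= s -> Us s <= Ut s.
Proof. exact: (le_lcm sqrt_le_affine). Qed.

(** Measurability comes from monotonicity. *)
Lemma measurable_U_sharp : measurable_fun (`[0, +oo[%classic : set R) Us.
Proof.
pose g' s := Us (Num.max s 0).
have mg' : measurable_fun setT g'.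
  apply: nondecreasing_measurable => // s t st.
  apply: (U_sharp_ndecr Y n Z_ge0); first by rewrite le_max lexx orbT.
  by rewrite ge_max !le_max st lexx /= orbT.
apply: (eq_measurable_fun g'); last exact: measurable_funTS.
by move=> s; rewrite inE/= in_itv/= andbT => s0; rewrite /g' max_l.
Qed.

Lemma measurable_U_tilde : measurable_fun (`[0, +oo[%classic : set R) Ut.
Proof.
by apply: measurable_lcm sqrt_le_affine => s s0; exact: U_sharp_ge0.
Qed.

Variables (x b L A : R) (k : R -> R).
Hypotheses (b_gt0 : 0 < b) (bx : 2 * b < x) (mk : measurable_fun setT k).
Hypothesis k_out : forall t, b <= `|t - x| -> k t = 0.
Hypothesis k_lip : forall s t, `|k s - k t| <= L * `|s - t|.

(** The difference quotients of U_tilde and U_sharp converge to Psi_tilde and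
    Psi_sharp. Those of U_tilde are at most a chord slope, those of U_sharp at
    most 2 Psi_sharp, which is integrable. *)
Lemma smoothed_estimators_le :
  (\int[mu]_(t in `[(x - 2 * b)%R, (x + 2 * b)%R]) (Ut t - Us t)%:E <= A%:E)%E ->
  `|\int[mu]_t (k t * Psi_tilde Y Z n t) - \int[mu]_t (k t * Psi_sharp Y Z n t)|
  <= L * A.
Proof.
move=> intA; have b0 := b_gt0; have bx' := bx.
have Us_ge0 s : 0 <= s -> 0 <= Us s by exact: U_sharp_ge0.
have E0 t : (`[(x - 2 * b), (x + 2 * b)]%classic : set R) t -> 0 <= t.
  by rewrite /= in_itv/= => /andP[+ _]; apply: le_trans; lra.
have ED t : (`[x - b, x + b]%classic : set R) t ->
    (`[(x - 2 * b), (x + 2 * b)]%classic : set R) t.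
  by rewrite /= !in_itv/= => /andP[? ?]; apply/andP; split; lra.
pose h m := b * harmonic m.
have h0 m : 0 < h m by rewrite mulr_gt0// /harmonic/= invr_gt0.
have hc : h m @[m --> \oo] --> 0.
  by rewrite -(mulr0 b); apply: cvgM; [exact: cvg_cst|exact: cvg_harmonic].
have hb m : h m <= b by rewrite ler_piMr ?(ltW b_gt0)// /harmonic/= invf_le1// ler1n.
pose C := Ut (x + 2 * b) / (x - 2 * b).
have Ut_ndecr := lcm_ndecr Us_ge0 sqrt_le_affine.
have Ut_ge0 := lcm_ge0 Us_ge0 sqrt_le_affine.
have x2 : 0 < x - 2 * b by lra.
have C0 : 0 <= C by rewrite divr_ge0 ?Ut_ge0//; lra.
apply: (@smoothing_le _ x b L k b_gt0 mk k_out k_lip Ut Us _ _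
  (fun t => 2 * Ps t + C) h (Ut (x + 2 * b))) => //.
- by apply: measurable_funS measurable_U_tilde => // t /E0;
    rewrite /= in_itv/= andbT.
- by apply: measurable_funS measurable_U_sharp => // t /E0; rewrite /= in_itv/= andbT.
- move=> t tE; have t0 := E0 _ tE; rewrite ger0_norm; last exact: Ut_ge0.
  by apply: Ut_ndecr => //; move: tE; rewrite /= in_itv/= => /andP[].
- move=> t tE; have t0 := E0 _ tE; rewrite ger0_norm; last exact: Us_ge0.
  apply: le_trans (U_sharp_le_tilde t0) _.
  by apply: Ut_ndecr => //; move: tE; rewrite /= in_itv/= => /andP[].
- move=> t tD; have tE := ED _ tD; have t0 : 0 < t.
    by move: tE; rewrite /= in_itv/= => /andP[+ _]; apply: lt_le_trans; lra.
  rewrite /Psi_tilde max_l ?(ltW t0)//.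
  exact: (cvg_right_derivative_lcm Us_ge0 sqrt_le_affine).
- by move=> t tD; apply: cvg_quotient_sharp => //; exact: E0 (ED _ tD).
- move=> t m tD; have tE := ED _ tD; have t0 : 0 < t.
    by move: tE; rewrite /= in_itv/= => /andP[+ _]; apply: lt_le_trans; lra.
  rewrite ger0_norm; last exact: (lcm_quotient_ge0 Us_ge0 sqrt_le_affine _ (ltW t0)).
  apply: le_trans (lcm_quotient_le Us_ge0 sqrt_le_affine (h0 m) t0) _.
  rewrite -[leLHS]add0r; apply: lerD.
    by rewrite mulr_ge0// Psi_sharp_ge0// ltW.
  move: tE; rewrite /= in_itv/= => /andP[t1 t2]; apply: ler_pM.
  - by apply: Ut_ge0; exact: ltW.
  - by rewrite invr_ge0 ltW.
  - by apply: Ut_ndecr => //; exact: ltW.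
  - by rewrite lef_pV2 ?posrE.
- move=> t m tD; have t0 := E0 _ (ED _ tD).
  rewrite ger0_norm; last exact: quotient_sharp_ge0.
  by apply: le_trans (quotient_sharp_le (h0 m) t0) _; rewrite lerDl.
- have iPs : mu.-integrable `[x - b, x + b] (EFin \o Ps).
    apply/integrableP; split.
      by apply/measurable_EFinP; apply: measurable_funTS; exact: measurable_Psi_sharp.
    under eq_integral.
      move=> t; rewrite inE => tD /=.
      rewrite ger0_norm; last by apply: Psi_sharp_ge0 => //; exact: E0 (ED _ tD).
      over.
    rewrite integral_itv_bndoo; last first.
      by apply/measurable_EFinP; apply: measurable_funTS; exact: measurable_Psi_sharp.
    by rewrite (integral_Psi_sharp Y n Z_ge0) ?ltry//; lra.
  have iC : mu.-integrable `[x - b, x + b] (EFin \o cst C).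
    apply: measurable_bounded_integrable => //.
      by rewrite /= lebesgue_measure_itv/=; case: ifP => _; rewrite ?ltry// -EFinB ltry.
    exact: bounded_cst.
  have i2 : mu.-integrable `[x - b, x + b] (fun t => 2%:E * (Ps t)%:E)%E.
    exact: integrableZl.
  rewrite (_ : EFin \o _ = ((fun t => 2%:E * (Ps t)%:E) \+ (EFin \o cst C))%E).
    exact: integrableD.
  by apply/funext => t.
- by move=> t tE; apply: U_sharp_le_tilde; exact: E0.
Qed.

End estimator_smoothing.

Section smooth_kernel.
Context {R : realType}.
Local Notation mu := (@lebesgue_measure R).
Variable K : R -> R.
Hypotheses (K'_derivable : forall t, derivable K^`()%classic t 1)
  (K''_continuous : continuous K^`()^`()%classic)
  (K_support : closure [set t | K t != 0] = `[-1, 1]%classic).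
Local Notation K' := (K^`()%classic).
Local Notation K'' := (K^`()^`()%classic).

Let K_out t : 1 < `|t| -> K t = 0.
Proof.
move=> t1; apply/eqP/negPn/negP => Kt.
have : `[-1, 1]%classic t by rewrite -K_support; exact: subset_closure.
by rewrite /= in_itv/= -ler_norml leNgt t1.
Qed.

Let near_out (t : R) : 1 < `|t| -> \forall s \near t, 1 < `|s|.
Proof.
move=> t1; have c : `|s| @[s --> t] --> `|t| by exact: norm_continuous.
exact: cvgr_gt c _ t1.
Qed.

Let K'_out_open t : 1 < `|t| -> K' t = 0.
Proof.
move=> t1; rewrite derive1E.
rewrite (@near_eq_derive R R R K (cst 0) t 1) ?derive_cst//.
by apply: filterS (near_out t1) => s /K_out.
Qed.

Let K''_out t : 1 < `|t| -> K'' t = 0.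
Proof.
move=> t1; rewrite derive1E.
rewrite (@near_eq_derive R R R K' (cst 0) t 1) ?derive_cst//.
by apply: filterS (near_out t1) => s /K'_out_open.
Qed.

Let K'_continuous : continuous K'.
Proof.
by move=> t; apply: differentiable_continuous; exact/derivable1_diffP.
Qed.

(** K' vanishes off [-1, 1], hence on its boundary by continuity. *)
Lemma kernel_derivative_out t : 1 <= `|t| -> K' t = 0.
Proof.
rewrite le_eqVlt => /predU1P[t1|]; last exact: K'_out_open.
pose u m := t + t * harmonic m.
have uc : u m @[m --> \oo] --> t.
  rewrite -[X in _ --> X]addr0 -[X in _ --> _ + X](mulr0 t).
  apply: cvgD; first exact: cvg_cst.
  by apply: cvgM; [exact: cvg_cst|exact: cvg_harmonic].
have c1 : K' (u m) @[m --> \oo] --> K' t.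
  by apply: continuous_cvg => //; exact: K'_continuous.
have c0 : K' (u m) @[m --> \oo] --> (0 : R).
  apply: cvg_near_cst; apply: nearW => m; apply: K'_out_open.
  have h0 : 0 < harmonic m :> R by rewrite /harmonic/= invr_gt0.
  rewrite /u -[X in X + _]mulr1 -mulrDr normrM -t1 mul1r gtr0_norm ?addr_gt0//.
  by rewrite ltrDl.
exact: cvg_unique c1 c0.
Qed.

(** K'' is continuous with compact support, hence bounded. *)
Lemma kernel_derivative_lipschitz : exists2 C : R, 0 <= C &
  forall s t, `|K' s - K' t| <= C * `|s - t|.
Proof.
have [C C0 CK] : exists2 C : R, 0 <= C & forall t, `|K'' t| <= C.
  have cn : {within `[-1, 1 : R], continuous (fun t => `|K'' t|)}.
    apply: continuous_subspaceT => t.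
    by apply: continuous_comp; [exact: K''_continuous|exact: norm_continuous].
  have n11 : -1 <= 1 :> R by lra.
  have [c _ cmax] := EVT_max n11 cn.
  exists `|K'' c| => // t.
  have [t1|t1] := leP `|t| 1; last by rewrite K''_out// normr0.
  by apply: cmax; rewrite in_itv/= -ler_norml.
exists C => // s t.
wlog st : s t / s < t.
  move=> H; have [st|ts|->] := ltgtP s t; first exact: H.
    by rewrite distrC [`|s - t|]distrC; exact: H.
  by rewrite !subrr normr0 mulr0.
have dK : forall z, z \in `]s, t[ -> is_derive z 1 K' (K'' z).
  by move=> z _; rewrite derive1E; exact: derivableP.
have [z _ Ez] := MVT st dK (continuous_subspaceT (fun z => @K'_continuous z)).
by rewrite distrC Ez normrM [`|s - t|]distrC ler_wpM2r.
Qed.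

Variable C : R.
Hypothesis K'_lipschitz : forall s t, `|K' s - K' t| <= C * `|s - t|.

Lemma smoothed_derivative_le (Y Z : nat -> R) (n : nat) (M x b A : R) :
  (forall i, 0 <= Z i) -> (forall i, Z i <= M) -> (0 < n)%N ->
  0 < b -> 2 * b < x ->
  (\int[mu]_(t in `[(x - 2 * b)%R, (x + 2 * b)%R])
      (U_tilde Y Z n t - U_sharp Y Z n t)%:E <= A%:E)%E ->
  `|smoothed_derivative K b (Psi_tilde Y Z n) x
    - smoothed_derivative K b (Psi_sharp Y Z n) x| <= C / b ^+ 3 * A.
Proof.
move=> Z0 ZM n0 b0 bx intA.
pose k t := b ^- 2 * K' ((t - x) / b).
have b20 : 0 < b ^- 2 by rewrite invr_gt0 exprn_gt0.
rewrite /smoothed_derivative -opprD normrN.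
apply: (@smoothed_estimators_le R Y Z n M Z0 ZM n0 x b _ A k b0 bx) => //.
- apply: measurable_funM => //; apply: measurableT_comp.
    by apply: continuous_measurable_fun; exact: K'_continuous.
  by apply: measurable_funM => //; exact: measurable_funB.
- move=> t bt; rewrite /k kernel_derivative_out ?mulr0//.
  by rewrite normrM normfV (gtr0_norm b0) ler_pdivlMr// mul1r.
- move=> s t; rewrite /k -mulrBr normrM gtr0_norm//.
  have := K'_lipschitz ((s - x) / b) ((t - x) / b).
  rewrite -mulrBl normrM normfV (gtr0_norm b0) => h.
  rewrite (_ : s - x - (t - x) = s - t) in h; last by ring.
  rewrite (_ : C / b ^+ 3 * `|s - t| = b ^- 2 * (C * (`|s - t| / b))).
    by rewrite ler_pM2l.
  by field; rewrite gt_eqF.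
Qed.

End smooth_kernel.

(** * Local comparison of the primitive with its concave majorant *)

Section local_bound.
Context {R : realType}.
Local Notation mu := (@lebesgue_measure R).
Variables (Y Z : nat -> R) (n : nat) (M : R).
Hypotheses (Z_ge0 : forall i, 0 <= Z i) (Z_le : forall i, Z i <= M).
Hypothesis n_gt0 : (0 < n)%N.
Local Notation Ps := (Psi_sharp Y Z n).
Local Notation Us := (U_sharp Y Z n).
Local Notation Ut := (U_tilde Y Z n).

Lemma U_sharp_increment_le (Q : R -> R) (p q al : R) :
  measurable_fun setT Q -> (forall u, 0 <= Q u) -> 0 <= p -> p <= q -> 0 <= al ->
  (forall u, p < u < q -> Ps u <= al + Q u) ->
  ((Us q - Us p)%:E <= (al * (q - p))%:E + \int[mu]_(u in `]p, q[) (Q u)%:E)%E.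
Proof.
move=> mQ Q0 p0 pq al0 PQ.
rewrite -(integral_Psi_sharp Y n Z_ge0 p0 pq) -(integral_cst_itv al pq).
have mQ' : measurable_fun `]p, q[ (fun u : R => (Q u)%:E).
  by apply/measurable_EFinP; exact: measurable_funTS.
rewrite -ge0_integralD//; last first.
  by move=> u _; rewrite lee_fin.
apply: ge0_le_integral => //.
- move=> u /=; rewrite in_itv/= => /andP[pu _].
  by rewrite lee_fin Psi_sharp_ge0// (le_trans p0)// ltW.
- by apply/measurable_EFinP; apply: measurable_funTS; exact: measurable_Psi_sharp.
- exact: emeasurable_funD.
Qed.

Lemma U_sharp_increment_ge (Q : R -> R) (p q al : R) :
  measurable_fun setT Q -> (forall u, 0 <= Q u) -> 0 <= p -> p <= q -> 0 <= al ->
  (forall u, p < u < q -> al <= Ps u + Q u) ->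
  ((al * (q - p))%:E <= (Us q - Us p)%:E + \int[mu]_(u in `]p, q[) (Q u)%:E)%E.
Proof.
move=> mQ Q0 p0 pq al0 PQ.
rewrite -(integral_Psi_sharp Y n Z_ge0 p0 pq) -(integral_cst_itv al pq).
have mQ' : measurable_fun `]p, q[ (fun u : R => (Q u)%:E).
  by apply/measurable_EFinP; exact: measurable_funTS.
have mP' : measurable_fun `]p, q[ (fun u : R => (Ps u)%:E).
  by apply/measurable_EFinP; apply: measurable_funTS; exact: measurable_Psi_sharp.
have P0 u : `]p, q[%classic u -> (0 <= (Ps u)%:E)%E.
  rewrite /= in_itv/= => /andP[pu _].
  by rewrite lee_fin Psi_sharp_ge0// (le_trans p0)// ltW.
rewrite -ge0_integralD//; last by move=> u _; rewrite lee_fin.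
apply: ge0_le_integral => //.
- exact: emeasurable_funD.
Qed.

Variables (x e c be S eta : R) (psi U d1 r : R -> R).
Hypotheses (c_gt0 : 0 < c) (be_gt0 : 0 < be) (be_e : 4 * be <= e) (e_x : e < x).
Hypothesis psi_ge0 : forall u, 0 <= psi u.
Hypothesis psi_decr : forall u v, x - e <= u -> u <= v -> v <= x + e ->
  2 * c * (v - u) <= psi u - psi v.
Hypotheses (md1 : measurable_fun setT d1) (mr : measurable_fun setT r).
Hypotheses (d1_ge0 : forall u, 0 <= d1 u) (r_ge0 : forall u, 0 <= r u).
Hypothesis Ps_psi : forall u, x - e <= u <= x + e -> `|Ps u - psi u| <= d1 u + r u.

(** The weight is 1 / |u - x|^2 away from x because, by the strict concavity of
    U, the line at t leaves room for an integrated deviation of order |s - x|^2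
    at s. *)
Definition local_weight (u : R) : R :=
  (Num.max `|u - x| be ^+ 2)^-1 * \1_`[x - e, x + e] u.

Hypothesis weighted_small :
  (\int[mu]_u ((d1 u + r u) * local_weight u)%:E <= (c / 16)%:E)%E.
Hypothesis Us_near_U : forall s, 0 <= s <= S -> `|Us s - U s| <= eta.
Hypothesis U_below : forall s t, 0 <= s <= S -> e < `|s - x| ->
  `|t - x| <= 2 * be -> U s - U t - psi t * (s - t) <= - (2 * eta).
Hypothesis S_ge : x + e <= S.
Hypothesis sqrt_below : forall s t, S < s -> `|t - x| <= 2 * be ->
  2 * M * Num.sqrt s <= psi t * (s - t).

(** What a deviation at u may contribute to the majorant at t. A deviation d1 u
    below 2 c |u - t| is absorbed by the decrease of psi between t and u. *)
Definition excess (t u : R) : R :=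
  d1 u * (2 * c * `|u - t| <= d1 u)%R%:R + r u.

Lemma excess_ge0 (t u : R) : 0 <= excess t u.
Proof. by rewrite addr_ge0// mulr_ge0. Qed.

Let d1_excess (t u : R) : d1 u + r u - 2 * c * `|u - t| <= excess t u.
Proof.
rewrite /excess; have c0 := c_gt0.
have h : 0 <= 2 * c * `|u - t| by rewrite !mulr_ge0// ltW.
set v := 2 * c * _ in h *; have [h2|h2] := leP v (d1 u) => /=.
  by rewrite mulr1; lra.
by rewrite mulr0; lra.
Qed.

Lemma measurable_excess : measurable_fun setT (fun p : R * R => excess p.1 p.2).
Proof.
have m2 : measurable_fun setT (fun p : R * R => d1 p.2) by exact: measurableT_comp.
apply: measurable_funD; last exact: measurableT_comp.
apply: measurable_funM => //.
rewrite (_ : (fun p : R * R => _) =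
  (fun p : R * R => if 2 * c * `|p.2 - p.1| <= d1 p.2 then 1 else 0)); last first.
  by apply/funext => p; case: ifP.
apply: measurable_fun_ifT => //; apply: measurable_fun_ler => //.
apply: measurable_funM => //; apply: measurableT_comp => //.
by apply: measurable_funB.
Qed.

Lemma local_weight_ge0 (u : R) : 0 <= local_weight u.
Proof. by rewrite mulr_ge0// invr_ge0 sqr_ge0. Qed.

Lemma measurable_local_weight : measurable_fun setT local_weight.
Proof.
apply: measurable_funM; last exact: measurable_indic.
rewrite (_ : (fun u => _) = (fun z : R => z `^ (-1)) \o
    (fun u => Num.max `|u - x| be ^+ 2)); last first.
  by apply/funext => u /=; rewrite powR_inv1// sqr_ge0.
apply: measurableT_comp; first exact: measurable_powR.
apply: measurable_funX; apply: measurable_maxr => //.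
by apply: measurableT_comp => //; exact: measurable_funB.
Qed.

(** On the interval the weight is at least rh^-2. *)
Let weighted_le (p q rh : R) : x - e <= p -> q <= x + e -> be <= rh ->
  x - rh <= p -> q <= x + rh ->
  (\int[mu]_(u in `]p, q[) (d1 u + r u)%:E <= (c / 16 * rh ^+ 2)%:E)%E.
Proof.
move=> pe qe brh prh qrh; have b0 := be_gt0.
have rh0 : 0 < rh by lra.
have mw := measurable_local_weight.
have mdr : measurable_fun setT (fun u : R => (d1 u + r u) * local_weight u).
  by apply: measurable_funM => //; exact: measurable_funD.
have dw0 u : 0 <= (d1 u + r u) * local_weight u.
  by rewrite mulr_ge0 ?addr_ge0// local_weight_ge0.
apply: (@le_trans _ _ (\int[mu]_u ((rh ^+ 2)%:E * ((d1 u + r u) * local_weight u)%:E))%E).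
  rewrite integral_mkcond; apply: ge0_le_integral => //.
  - by move=> u _; apply: erestrict_ge0 => v _; rewrite lee_fin addr_ge0.
  - apply: measurable_patchT => //; apply/measurable_EFinP; exact: measurable_funD.
  - by apply: emeasurable_funM => //; exact/measurable_EFinP.
  - move=> u _; rewrite patchE -EFinM; case: ifPn; last first.
      by rewrite lee_fin mulr_ge0 ?sqr_ge0.
    rewrite inE/= in_itv/= => /andP[pu uq]; rewrite lee_fin /local_weight.
    rewrite indicE mem_set/=; last by rewrite in_itv/=; apply/andP; split; lra.
    rewrite mulr1 mulrCA ler_peMr ?addr_ge0//.
    have m0 : 0 < Num.max `|u - x| be by rewrite lt_max b0 orbT.
    rewrite ler_pdivlMr ?exprn_gt0// mul1r ler_pXn2r ?nnegrE ?(ltW m0) ?(ltW rh0)//.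
    by rewrite ge_max brh andbT ler_norml; apply/andP; split; lra.
rewrite ge0_integralZl//.
- rewrite (_ : (c / 16 * rh ^+ 2)%:E = (rh ^+ 2)%:E * (c / 16)%:E)%E; last first.
    by rewrite -EFinM mulrC.
  apply: lee_wpmul2l => //.
  by rewrite lee_fin sqr_ge0.
- exact/measurable_EFinP.
- by move=> u _; rewrite lee_fin.
- by rewrite lee_fin sqr_ge0.
Qed.

(** Integrate Psi_sharp <= psi(t) - 2 c (u - t) + d1 + r between t and s. *)
Let near_case t s g : `|t - x| <= 2 * be -> `|s - x| <= 4 * be ->
  (\int[mu]_(u in `[(x - 4 * be)%R, (x + 4 * be)%R]) (excess t u)%:E <= g%:E)%E ->
  Us s <= Us t + psi t * (s - t) + g.
Proof.
move=> tx sx ig; have b0 := be_gt0; have be4 := be_e; have ex := e_x.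
have c0 := c_gt0.
move: tx sx; rewrite !ler_norml => /andP[t1 t2] /andP[s1 s2].
have mexc : measurable_fun setT (excess t).
  exact: (measurableT_comp measurable_excess (@pair1_measurable _ _ R R t)).
have exc p q : x - 4 * be <= p -> q <= x + 4 * be ->
    (\int[mu]_(u in `]p, q[) (excess t u)%:E <= g%:E)%E.
  move=> xp qx; apply: le_trans ig; apply: ge0_subset_integral => //.
  - by apply/measurable_EFinP; exact: measurable_funTS.
  - by move=> u _; rewrite lee_fin excess_ge0.
  - by move=> u /=; rewrite !in_itv/= => /andP[? ?]; apply/andP; split; lra.
have dec u v : x - 4 * be <= u -> u <= v -> v <= x + 4 * be ->
    2 * c * (v - u) <= psi u - psi v by move=> ? ? ?; apply: psi_decr; lra.
have [ts|st] := leP t s.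
  have := @U_sharp_increment_le (excess t) t s (psi t) mexc (excess_ge0 t).
  have t0 : 0 <= t by lra.
  have PQ u : t < u < s -> Ps u <= psi t + excess t u.
    move=> /andP[tu us].
    have : x - e <= u <= x + e by apply/andP; split; lra.
    move=> /Ps_psi; rewrite ler_norml => /andP[_ h1].
    have := d1_excess t u; rewrite ger0_norm ?subr_ge0 ?(ltW tu)//.
    have : 2 * c * (u - t) <= psi t - psi u by apply: dec; lra.
    lra.
  move=> /(_ t0 ts (psi_ge0 t) PQ) h.
  have h2 : x - 4 * be <= t by lra.
  have h3 : s <= x + 4 * be by lra.
  have := le_trans h (leeD2l _ (exc t s h2 h3)).
  by rewrite -EFinD lee_fin; lra.
have {}st := ltW st.
have := @U_sharp_increment_ge (excess t) s t (psi t) mexc (excess_ge0 t).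
have s0 : 0 <= s by lra.
have PQ u : s < u < t -> psi t <= Ps u + excess t u.
  move=> /andP[su ut].
  have : x - e <= u <= x + e by apply/andP; split; lra.
  move=> /Ps_psi; rewrite ler_norml => /andP[h1 _].
  have := d1_excess t u; rewrite ltr0_norm ?subr_lt0//.
  have : 2 * c * (t - u) <= psi u - psi t by apply: dec; lra.
  lra.
move=> /(_ s0 st (psi_ge0 t) PQ) h.
have h2 : x - 4 * be <= s by lra.
have h3 : t <= x + 4 * be by lra.
have := le_trans h (leeD2l _ (exc s t h2 h3)).
by rewrite -EFinD lee_fin; lra.
Qed.

(** Half of the way from t to s lies beyond the midpoint m, where psi differs
    from psi(t) by at least c |s - t|. The gain c |s - t|^2 / 2 covers the two
    integrated deviations, each at most c rh^2 / 16 with rh <= 2 |s - t|. *)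
Let middle_case t s : `|t - x| <= 2 * be -> 4 * be < `|s - x| -> `|s - x| <= e ->
  Us s <= Us t + psi t * (s - t).
Proof.
move=> tx sx se; have b0 := be_gt0; have be4 := be_e; have ex := e_x.
have c0 := c_gt0.
move: tx; rewrite !ler_norml => /andP[t1 t2].
set rh := `|s - x| in sx se.
pose Q u := d1 u + r u.
have mQ : measurable_fun setT Q by exact: measurable_funD.
have Q0 u : 0 <= Q u by rewrite addr_ge0.
have PsQ u : x - e <= u -> u <= x + e -> Ps u <= psi u + Q u /\ psi u <= Ps u + Q u.
  move=> h1 h2; have /Ps_psi : x - e <= u <= x + e by rewrite h1.
  by rewrite ler_norml /Q => /andP[? ?]; split; lra.
have brh : be <= rh by lra.
pose m := (t + s) / 2.
have [xs|sx'] := leP x s.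
  have rhE : rh = s - x by rewrite /rh ger0_norm// subr_ge0.
  have tm : t <= m by rewrite /m; lra.
  have ms : m <= s by rewrite /m; lra.
  have psi_m u : m <= u -> u <= s -> psi u <= psi t - c * (s - t).
    move=> mu us; have : 2 * c * (u - t) <= psi t - psi u by apply: psi_decr; lra.
    have : c * (s - t) <= 2 * c * (u - t).
      rewrite -subr_ge0 [X in 0 <= X](_ : _ = 2 * c * (u - m)); last by rewrite /m; field.
      by rewrite !mulr_ge0 ?subr_ge0// ltW.
    lra.
  have al0 : 0 <= psi t - c * (s - t) by apply: le_trans (psi_ge0 s) _; apply: psi_m.
  have t0 : 0 <= t by lra.
  have m0 : 0 <= m by lra.
  have PQ1 u : t < u < m -> Ps u <= psi t + Q u.
    move=> /andP[h1 h2]; have [||h3 _] := @PsQ u; [lra|lra|].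
    have : 2 * c * (u - t) <= psi t - psi u by apply: psi_decr; lra.
    have : 0 <= 2 * c * (u - t) by rewrite !mulr_ge0 ?subr_ge0// ltW.
    lra.
  have PQ2 u : m < u < s -> Ps u <= (psi t - c * (s - t)) + Q u.
    move=> /andP[h1 h2]; have [||h3 _] := @PsQ u; [lra|lra|].
    by have := @psi_m u (ltW h1) (ltW h2); lra.
  have := U_sharp_increment_le mQ Q0 t0 tm (psi_ge0 t) PQ1.
  have W1 := @weighted_le t m rh.
  move=> /le_trans /(_ (leeD2l _ (W1 _ _ _ _ _))).
  rewrite -EFinD lee_fin => E1.
  have := U_sharp_increment_le mQ Q0 m0 ms al0 PQ2.
  have W2 := @weighted_le m s rh.
  move=> /le_trans /(_ (leeD2l _ (W2 _ _ _ _ _))).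
  rewrite -EFinD lee_fin => E2.
  have rh2 : c / 16 * rh ^+ 2 <= c / 4 * (s - t) ^+ 2.
    rewrite (_ : c / 4 * _ = c / 16 * (2 * (s - t)) ^+ 2); last by field.
    rewrite ler_pM2l ?divr_gt0// ler_pXn2r// ?nnegrE; lra.
  have {}E1 : Us m - Us t <= psi t * (m - t) + c / 16 * rh ^+ 2 by apply: E1; lra.
  have {}E2 : Us s - Us m <= (psi t - c * (s - t)) * (s - m) + c / 16 * rh ^+ 2.
    by apply: E2; lra.
  have E3 : (psi t - c * (s - t)) * (s - m) =
    psi t * (s - m) - 2 * (c / 4 * (s - t) ^+ 2) by rewrite /m; field.
  have E4 : psi t * (m - t) + psi t * (s - m) = psi t * (s - t) by ring.
  lra.
have rhE : rh = x - s by rewrite /rh ltr0_norm ?opprB// subr_lt0.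
have mt : m <= t by rewrite /m; lra.
have sm : s <= m by rewrite /m; lra.
have psi_m u : s <= u -> u <= m -> psi t + c * (t - s) <= psi u.
  move=> mu us; have : 2 * c * (t - u) <= psi u - psi t by apply: psi_decr; lra.
  have : c * (t - s) <= 2 * c * (t - u).
    rewrite -subr_ge0 [X in 0 <= X](_ : _ = 2 * c * (m - u)); last by rewrite /m; field.
    by rewrite !mulr_ge0 ?subr_ge0// ltW.
  lra.
have al0 : 0 <= psi t + c * (t - s).
  by rewrite addr_ge0// mulr_ge0 ?subr_ge0 ?(ltW c0)//; lra.
have s0 : 0 <= s by lra.
have m0 : 0 <= m by lra.
have PQ1 u : m < u < t -> psi t <= Ps u + Q u.
  move=> /andP[h1 h2]; have [||_ h3] := @PsQ u; [lra|lra|].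
  have : 2 * c * (t - u) <= psi u - psi t by apply: psi_decr; lra.
  have : 0 <= 2 * c * (t - u) by rewrite !mulr_ge0 ?subr_ge0// ltW.
  lra.
have PQ2 u : s < u < m -> (psi t + c * (t - s)) <= Ps u + Q u.
  move=> /andP[h1 h2]; have [||_ h3] := @PsQ u; [lra|lra|].
  by have := @psi_m u (ltW h1) (ltW h2); lra.
have := U_sharp_increment_ge mQ Q0 m0 mt (psi_ge0 t) PQ1.
have W1 := @weighted_le m t rh.
move=> /le_trans /(_ (leeD2l _ (W1 _ _ _ _ _))).
rewrite -EFinD lee_fin => E1.
have := U_sharp_increment_ge mQ Q0 s0 sm al0 PQ2.
have W2 := @weighted_le s m rh.
move=> /le_trans /(_ (leeD2l _ (W2 _ _ _ _ _))).
rewrite -EFinD lee_fin => E2.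
have rh2 : c / 16 * rh ^+ 2 <= c / 4 * (t - s) ^+ 2.
  rewrite (_ : c / 4 * _ = c / 16 * (2 * (t - s)) ^+ 2); last by field.
  rewrite ler_pM2l ?divr_gt0// ler_pXn2r// ?nnegrE; lra.
have {}E1 : psi t * (t - m) <= Us t - Us m + c / 16 * rh ^+ 2 by apply: E1; lra.
have {}E2 : (psi t + c * (t - s)) * (m - s) <= Us m - Us s + c / 16 * rh ^+ 2.
  by apply: E2; lra.
have E3 : (psi t + c * (t - s)) * (m - s) =
  psi t * (m - s) + 2 * (c / 4 * (t - s) ^+ 2) by rewrite /m; field.
have E4 : psi t * (t - m) + psi t * (m - s) = - (psi t * (s - t)) by ring.
lra.
Qed.

(** The line of slope psi(t) through (t, U_sharp(t) + g), with g the integral of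
    the excess, lies above U_sharp; being concave, it also lies above U_tilde. *)
Lemma tilde_minus_sharp_le t : `|t - x| <= 2 * be ->
  ((Ut t - Us t)%:E <=
   \int[mu]_(u in `[(x - 4 * be)%R, (x + 4 * be)%R]) (excess t u)%:E)%E.
Proof.
move=> tx; have b0 := be_gt0; have be4 := be_e; have ex := e_x.
set I := integral _ _ _.
have I0 : (0 <= I)%E by apply: integral_ge0 => u _; rewrite lee_fin excess_ge0.
have [Iy|Ifin] := eqVneq I +oo%E; first by rewrite Iy leey.
have {}Ifin : I \is a fin_num by rewrite ge0_fin_numE// ltey.
rewrite -(fineK Ifin) lee_fin; set g := fine I.
have g0 : 0 <= g by exact: fine_ge0.
have t0 : 0 <= t by move: tx; rewrite ler_norml => /andP[? ?]; lra.
suff H s : 0 <= s -> Us s <= (Us t + g - psi t * t) + psi t * s.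
  have := U_tilde_le_affine H t0; lra.
move=> s0.
have [sx|sx] := leP `|s - x| (4 * be).
  have := @near_case t s g tx sx.
  by rewrite /g (fineK Ifin) lexx => /(_ isT); lra.
have [se|se] := leP `|s - x| e.
  by have := middle_case tx sx se; lra.
have tS : 0 <= t <= S.
  by rewrite t0; move: tx S_ge; rewrite ler_norml => /andP[? ?] ?; lra.
have [sS|sS] := leP s S.
  have s0S : 0 <= s <= S by rewrite s0.
  have := U_below s0S se tx.
  have := Us_near_U s0S; have := Us_near_U tS.
  by rewrite !ler_norml => /andP[? ?] /andP[? ?]; lra.
have := sqrt_below sS tx; have := U_sharp_le Y Z_ge0 Z_le n_gt0 s0.
have := U_sharp_ge0 Y n Z_ge0 t0; lra.
Qed.

End local_bound.

(** * Averaging the local bound over the smoothing window *)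

Section averaging.
Context {R : realType}.
Local Notation mu := (@lebesgue_measure R).
Variables (x b c be : R) (d1 r : R -> R).
Hypotheses (b_gt0 : 0 < b) (c_gt0 : 0 < c).
Hypotheses (md1 : measurable_fun setT d1) (mr : measurable_fun setT r).
Hypotheses (d1_ge0 : forall u, 0 <= d1 u) (r_ge0 : forall u, 0 <= r u).
Local Notation W := (`[x - 2 * b, x + 2 * b]%classic : set R).
Local Notation I := (`[x - 4 * be, x + 4 * be]%classic : set R).
Local Notation exc := (excess c d1 r).

Let exc_ge0 t u : 0 <= exc t u. Proof. exact: excess_ge0. Qed.

Let mexc : measurable_fun setT (fun p : R * R => exc p.1 p.2).
Proof. exact: measurable_excess. Qed.

Let mexc_t u : measurable_fun setT (exc^~ u).
Proof. exact: (measurableT_comp mexc (@pair2_measurable _ _ R R u)). Qed.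

Let mexc_tE u : measurable_fun setT (fun t : R => (exc t u)%:E).
Proof. by apply/measurable_EFinP; exact: mexc_t. Qed.

Let integral_W (al : R) : (\int[mu]_(t in W) al%:E = (4 * b * al)%:E)%E.
Proof.
have b0 := b_gt0.
rewrite integral_cst//= lebesgue_measure_itv/= lte_fin ifT; last by lra.
by rewrite -EFinB -EFinM; congr EFin; ring.
Qed.

(** The deviation d1 u enters only for t within d1 u / (2 c) of u, an interval
    of length d1 u / c. *)
Lemma integral_excess_le_sqr u :
  (\int[mu]_(t in W) (exc t u)%:E <= (d1 u ^+ 2 / c + 4 * b * r u)%:E)%E.
Proof.
have c0 := c_gt0; have c2 : 0 < 2 * c by lra.
pose a := d1 u / (2 * c).
have a0 : 0 <= a by apply: divr_ge0; [exact: d1_ge0|exact: ltW].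
pose J := (`[u - a, u + a]%classic : set (measurableTypeR R)).
have mJ : measurable J by exact: measurable_itv.
have mW : measurable (W : set (measurableTypeR R)) by [].
have mi : measurable_fun setT (fun t : R => (d1 u * \1_J t)%:E).
  by apply/measurable_EFinP; apply: measurable_funM => //; exact: measurable_indic.
apply: (@le_trans _ _ (\int[mu]_(t in W) ((d1 u * \1_J t)%:E + (r u)%:E))%E).
  apply: ge0_le_integral => //.
  - by move=> t _; rewrite lee_fin; exact: exc_ge0.
  - by apply: measurable_funTS; exact: mexc_tE.
  - by apply: emeasurable_funD => //; exact: measurable_funTS.
  - move=> t _; rewrite -EFinD lee_fin /excess lerD2r ler_wpM2l//.
    have [h|_] := leP (2 * c * `|u - t|) (d1 u); last by rewrite indicE ler0n.
    rewrite indicE mem_set// /J /= in_itv/=.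
    have : `|u - t| <= a by rewrite ler_pdivlMr// mulrC.
    by rewrite ler_norml => /andP[? ?]; apply/andP; split; lra.
have mi' : measurable_fun (W : set (measurableTypeR R)) (fun t => (d1 u * \1_J t)%:E).
  exact: measurable_funTS.
have p1 t : (W : set (measurableTypeR R)) t -> (0 <= (d1 u * \1_J t)%:E)%E.
  by move=> _; rewrite lee_fin mulr_ge0.
have p2 t : (W : set (measurableTypeR R)) t -> (0 <= (cst (r u)%:E : measurableTypeR R -> \bar R) t)%E.
  by move=> _; rewrite lee_fin.
rewrite (ge0_integralD mu mW p1 mi' p2 (measurable_cst _)).
rewrite (integral_W (r u)) EFinD; apply: leeD => //.
apply: (@le_trans _ _ (\int[mu]_t (d1 u * \1_J t)%:E)%E).
  apply: ge0_subset_integral => //.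
  by move=> t _; rewrite lee_fin mulr_ge0.
under eq_integral do rewrite EFinM.
rewrite ge0_integralZl//.
- have -> : (\int[mu]_t (\1_J t)%:E = mu `[(u - a)%R, (u + a)%R])%E.
    by rewrite integral_indic// setIT.
  rewrite lebesgue_measure_itv/= lte_fin.
  case: ifPn => h; last by rewrite mule0 lee_fin divr_ge0 ?sqr_ge0 ?(ltW c0).
  rewrite -EFinB -EFinM lee_fin le_eqVlt; apply/orP; left; apply/eqP.
  by rewrite /a; field; rewrite gt_eqF.
- by apply/measurable_EFinP; exact: measurable_indic.
- by rewrite lee_fin.
Qed.

Lemma integral_excess_le_linear u :
  (\int[mu]_(t in W) (exc t u)%:E <= (4 * b * (d1 u + r u))%:E)%E.
Proof.
rewrite -integral_W; apply: ge0_le_integral => //.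
- by move=> t _; rewrite lee_fin; exact: exc_ge0.
- by apply: measurable_funTS; exact: mexc_tE.
- by move=> t _; rewrite lee_fin /excess lerD2r ler_piMr// lern1 leq_b1.
Qed.

(** Exchange of the order of integration. *)
Lemma averaged_excess_le (B : R -> R) : measurable_fun setT B ->
  (forall u, (\int[mu]_(t in W) (exc t u)%:E <= (B u)%:E)%E) ->
  (\int[mu]_(t in W) \int[mu]_(u in I) (exc t u)%:E <=
   \int[mu]_(u in I) (B u)%:E)%E.
Proof.
move=> mB excB.
have mW : measurable (W : set (measurableTypeR R)) by [].
have mI : measurable (I : set (measurableTypeR R)) by [].
pose k (p : R * R) := (\1_W p.1 * (\1_I p.2 * exc p.1 p.2))%:E.
have mk : measurable_fun setT k.
  apply/measurable_EFinP; apply: measurable_funM.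
    by apply: measurableT_comp => //; exact: measurable_indic.
  apply: measurable_funM => //.
  by apply: measurableT_comp => //; exact: measurable_indic.
have k0 p : (0 <= k p)%E by rewrite lee_fin !mulr_ge0.
rewrite [leLHS](_ : _ = \int[mu]_t \int[mu]_u k (t, u))%E; last first.
  rewrite integral_mkcond epatch_indic; apply: eq_integral => t _ /=.
  rewrite [X in (X * _)%E]integral_mkcond epatch_indic muleC -ge0_integralZl//.
  - by apply: eq_integral => u _; rewrite /k/= -!EFinM [X in _ * X]mulrC.
  - apply: emeasurable_funM; last by apply/measurable_EFinP; exact: measurable_indic.
    apply/measurable_EFinP.
    exact: (measurableT_comp mexc (@pair1_measurable _ _ R R t)).
  - by move=> u _; rewrite -EFinM lee_fin mulr_ge0.
rewrite (@fubini_tonelli _ _ _ _ _ mu mu k)//.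
rewrite [leRHS]integral_mkcond; apply: ge0_le_integral => //.
- by move=> u _; exact: integral_ge0.
- exact: (measurable_fun_fubini_tonelli_G (m1 := mu) _ mk k0).
- by apply: measurable_patchT => //; exact/measurable_EFinP.
- move=> u _; rewrite patchE; case: ifPn => uI.
    apply: le_trans (excB u); rewrite [leRHS]integral_mkcond epatch_indic.
    apply: ge0_le_integral => //.
    + exact: (measurableT_comp mk (@pair2_measurable _ _ R R u)).
    + apply: emeasurable_funM; first exact: mexc_tE.
      by apply/measurable_EFinP; exact: measurable_indic.
    + by move=> t _; rewrite /k/= -EFinM lee_fin !indicE uI mul1r mulrC.
  rewrite (eq_integral (cst 0)%E) ?integral0// => t _.
  by rewrite /k/= !indicE (negbTE uI) mul0r mulr0.
Qed.

End averaging.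

(** * Two integrals for the moment bounds *)

Section weight_integral.
Context {R : realType}.
Local Notation mu := (@lebesgue_measure R).

Lemma integral_oneDsqrV :
  (\int[mu]_t ((oneDsqr t)^-1)%:E = (pi : R)%:E)%E.
Proof.
have mo : measurable_fun setT (fun t : R => ((oneDsqr t)^-1)%:E).
  apply/measurable_EFinP; apply: continuous_measurable_fun.
  exact: continuous_oneDsqrV.
have o0 (t : R) : (0 <= ((oneDsqr t)^-1)%:E)%E.
  by rewrite lee_fin invr_ge0 (le_trans ler01)// oneDsqr_ge1.
have h2 := @integral0y_oneDsqr R.
have h1 : (\int[mu]_(t in `]-oo, 0%R[) ((oneDsqr t)^-1)%:E = (pi / 2)%:E :> \bar R)%E.
  rewrite -h2 (ge0_integration_by_substitution0 mo o0).
  rewrite integral_itv_bndo_bndc; last exact: measurable_funTS.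
  by apply: eq_integral => t _; rewrite /oneDsqr sqrrN.
have TE : [set: R] = `]-oo, 0[%classic `|` `[0, +oo[%classic.
  apply/seteqP; split => // t _; rewrite /= !in_itv/= andbT.
  by have [t0|t0] := ltP t 0; [left|right].
rewrite TE ge0_integral_setU//.
- by rewrite h1 h2 -EFinD; congr EFin; field.
- exact: measurable_funTS.
- apply/disj_setPS => t [] /=; rewrite !in_itv/= andbT => t0.
  by rewrite leNgt t0.
Qed.

(** As max (|v|, be)^2 >= (v^2 + be^2) / 2, the weight is at most a multiple of
    a Cauchy density of scale be. *)
Lemma integral_local_weight_le (x e be : R) : 0 < be ->
  (\int[mu]_u (local_weight x e be u)%:E <= (2 * pi / be)%:E)%E.
Proof.
move=> b0.
pose f (t : R) := ((2 / be ^+ 2) * (oneDsqr (be^-1 * t))^-1)%:E.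
have mo : measurable_fun setT (fun t : R => ((oneDsqr t)^-1)%:E).
  apply/measurable_EFinP; apply: continuous_measurable_fun.
  exact: continuous_oneDsqrV.
have o0 (t : R) : (0 <= ((oneDsqr t)^-1)%:E)%E.
  by rewrite lee_fin invr_ge0 (le_trans ler01)// oneDsqr_ge1.
have mo' : measurable_fun setT (fun t : R => ((oneDsqr (be^-1 * t))^-1)%:E).
  apply: (measurableT_comp mo); exact: measurable_funM.
have C0 : 0 <= 2 / be ^+ 2 by rewrite divr_ge0 ?sqr_ge0.
have mf : measurable_fun setT f.
  rewrite (_ : f = (fun t => (2 / be ^+ 2)%:E * ((oneDsqr (be^-1 * t))^-1)%:E)%E).
    exact: emeasurable_funM.
  by apply/funext => t; rewrite /f EFinM.
have f0 t : (0 <= f t)%E by rewrite lee_fin mulr_ge0// -lee_fin.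
have intf : (\int[mu]_t f t = (2 * pi / be)%:E)%E.
  under eq_integral do rewrite /f EFinM.
  rewrite ge0_integralZl//.
  have bV : 0 < be^-1 by rewrite invr_gt0.
  have := ge0_integral_scale bV mo o0; rewrite integral_oneDsqrV => E.
  have -> : (\int[mu]_t ((oneDsqr (be^-1 * t))^-1)%:E = (be * pi)%:E)%E.
    rewrite EFinM -E muleA -EFinM divff ?mul1e// gt_eqF//.
  by rewrite -EFinM; congr EFin; field; rewrite gt_eqF.
rewrite -intf -(ge0_integral_shift (- x) mf f0).
apply: ge0_le_integral => //.
- by move=> u _; rewrite lee_fin local_weight_ge0.
- by apply/measurable_EFinP; exact: measurable_local_weight.
- by apply: (measurableT_comp mf); exact: measurable_funD.
- move=> u _; rewrite /f lee_fin /local_weight.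
  apply: (@le_trans _ _ (Num.max `|u - x| be ^+ 2)^-1).
    by rewrite ler_piMr ?invr_ge0 ?sqr_ge0// indicE lern1 leq_b1.
  have m0 : 0 < Num.max `|u - x| be by rewrite lt_max b0 orbT.
  have o1 : 0 < oneDsqr (be^-1 * (u - x)) by rewrite (lt_le_trans ltr01)// oneDsqr_ge1.
  rewrite -[leRHS]invrK lef_pV2 ?posrE ?invr_gt0 ?mulr_gt0 ?invr_gt0 ?exprn_gt0//.
  rewrite !invfM !invrK mulrC /oneDsqr.
  rewrite (_ : _ * _ = (be ^+ 2 + (u - x) ^+ 2) / 2); last first.
    by field; rewrite gt_eqF.
  rewrite ler_pdivrMr// -[(u - x) ^+ 2]real_normK ?num_real//.
  have b2 : be ^+ 2 <= Num.max `|u - x| be ^+ 2.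
    by rewrite ler_pXn2r// ?nnegrE ?(ltW b0) ?(ltW m0)// le_max lexx orbT.
  have n2 : `|u - x| ^+ 2 <= Num.max `|u - x| be ^+ 2.
    by rewrite ler_pXn2r// ?nnegrE ?(ltW m0)// le_max lexx.
  lra.
Qed.

Lemma integral_invr_itv (h e : R) : 0 < h -> h <= e ->
  (\int[mu]_(t in `[h, e[) (t^-1)%:E = (ln e - ln h)%:E)%E.
Proof.
move=> h0; rewrite le_eqVlt => /predU1P[->|he].
  by rewrite set_itv_ge ?integral_set0 ?subrr// bnd_simp -leNgt.
have c t : h <= t -> {for t, continuous (fun s : R => s^-1)}.
  by move=> ht; apply: cvgV; [rewrite gt_eqF// (lt_le_trans h0)|exact: cvg_id].
have mV : measurable_fun `]h, e[ (fun t : R => (t^-1)%:E).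
  apply/measurable_EFinP; apply: open_continuous_measurable_fun => //.
  by move=> t; rewrite inE/= in_itv/= => /andP[ht _]; apply: c; exact: ltW.
rewrite integral_itv_bndoo// -(integral_itv_bndoo true false)//.
rewrite (@continuous_FTC2 _ _ (@ln R))//.
- apply: continuous_in_subspaceT => t; rewrite inE/= in_itv/= => /andP[ht _].
  exact: c.
- split=> [t||].
  + rewrite in_itv/= => /andP[ht _].
    have t0 : 0 < t by exact: lt_trans ht.
    by apply: ex_derive; exact: is_derive1_ln.
  + by apply: cvg_at_right_filter; exact: continuous_ln.
  + by apply: cvg_at_left_filter; apply: continuous_ln; exact: lt_trans he.
- move=> t; rewrite in_itv/= => /andP[ht _]; rewrite derive1E.
  have t0 : 0 < t by exact: lt_trans ht.
  by have := is_derive1_ln t0 => ?; rewrite derive_val.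
Qed.

End weight_integral.

(** * Truncated statistics and their moments *)

Lemma markov_event d (T : measurableType d) (R : realType) (P : probability T R)
    (F : T -> \bar R) (a eps : R) : 0 < a -> measurable_fun setT F ->
  (forall w, (0 <= F w)%E) -> (\int[P]_w F w <= (a * eps)%:E)%E ->
  measurable [set w | (a%:E < F w)%E] /\ (P [set w | (a%:E < F w)%E] <= eps%:E)%E.
Proof.
move=> a0 mF F0 Fa.
have mA : measurable [set w | (a%:E < F w)%E].
  rewrite (_ : [set w | _] = F @^-1` `]a%:E, +oo[%classic).
    by rewrite -[X in measurable X]setTI; apply: mF => //; exact: emeasurable_itv.
  apply/seteqP; split => w /=; rewrite in_itv/= ?andbT//.
split=> //; rewrite -(@lee_pmul2l _ a%:E) ?lte_fin//; apply: le_trans Fa.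
apply: (@le_trans _ _ (\int[P]_(w in [set w | (a%:E < F w)%E]) F w)%E).
  rewrite -integral_cst//; apply: ge0_le_integral => //.
  - by move=> w _; rewrite lee_fin ltW.
  - exact: measurable_funTS.
  - by move=> w /= /ltW.
by apply: ge0_subset_integral.
Qed.

Section clipped_statistics.
Context {R : realType}.
Local Notation mu := (@lebesgue_measure R).
Variable M : R.
Hypothesis M_gt0 : 0 < M.

(** Truncating to [0, M] alters neither Z nor its copies, up to a null event,
    and makes the bound by M hold everywhere. *)
Definition clip (z : R) : R := Num.min (Num.max z 0) M.

Definition planar_sqr (s : R * R * R) : R := s.1.1 ^+ 2 + s.1.2 ^+ 2.

Definition clipped_stat (k : R -> R) (s : R * R * R) : R :=
  clip s.2 * k (planar_sqr s).

(** The singular kernel isq (y - u) is cut at distance h from its singularity: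
    the first part has a finite second moment, the second one a small mean. *)
Definition far_kernel (h u y : R) : R := isq (y - u) * (h <= y - u)%R%:R.
Definition near_kernel (h u y : R) : R := isq (y - u) * (y - u < h)%R%:R.

Lemma clip_ge0 z : 0 <= clip z.
Proof. by rewrite le_min (ltW M_gt0) andbT le_max lexx orbT. Qed.

Lemma clip_le z : clip z <= M.
Proof. by rewrite ge_min lexx orbT. Qed.

Lemma clip_id z : 0 <= z <= M -> clip z = z.
Proof. by move=> /andP[z0 zM]; rewrite /clip max_l// min_l. Qed.

Lemma measurable_clip : measurable_fun setT clip.
Proof. by apply: measurable_minr => //; exact: measurable_maxr. Qed.

Lemma measurable_planar_sqr : measurable_fun setT planar_sqr.
Proof.
by apply: measurable_funD; apply: measurable_funX; apply: measurableT_comp.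
Qed.

Lemma measurable_clipped_stat (k : R -> R) : measurable_fun setT k ->
  measurable_fun setT (clipped_stat k).
Proof.
move=> mk; apply: measurable_funM; first exact: measurableT_comp measurable_clip _.
exact: measurableT_comp measurable_planar_sqr.
Qed.

Lemma clipped_stat_ge0 (k : R -> R) s : (forall y, 0 <= k y) -> 0 <= clipped_stat k s.
Proof. by move=> k0; rewrite mulr_ge0 ?clip_ge0. Qed.

Lemma far_near_kernel h u y : far_kernel h u y + near_kernel h u y = isq (y - u).
Proof.
rewrite /far_kernel /near_kernel; case: (leP h (y - u)) => _ /=;
by rewrite ?mulr1 ?mulr0 ?addr0 ?add0r.
Qed.

Lemma far_kernel_ge0 h u y : 0 <= far_kernel h u y.
Proof. by rewrite mulr_ge0 ?isq_ge0. Qed.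

Lemma near_kernel_ge0 h u y : 0 <= near_kernel h u y.
Proof. by rewrite mulr_ge0 ?isq_ge0. Qed.

Lemma measurable_far_kernel h :
  measurable_fun setT (fun p : R * R => far_kernel h p.1 p.2).
Proof.
have m : measurable_fun setT (fun p : R * R => p.2 - p.1) by exact: measurable_funB.
apply: measurable_funM; first by apply: measurableT_comp m; exact: measurable_isq.
rewrite (_ : (fun p : R * R => _) =
  (fun p : R * R => if h <= p.2 - p.1 then 1 else 0)); last first.
  by apply/funext => p; case: ifP.
by apply: measurable_fun_ifT => //; exact: measurable_fun_ler.
Qed.

Lemma measurable_near_kernel h :
  measurable_fun setT (fun p : R * R => near_kernel h p.1 p.2).
Proof.
have m : measurable_fun setT (fun p : R * R => p.2 - p.1) by exact: measurable_funB.
apply: measurable_funM; first by apply: measurableT_comp m; exact: measurable_isq.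
rewrite (_ : (fun p : R * R => _) =
  (fun p : R * R => if p.2 - p.1 < h then 1 else 0)); last first.
  by apply/funext => p; case: ifP.
by apply: measurable_fun_ifT => //; exact: measurable_fun_ltr.
Qed.

Lemma measurable_far_kernel1 h u : measurable_fun setT (far_kernel h u).
Proof.
exact: (measurableT_comp (measurable_far_kernel h) (@pair1_measurable _ _ R R u)).
Qed.

Lemma measurable_near_kernel1 h u : measurable_fun setT (near_kernel h u).
Proof.
exact: (measurableT_comp (measurable_near_kernel h) (@pair1_measurable _ _ R R u)).
Qed.

Context d0 (T0 : measurableType d0) (P0 : probability T0 R).
Variables (X : 'I_3 -> {RV P0 >-> R}) (Z : {RV P0 >-> R}).
Hypothesis Z_ge0 : forall w, 0 <= Z w.
Hypothesis Z_bounded : {ae P0, forall w, Z w <= M}.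
Local Notation Y w := (X 0 w ^+ 2 + X 1 w ^+ 2).

Definition planar_copy (w : T0) : R * R * R := (X 0 w, X 1 w, Z w).

Lemma measurable_planar_copy : measurable_fun setT planar_copy.
Proof. by apply/measurable_fun_pairP; split => //; exact/measurable_fun_pairP. Qed.

Let mY : measurable_fun setT (fun w => Y w).
Proof. by apply: measurable_funD; apply: measurable_funX. Qed.

Lemma expect_clipped_stat (k : R -> R) : measurable_fun setT k -> (forall y, 0 <= k y) ->
  (\int[P0]_w (clipped_stat k (planar_copy w))%:E =
   \int[P0]_w (Z w * k (Y w))%:E)%E.
Proof.
move=> mk k0; apply: ge0_ae_eq_integral => //.
- apply/measurable_EFinP; apply: measurableT_comp measurable_planar_copy.
  exact: measurable_clipped_stat.
- by apply/measurable_EFinP; apply: measurable_funM => //; exact: measurableT_comp.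
- by move=> w _; rewrite lee_fin clipped_stat_ge0.
- by move=> w _; rewrite lee_fin mulr_ge0.
- by apply: filterS Z_bounded => w ZM _; rewrite /clipped_stat/= clip_id// Z_ge0.
Qed.

Variables (x e D : R).
Hypothesis e_gt0 : 0 < e.
Hypothesis local_le : forall k : R -> \bar R, measurable_fun setT k ->
  (forall t, (0 <= k t)%E) ->
  (forall t, ~ (x - e < t < x + 2 * e) -> k t = 0%E) ->
  (\int[P0]_w ((Z w)%:E * k (Y w)) <= D%:E * \int[mu]_v k v)%E.

Lemma expect_near_kernel_le (h u : R) : 0 < h -> h <= e -> x - e <= u <= x + e ->
  (\int[P0]_w (Z w * near_kernel h u (Y w))%:E <= (D * (2 * Num.sqrt h))%:E)%E.
Proof.
move=> h0 he /andP[xu ux].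
have mk : measurable_fun setT (fun y => (near_kernel h u y)%:E).
  by apply/measurable_EFinP; exact: measurable_near_kernel1.
have k0 y : (0 <= (near_kernel h u y)%:E)%E by rewrite lee_fin near_kernel_ge0.
under eq_integral do rewrite EFinM.
apply: le_trans (local_le mk k0 _) _ => [t|].
  move=> nt; congr EFin; rewrite /near_kernel.
  have [tu|tu] := leP (t - u) 0; first by rewrite isq_le0 ?mul0r.
  have [th|th] := ltP (t - u) h; last by rewrite mulr0.
  by exfalso; apply: nt; apply/andP; split; lra.
rewrite le_eqVlt; apply/orP; left; apply/eqP; rewrite EFinM; congr (_ * _)%E.
rewrite -(integral_isq_itv0 (ltW h0)) [RHS]integral_mkcond.
pose g (t : R) : \bar R := (isq t * (t < h)%R%:R)%:E.
have mg : measurable_fun setT g.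
  rewrite (_ : g = (fun y => (near_kernel h 0 y)%:E)); last first.
    by apply/funext => t; rewrite /g /near_kernel subr0.
  by apply/measurable_EFinP; exact: measurable_near_kernel1.
have g0 t : (0 <= g t)%E by rewrite lee_fin mulr_ge0 ?isq_ge0.
transitivity (\int[mu]_t g (t - u)%R)%E.
  by apply: eq_integral => t _; rewrite /g /near_kernel.
rewrite (ge0_integral_shift (- u) mg g0).
apply: eq_integral => t _; rewrite patchE mem_setE in_itv/= /g.
have [t0|t0] := leP t 0; first by rewrite isq_le0 ?mul0r.
by case: ltP => _ /=; rewrite ?mulr1 ?mulr0.
Qed.

(** The squared kernel is 1 / (y - u) for y - u >= h. Up to y - u = e the
    bounded density of the Z-weighted law of Y yields the logarithm; beyond, the
    square is at most M^2 / e. *)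
Lemma expect_far_kernel_sqr_le (h u : R) : 0 < h -> h <= e -> x - e <= u <= x + e ->
  (\int[P0]_w (clipped_stat (far_kernel h u) (planar_copy w) ^+ 2)%:E <=
   (M * D * (ln e - ln h) + M ^+ 2 / e)%:E)%E.
Proof.
move=> h0 he /andP[xu ux].
pose kk (v y : R) : R := far_kernel h v y ^+ 2 * (y - v < e)%R%:R.
have mkk v : measurable_fun setT (fun y => (kk v y)%:E).
  apply/measurable_EFinP; apply: measurable_funM.
    by apply: measurable_funX; exact: measurable_far_kernel1.
  rewrite (_ : (fun y : R => _) = (fun y : R => if y - v < e then 1 else 0)).
    by apply: measurable_fun_ifT => //; apply: measurable_fun_ltr => //; exact: measurable_funB.
  by apply/funext => y; case: ifP.
have kk0 v y : 0 <= kk v y by rewrite mulr_ge0 ?sqr_ge0.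
pose k := kk u; have mk : measurable_fun setT (fun y => (k y)%:E) := mkk u.
have k0 y : 0 <= k y := kk0 u y.
have k0E y : (0 <= (k y)%:E)%E by rewrite lee_fin.
have ksupp t : ~ (x - e < t < x + 2 * e) -> (k t)%:E = 0%E.
  move=> nt; congr EFin; rewrite /k /kk /far_kernel.
  have [th|th] := leP h (t - u); last by rewrite mulr0 expr0n mul0r.
  have [te|te] := ltP (t - u) e; last by rewrite mulr0.
  by exfalso; apply: nt; apply/andP; split; lra.
have sqE t : h <= t - u -> far_kernel h u t ^+ 2 = (t - u)^-1.
  by move=> th; rewrite /far_kernel th mulr1 sqr_isq// (lt_le_trans h0).
have mS : measurable_fun setT (fun w => clipped_stat (far_kernel h u) (planar_copy w)).
  apply: measurableT_comp measurable_planar_copy.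
  by apply: measurable_clipped_stat; exact: measurable_far_kernel1.
have mkY : measurable_fun setT (fun w => (k (Y w))%:E) by exact: (measurableT_comp mk mY).
have mZk : measurable_fun setT (fun w => (Z w)%:E * (k (Y w))%:E)%E.
  by apply: emeasurable_funM => //; exact/measurable_EFinP.
have mMZk : measurable_fun setT (fun w => M%:E * ((Z w)%:E * (k (Y w))%:E))%E.
  by apply: emeasurable_funM.
apply: (@le_trans _ _ (\int[P0]_w (M%:E * ((Z w)%:E * (k (Y w))%:E) + (M ^+ 2 / e)%:E))%E).
  apply: ge0_le_integral => //.
  - by move=> w _; rewrite lee_fin sqr_ge0.
  - by apply/measurable_EFinP; exact: measurable_funX.
  - exact: emeasurable_funD.
  - move=> w _; rewrite -!EFinM -EFinD lee_fin /clipped_stat/=.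
    set z := clip _; rewrite exprMn.
    have z0 : 0 <= z by exact: clip_ge0.
    have zM : z <= M by exact: clip_le.
    have zZ : z <= Z w by rewrite /z /clip max_l ?ge_min ?lexx.
    rewrite -/(Y w) /planar_sqr/= /k /kk; set y := Y w.
    have Me0 : 0 <= M ^+ 2 / e by rewrite divr_ge0 ?sqr_ge0 ?(ltW e_gt0).
    have [ye|ye] /= := ltP (y - u) e.
      rewrite mulr1 -[leLHS]addr0; apply: lerD => //.
      by rewrite mulrA; apply: ler_wpM2r; [exact: sqr_ge0|rewrite expr2; apply: ler_pM].
    rewrite !mulr0 add0r sqE ?(le_trans he)//.
    apply: ler_pM; rewrite ?sqr_ge0 ?invr_ge0 ?(le_trans _ ye) ?(ltW e_gt0)//.
      by rewrite ler_pXn2r// nnegrE// ltW.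
    by rewrite lef_pV2 ?posrE// (lt_le_trans e_gt0).
rewrite ge0_integralD//; last 2 first.
- move=> w _; rewrite -!EFinM lee_fin; apply: mulr_ge0; first exact: ltW.
  exact: mulr_ge0.
- by move=> w _; rewrite lee_fin divr_ge0 ?sqr_ge0 ?(ltW e_gt0).
rewrite integral_cst// [X in (_ + _ * X)%E]probability_setT mule1 EFinD leeD2r//.
rewrite ge0_integralZl//; last 2 first.
- by move=> w _; rewrite -EFinM lee_fin; exact: mulr_ge0.
- by rewrite lee_fin ltW.
rewrite -mulrA EFinM; apply: lee_wpmul2l; first by rewrite lee_fin ltW.
apply: le_trans (local_le mk k0E ksupp) _.
rewrite le_eqVlt; apply/orP; left; apply/eqP; rewrite EFinM; congr (_ * _)%E.
rewrite -(integral_invr_itv h0 he).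
transitivity (\int[mu]_t (kk 0%R (t - u)%R)%:E)%E.
  by apply: eq_integral => t _; rewrite /k /kk /far_kernel !subr0.
have kk0E t : (0 <= (kk 0%R t)%:E)%E by rewrite lee_fin.
rewrite (ge0_integral_shift (- u) (mkk 0) kk0E) [RHS]integral_mkcond.
apply: eq_integral => t _; rewrite patchE mem_setE in_itv/= /kk /far_kernel subr0.
have [ht|th] := leP h t; last by rewrite mulr0 expr0n mul0r.
rewrite mulr1 sqr_isq ?(lt_le_trans h0)//.
by case: ltP => _ /=; rewrite ?mulr1 ?mulr0.
Qed.

End clipped_statistics.

(** * Expected deviation over a window *)

Section expected_deviation.
Context {R : realType} d (T : measurableType d) (P : probability T R).
Local Notation mu := (@lebesgue_measure R).

Lemma measurable_weighted_integral (F : R * T -> R) (g : R -> R) :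
  measurable_fun setT F -> (forall p, 0 <= F p) ->
  measurable_fun setT g -> (forall u, 0 <= g u) ->
  measurable_fun setT (fun w => \int[mu]_u (F (u, w) * g u)%:E)%E.
Proof.
move=> mF F0 mg g0.
have mk : measurable_fun setT (fun p : R * T => (F p * g p.1)%:E).
  by apply/measurable_EFinP; apply: measurable_funM => //; exact: measurableT_comp.
apply: (measurable_fun_fubini_tonelli_G (m1 := mu) _ mk) => p.
by rewrite lee_fin mulr_ge0.
Qed.

Lemma expect_weighted_integral_le (F : R * T -> R) (g : R -> R) (A : R) :
  measurable_fun setT F -> (forall p, 0 <= F p) ->
  measurable_fun setT g -> (forall u, 0 <= g u) -> 0 <= A ->
  (forall u, g u != 0 -> (\int[P]_w (F (u, w))%:E <= A%:E)%E) ->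
  (\int[P]_w \int[mu]_u (F (u, w) * g u)%:E <= A%:E * \int[mu]_u (g u)%:E)%E.
Proof.
move=> mF F0 mg g0 A0 FA.
pose k (p : R * T) := (F p * g p.1)%:E.
have mk : measurable_fun setT k.
  by apply/measurable_EFinP; apply: measurable_funM => //; exact: measurableT_comp.
have k0 p : (0 <= k p)%E by rewrite lee_fin mulr_ge0.
rewrite -(@fubini_tonelli _ _ _ _ _ mu P k mk k0).
have mgE : measurable_fun setT (fun u : R => (g u)%:E) by exact/measurable_EFinP.
have g0E u : setT u -> (0 <= (g u)%:E)%E by rewrite lee_fin.
have A0E : (0 <= A%:E)%E by rewrite lee_fin.
rewrite -(ge0_integralZl mu measurableT mgE g0E A0E).
apply: ge0_le_integral => //.
- by move=> u _; exact: integral_ge0.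
- exact: (measurable_fun_fubini_tonelli_F (m2 := P) _ mk k0).
- exact: emeasurable_funM.
- move=> u _; have mFu : measurable_fun setT (fun w => F (u, w)).
    exact: (measurableT_comp mF (@pair1_measurable _ _ _ _ u)).
  have [gu|gu] := eqVneq (g u) 0.
    by rewrite gu mule0 (eq_integral (cst 0%E)) ?integral0// => w _; rewrite /k/= gu mulr0.
  under eq_integral do rewrite /k/= EFinM.
  rewrite ge0_integralZr ?lee_fin//; last 2 first.
  + exact/measurable_EFinP.
  + by move=> w _; rewrite lee_fin.
  by apply: lee_wpmul2r; rewrite ?lee_fin ?FA.
Qed.

Variables (x e b c q K L : R) (D1 D2 : R * T -> R).
Hypotheses (mD1 : measurable_fun setT D1) (mD2 : measurable_fun setT D2).
Hypotheses (D1_ge0 : forall p, 0 <= D1 p) (D2_ge0 : forall p, 0 <= D2 p).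
Hypotheses (b_gt0 : 0 < b) (c_gt0 : 0 < c) (e_gt0 : 0 < e) (L_gt0 : 0 < L).
Hypotheses (q_gt0 : 0 < q) (q_le1 : q <= 1) (K_ge1 : 1 <= K).
Hypothesis expect_D1_sqr : forall u, x - e <= u <= x + e ->
  (\int[P]_w (D1 (u, w) ^+ 2)%:E <= (K * q)%:E)%E.
Hypothesis expect_D2 : forall u, x - e <= u <= x + e ->
  (\int[P]_w (D2 (u, w))%:E <= (K * q)%:E)%E.

(** The scale on which U_tilde and U_sharp are compared. It is bounded below by
    a multiple of sqrt q, since on smaller scales the deviations are not
    dominated by the concavity of U. *)
Definition scale : R := Num.max b (L * Num.sqrt q).
Hypothesis scale_le : 4 * scale <= e.

Let rt := Num.sqrt q.
Let rt0 : 0 < rt. Proof. by rewrite sqrtr_gt0. Qed.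
Let rtE : rt ^+ 2 = q. Proof. by rewrite sqr_sqrtr// ltW. Qed.
Let rt1 : rt <= 1. Proof. by rewrite -sqrtr1 ler_wsqrtr. Qed.
Let K0 : 0 < K. Proof. exact: lt_le_trans K_ge1. Qed.

Let mD1u u : measurable_fun setT (fun w => D1 (u, w)).
Proof. exact: (measurableT_comp mD1 (@pair1_measurable _ _ _ _ u)). Qed.

Let mD2u u : measurable_fun setT (fun w => D2 (u, w)).
Proof. exact: (measurableT_comp mD2 (@pair1_measurable _ _ _ _ u)). Qed.

Lemma scale_gt0 : 0 < scale.
Proof. by rewrite lt_max b_gt0. Qed.

(** Only the mean of D1^2 is controlled; D1 <= (D1^2 / rt + rt) / 2 with rt =
    sqrt q converts it. *)
Lemma expect_deviation_le u : x - e <= u <= x + e ->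
  (\int[P]_w (D1 (u, w) + D2 (u, w))%:E <= (2 * K * Num.sqrt q)%:E)%E.
Proof.
move=> uN.
have mE1 : measurable_fun setT (fun w => ((2 * rt)^-1 * D1 (u, w) ^+ 2)%:E).
  by apply/measurable_EFinP; apply: measurable_funM => //; exact: measurable_funX.
have mE2 : measurable_fun setT (fun w => (D2 (u, w))%:E) by exact/measurable_EFinP.
have p10 w : setT w -> (0 <= ((2 * rt)^-1 * D1 (u, w) ^+ 2)%:E)%E.
  by move=> _; rewrite lee_fin mulr_ge0 ?sqr_ge0// invr_ge0 mulr_ge0// ltW.
have p20 w : setT w -> (0 <= (D2 (u, w))%:E)%E by rewrite lee_fin.
have p30 (w : T) : setT w -> (0 <= (rt / 2)%:E :> \bar R)%E.
  by move=> _; rewrite lee_fin divr_ge0// ltW.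
have p12 w : setT w -> (0 <= ((2 * rt)^-1 * D1 (u, w) ^+ 2)%:E + (D2 (u, w))%:E)%E.
  by move=> wT; rewrite adde_ge0// ?p10 ?p20.
have m12 : measurable_fun setT
    (fun w => ((2 * rt)^-1 * D1 (u, w) ^+ 2)%:E + (D2 (u, w))%:E)%E.
  exact: emeasurable_funD.
apply: (@le_trans _ _ (\int[P]_w (((2 * rt)^-1 * D1 (u, w) ^+ 2)%:E
    + (D2 (u, w))%:E + (rt / 2)%:E))%E).
  apply: ge0_le_integral => //.
  - by move=> w _; rewrite lee_fin addr_ge0.
  - by apply/measurable_EFinP; exact: measurable_funD.
  - exact: emeasurable_funD.
  - move=> w _; rewrite -!EFinD lee_fin addrAC lerD2r.
    rewrite -(@ler_pM2l _ (2 * rt)) ?mulr_gt0// mulrDr mulVKf ?gt_eqF ?mulr_gt0//.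
    have := sqr_ge0 (D1 (u, w) - rt); rewrite sqrrB; lra.
rewrite (ge0_integralD P measurableT p12 m12 p30 (measurable_cst _)).
rewrite (ge0_integralD P measurableT p10 mE1 p20 mE2).
rewrite integral_cst// [X in (_ + _ * X)%E]probability_setT mule1.
under eq_integral do rewrite EFinM.
rewrite ge0_integralZl//; last 3 first.
- by apply/measurable_EFinP; exact: measurable_funX.
- by move=> w _; rewrite lee_fin sqr_ge0.
- by rewrite lee_fin invr_ge0 mulr_ge0// ltW.
have iv0 : (0 <= ((2 * rt)^-1)%:E :> \bar R)%E by rewrite lee_fin invr_ge0 mulr_ge0// ltW.
apply: le_trans (leeD2r _ (leeD (lee_wpmul2l iv0 (expect_D1_sqr uN)) (expect_D2 uN))) _.
rewrite -EFinM -!EFinD lee_fin -/rt -rtE.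
have -> : (2 * rt)^-1 * (K * rt ^+ 2) = K * rt / 2 by field; rewrite gt_eqF.
have h1 : rt <= K * rt by rewrite ler_peMl ?(ltW rt0).
have h2 : K * rt ^+ 2 <= K * rt.
  by rewrite ler_pM2l// expr2 ler_piMl ?(ltW rt0).
lra.
Qed.

Lemma expect_weighted_deviation_le :
  (\int[P]_w \int[mu]_u ((D1 (u, w) + D2 (u, w)) * local_weight x e scale u)%:E <=
   (4 * pi * K / L)%:E)%E.
Proof.
have F0 p : 0 <= D1 p + D2 p by rewrite addr_ge0.
have A0 : 0 <= 2 * K * Num.sqrt q by rewrite !mulr_ge0// ltW.
have g0 u : 0 <= local_weight x e scale u by exact: local_weight_ge0.
apply: le_trans (expect_weighted_integral_le (measurable_funD mD1 mD2) F0
  (measurable_local_weight _ _ _) g0 A0 _) _.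
  move=> u; rewrite /local_weight indicE mulf_eq0 negb_or => /andP[_].
  case: (boolP (u \in _)); last by rewrite eqxx.
  by rewrite inE/= in_itv/= => uN _; exact: expect_deviation_le.
apply: le_trans (lee_wpmul2l _ (integral_local_weight_le x e scale_gt0)) _.
  by rewrite lee_fin.
rewrite -EFinM lee_fin.
have -> : 2 * K * Num.sqrt q * (2 * pi / scale) = 4 * pi * K * (rt / scale).
  by rewrite /rt; field; rewrite gt_eqF// scale_gt0.
apply: ler_wpM2l; first by rewrite !mulr_ge0 ?pi_ge0// ltW.
rewrite ler_pdivrMr ?scale_gt0// ler_pdivlMl//.
by rewrite /scale le_max lexx orbT.
Qed.

(** The bound on the averaged excess to be used: the quadratic one when the
    scale is b, the linear one when it is larger. *)
Definition averaged_bound (p : R * T) : R :=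
  if L * Num.sqrt q <= b then D1 p ^+ 2 / c + 4 * b * D2 p
  else 4 * b * (D1 p + D2 p).

Lemma measurable_averaged_bound : measurable_fun setT averaged_bound.
Proof.
rewrite /averaged_bound; case: (L * Num.sqrt q <= b).
  by apply: measurable_funD; apply: measurable_funM => //; exact: measurable_funX.
by apply: measurable_funM => //; exact: measurable_funD.
Qed.

Lemma averaged_bound_ge0 p : 0 <= averaged_bound p.
Proof.
rewrite /averaged_bound; case: (L * Num.sqrt q <= b).
  by rewrite addr_ge0// ?divr_ge0 ?sqr_ge0 ?(ltW c_gt0)// !mulr_ge0// ltW.
by rewrite !mulr_ge0 ?addr_ge0// ltW.
Qed.

Local Notation I := (`[x - 4 * scale, x + 4 * scale]%classic : set R).

(** When the scale is b, the window has length 8 b and the integrand has mean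
    O(q). Otherwise the window has length 8 L sqrt q and the integrand mean O(b
    sqrt q). *)
Lemma expect_averaged_bound_le :
  (\int[P]_w \int[mu]_u (averaged_bound (u, w) * \1_I u)%:E <=
   (64 * K * (c^-1 + e + L) * b * q)%:E)%E.
Proof.
have g0 u : 0 <= (\1_I u : R) by [].
have mI : measurable (I : set (measurableTypeR R)) by [].
have sc0 := scale_gt0; have b0 := b_gt0; have c0 := c_gt0; have sce := scale_le.
have cV0 : 0 < c^-1 by rewrite invr_gt0.
have inN u : (\1_I u : R) != 0 -> x - e <= u <= x + e.
  rewrite indicE; case: (boolP (u \in _)); last by rewrite eqxx.
  by rewrite inE/= in_itv/= => /andP[? ?] _; apply/andP; split; lra.
have intI : (\int[mu]_u (\1_I u)%:E = (8 * scale)%:E)%E.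
  rewrite integral_indic//= setIT lebesgue_measure_itv/= lte_fin.
  have -> : x - 4 * scale < x + 4 * scale by lra.
  by rewrite -EFinB; congr EFin; ring.
suff [A [A0 AB AC]] : exists A, [/\ 0 <= A, A * (8 * scale) <=
    64 * K * (c^-1 + e + L) * b * q & forall u, x - e <= u <= x + e ->
    (\int[P]_w (averaged_bound (u, w))%:E <= A%:E)%E].
  apply: le_trans (expect_weighted_integral_le measurable_averaged_bound
    averaged_bound_ge0 (measurable_indic mI) g0 A0 _) _ => [u /inN|]; first exact: AC.
  by rewrite [X in (_ * X)%E]intI -EFinM lee_fin.
have KqL : 0 <= K * q * b by rewrite !mulr_ge0// ltW.
have e0 := e_gt0; have L0 := L_gt0.
rewrite /averaged_bound; have [Lb|Lb] := leP (L * Num.sqrt q) b.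
  exists (K * q * (c^-1 + 4 * b)); split.
  - by rewrite !mulr_ge0 ?addr_ge0 ?mulr_ge0// ltW.
  - rewrite /scale max_l//.
    rewrite (_ : _ * (8 * b) = K * q * b * (8 * (c^-1 + 4 * b))); last by ring.
    rewrite [leRHS](_ : _ = K * q * b * (64 * (c^-1 + e + L))); last by ring.
    apply: ler_wpM2l => //.
    have be : (b <= e)%R by move: sce; rewrite /scale max_l//; lra.
    lra.
  - move=> u uN; under eq_integral do rewrite EFinD.
    have m1 : measurable_fun setT (fun w => (D1 (u, w) ^+ 2 / c)%:E).
      by apply/measurable_EFinP; apply: measurable_funM => //; exact: measurable_funX.
    have m2 : measurable_fun setT (fun w => (4 * b * D2 (u, w))%:E).
      by apply/measurable_EFinP; apply: measurable_funM.
    have p1 (w : T) : setT w -> (0 <= (D1 (u, w) ^+ 2 / c)%:E)%E.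
      by move=> _; rewrite lee_fin divr_ge0 ?sqr_ge0// ltW.
    have p2 (w : T) : setT w -> (0 <= (4 * b * D2 (u, w))%:E)%E.
      by move=> _; rewrite lee_fin !mulr_ge0// ltW.
    rewrite (ge0_integralD P measurableT p1 m1 p2 m2) mulrDr EFinD; apply: leeD.
      under eq_integral do rewrite EFinM.
      rewrite ge0_integralZr//; last 3 first.
      - by apply/measurable_EFinP; exact: measurable_funX.
      - by move=> w _; rewrite lee_fin sqr_ge0.
      - by rewrite lee_fin ltW.
      by rewrite EFinM; apply: lee_wpmul2r; [rewrite lee_fin ltW|exact: expect_D1_sqr].
    under eq_integral do rewrite EFinM.
    rewrite ge0_integralZl//; last 3 first.
    - exact/measurable_EFinP.
    - by move=> w _; rewrite lee_fin.
    - by rewrite lee_fin mulr_ge0// ltW.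
    rewrite [X in (_ <= X%:E)%E]mulrC [leRHS]EFinM; apply: lee_wpmul2l; [by rewrite lee_fin mulr_ge0// ltW|].
    exact: expect_D2.
exists (4 * b * (2 * K * rt)); split.
- by rewrite !mulr_ge0// ltW.
- rewrite /scale max_r; last exact: ltW.
  rewrite [leLHS](_ : _ = K * rt ^+ 2 * b * (64 * L)); last by rewrite /rt; ring.
  rewrite rtE [leRHS](_ : _ = K * q * b * (64 * (c^-1 + e + L))); last by ring.
  by apply: ler_wpM2l => //; lra.
- move=> u uN; under eq_integral do rewrite EFinM.
  rewrite ge0_integralZl//; last 3 first.
  - by apply/measurable_EFinP; exact: measurable_funD.
  - by move=> w _; rewrite lee_fin addr_ge0.
  - by rewrite lee_fin mulr_ge0// ltW.
  rewrite [leRHS]EFinM; apply: lee_wpmul2l; [by rewrite lee_fin mulr_ge0// ltW|].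
  exact: expect_deviation_le.
Qed.

End expected_deviation.

(** * The sample curves *)

Section grid.
Context {R : realType}.

Lemma grid_uniform_bound (f g : R -> R) (S M eta : R) (N : nat) : (0 < N)%N -> 0 < S ->
  (forall s t, 0 <= s -> s <= t -> 0 <= f t - f s <= 2 * M * Num.sqrt (t - s)) ->
  (forall s t, 0 <= s -> s <= t -> 0 <= g t - g s <= 2 * M * Num.sqrt (t - s)) ->
  0 <= M -> 2 * M * Num.sqrt (S / N%:R) <= eta / 2 ->
  (forall j : 'I_N.+1, `|f (j%:R * (S / N%:R)) - g (j%:R * (S / N%:R))| <= eta / 2) ->
  forall s, 0 <= s <= S -> `|f s - g s| <= eta.
Proof.
move=> N0 S0 fh gh M0 meta fg s /andP[s0 sS].
have N0' : 0 < N%:R :> R by rewrite ltr0n.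
(* Compare with the largest grid point t below s: f and g each move by at most
   eta / 2 in the same direction, so that f s - g s moves by at most eta / 2. *)
set a := S / N%:R in meta fg *; have a0 : 0 < a by rewrite divr_gt0.
have /andP[js sj] := truncn_itv (divr_ge0 s0 (ltW a0)).
set j := Num.truncn (s / a) in js sj.
have {}js : j%:R * a <= s by rewrite -ler_pdivlMr.
have {}sj : s <= j%:R * a + a by rewrite -natr1 ltr_pdivrMr// mulrDl mul1r in sj; exact: ltW.
have jN : (j < N.+1)%N.
  rewrite ltnS -(ler_nat R) -(ler_pM2r a0); apply: le_trans js _.
  by rewrite /a mulrC mulfVK ?gt_eqF.
have := fg (Ordinal jN) => /=; set t := _ * a in js sj *; rewrite ler_norml => /andP[h1 h2].
have t0 : 0 <= t by rewrite mulr_ge0// ltW.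
have st : Num.sqrt (s - t) <= Num.sqrt a by apply: ler_wsqrtr; lra.
have {}st : 2 * M * Num.sqrt (s - t) <= eta / 2.
  by apply: le_trans meta; apply: ler_wpM2l st; rewrite mulr_ge0.
have /andP[f1 f2] := fh _ _ t0 js; have /andP[g1 g2] := gh _ _ t0 js.
by rewrite ler_norml; apply/andP; split; lra.
Qed.

End grid.

Section sample_curves.
Context {R : realType} d0 (T0 : measurableType d0) (P0 : probability T0 R).
Local Notation mu := (@lebesgue_measure R).
Variables (X : 'I_3 -> {RV P0 >-> R}) (Z : {RV P0 >-> R}).
Hypothesis Z_ge0 : forall w, 0 <= Z w.
Variable M : R.
Hypothesis M_gt0 : 0 < M.
Hypothesis Z_bounded : {ae P0, forall w, Z w <= M}.
Context d (T : measurableType d) (P : probability T R).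
Variables X1 X2 Zs : nat -> {RV P >-> R}.
Hypothesis copies : forall i, same_law P (fun w => (X1 i w, X2 i w, Zs i w))
  P0 (planar_copy X Z).
Hypothesis indep : mutually_independent P (fun i w => (X1 i w, X2 i w, Zs i w)).
Variable n : nat.
Hypothesis n_gt0 : (0 < n)%N.
Local Notation V := (fun i w => (X1 i w, X2 i w, Zs i w)).
Local Notation Y w := (X 0 w ^+ 2 + X 1 w ^+ 2).
Local Notation Ysample w := (fun i => X1 i w ^+ 2 + X2 i w ^+ 2).

Let mV i : measurable_fun setT (V i).
Proof. by apply/measurable_fun_pairP; split => //; exact/measurable_fun_pairP. Qed.

Let mY : measurable_fun setT (fun w => Y w).
Proof. by apply: measurable_funD; apply: measurable_funX. Qed.

Definition stat_mean (k : R -> R) : R := fine (\int[P0]_w (Z w * k (Y w))%:E)%E.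

Definition empirical (k : R -> R) (w : T) : R := sample_mean V (clipped_stat M k) n w.

Lemma empirical_ge0 (k : R -> R) w : (forall y, 0 <= k y) -> 0 <= empirical k w.
Proof. by move=> k0; apply: sample_mean_ge0 => s; exact: clipped_stat_ge0. Qed.

Lemma empirical_expectation (k : R -> R) : measurable_fun setT k ->
  (forall y, 0 <= k y) -> (\int[P0]_w (Z w * k (Y w))%:E < +oo)%E ->
  (\int[P]_w (empirical k w)%:E = (stat_mean k)%:E)%E.
Proof.
move=> mk k0 ky; apply: (sample_mean_expectation mV (measurable_planar_copy X Z) copies) => //.
- exact: measurable_clipped_stat.
- by move=> s; exact: clipped_stat_ge0.
- rewrite expect_clipped_stat// fineK// ge0_fin_numE//.
  by apply: integral_ge0 => w _; rewrite lee_fin mulr_ge0.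
Qed.

Lemma empirical_variance (k : R -> R) s : measurable_fun setT k ->
  (forall y, 0 <= k y) -> (\int[P0]_w (Z w * k (Y w))%:E < +oo)%E ->
  (\int[P0]_w (clipped_stat M k (planar_copy X Z w) ^+ 2)%:E <= s%:E)%E ->
  (\int[P]_w ((empirical k w - stat_mean k) ^+ 2)%:E <= (n%:R^-1 * s)%:E)%E.
Proof.
move=> mk k0 ky ks; apply: (sample_mean_variance mV (measurable_planar_copy X Z) copies) => //.
- exact: measurable_clipped_stat.
- by move=> s'; exact: clipped_stat_ge0.
- rewrite expect_clipped_stat// fineK// ge0_fin_numE//.
  by apply: integral_ge0 => w _; rewrite lee_fin mulr_ge0.
Qed.

Lemma measurable_empirical (k : R -> R -> R) :
  measurable_fun setT (fun p : R * R => k p.1 p.2) ->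
  measurable_fun setT (fun p : R * T => empirical (k p.1) p.2).
Proof.
move=> mk; apply: measurable_funM => //; apply: measurable_sum => i.
have mVi : measurable_fun setT (fun p : R * T => V i p.2).
    exact: (measurableT_comp (mV i) (@measurable_snd _ _ R T)).
apply: measurable_funM.
  have mZi : measurable_fun setT (fun p : R * T => Zs i p.2) by exact: measurableT_comp.
  exact: (measurableT_comp (@measurable_clip R M) mZi).
apply: (measurableT_comp mk (g := fun p : R * T => (p.1, planar_sqr (V i p.2)))).
have mp : measurable_fun setT (fun p : R * T => planar_sqr (V i p.2)).
  exact: (measurableT_comp (@measurable_planar_sqr R) mVi).
exact: (measurable_fun_pair (@measurable_fst _ _ R T) mp).
Qed.

Lemma measurable_stat_mean (k : R -> R -> R) :
  measurable_fun setT (fun p : R * R => k p.1 p.2) -> (forall u y, 0 <= k u y) ->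
  measurable_fun setT (fun u => stat_mean (k u)).
Proof.
move=> mk k0; apply: measurableT_comp => //.
have mf : measurable_fun setT (fun p : R * T0 => (Z p.2 * k p.1 (Y p.2))%:E).
  apply/measurable_EFinP; apply: measurable_funM; first exact: measurableT_comp.
  apply: (measurableT_comp mk (g := fun p : R * T0 => (p.1, Y p.2))).
  have mp : measurable_fun setT (fun p : R * T0 => Y p.2).
    exact: (measurableT_comp mY (@measurable_snd _ _ R T0)).
  exact: (measurable_fun_pair (@measurable_fst _ _ R T0) mp).
apply: (measurable_fun_fubini_tonelli_F (m2 := P0) _ mf) => p.
by rewrite lee_fin mulr_ge0.
Qed.

(** A countable union of null events, each by equality of the laws. *)
Lemma Zs_out_negligible : P.-negligible [set w | exists i, ~ (0 <= Zs i w <= M)].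
Proof.
pose out := [set s : R * R * R | ~ (0 <= s.2 <= M)].
have mout : measurable out.
  rewrite (_ : out = ~` (snd @^-1` `[0, M])).
    by apply: measurableC; rewrite -[X in measurable X]setTI; exact: measurable_snd.
  by apply/seteqP; split => s /=; rewrite in_itv.
rewrite (_ : [set w | _] = \bigcup_i (V i @^-1` out)); last first.
  by apply/seteqP; split => [w [i wi]|w [i _ wi]]; exists i.
apply: negligible_bigcup => i; apply/negligibleP.
  by rewrite -[X in measurable X]setTI; exact: mV.
have mP : measurable (planar_copy X Z @^-1` out).
  by rewrite -[X in measurable X]setTI; exact: measurable_planar_copy.
have N0 : P0.-negligible (planar_copy X Z @^-1` out); last first.
  by apply: (eq_trans (copies i mout)); exact: measure_negligible mP N0.
apply: negligibleS Z_bounded => w /= wout ZM; apply: wout.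
by rewrite Z_ge0.
Qed.

End sample_curves.

Section sample_deviation.
Context {R : realType} d0 (T0 : measurableType d0) (P0 : probability T0 R).
Local Notation mu := (@lebesgue_measure R).
Variables (X : 'I_3 -> {RV P0 >-> R}) (Z : {RV P0 >-> R}).
Hypothesis Z_ge0 : forall w, 0 <= Z w.
Variable M : R.
Hypothesis M_gt0 : 0 < M.
Hypothesis Z_bounded : {ae P0, forall w, Z w <= M}.
Context d (T : measurableType d) (P : probability T R).
Variables X1 X2 Zs : nat -> {RV P >-> R}.
Hypothesis copies : forall i, same_law P (fun w => (X1 i w, X2 i w, Zs i w))
  P0 (planar_copy X Z).
Hypothesis indep : mutually_independent P (fun i w => (X1 i w, X2 i w, Zs i w)).
Variable n : nat.
Hypothesis n_gt0 : (0 < n)%N.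
Local Notation Y w := (X 0 w ^+ 2 + X 1 w ^+ 2).
Local Notation Ysample w := (fun i => X1 i w ^+ 2 + X2 i w ^+ 2).
Local Notation Zsample w := (fun i => Zs i w).
Local Notation empirical := (empirical M X1 X2 Zs n).
Local Notation stat_mean := (stat_mean X Z).

Let mY : measurable_fun setT (fun w => Y w).
Proof. by apply: measurable_funD; apply: measurable_funX. Qed.

Let n0 : 0 < n%:R :> R. Proof. by rewrite ltr0n. Qed.

Lemma empirical_clipped (k : R -> R) w : (forall i, 0 <= Zs i w <= M) ->
  empirical k w = n%:R^-1 * \sum_(i < n) Zs i w * k (X1 i w ^+ 2 + X2 i w ^+ 2).
Proof.
move=> Zw; congr (_ * _); apply: eq_bigr => i _.
by rewrite /clipped_stat/= clip_id.
Qed.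

Lemma U_sharp_empirical s w : (forall i, 0 <= Zs i w <= M) -> 0 <= s ->
  U_sharp (Ysample w) (Zsample w) n s = empirical (U_weight s) w.
Proof.
move=> Zw s0; rewrite empirical_clipped// U_sharpE// => i.
by have /andP[] := Zw i.
Qed.

Lemma expect_stat_lty (k : R -> R) (a : R) : measurable_fun setT k ->
  (forall y, 0 <= k y <= a) -> (\int[P0]_w (Z w * k (Y w))%:E < +oo)%E.
Proof.
move=> mk ka.
have mkE : measurable_fun setT (fun y => (k y)%:E) by exact/measurable_EFinP.
have k0 y : (0 <= (k y)%:E)%E by rewrite lee_fin; have /andP[] := ka y.
under eq_integral do rewrite EFinM.
apply: le_lt_trans (expect_Z_le X Z_ge0 M_gt0 Z_bounded mkE k0) _.
apply: (@le_lt_trans _ _ (M%:E * a%:E)%E); last by rewrite -EFinM ltry.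
apply: lee_wpmul2l; first by rewrite lee_fin ltW.
apply: expect_le_cst => [|w|w]; first exact: (measurableT_comp mkE mY).
  exact: k0.
by rewrite lee_fin; have /andP[] := ka (Y w).
Qed.

Lemma U_sharp_variance s : 0 <= s ->
  (\int[P]_w ((empirical (U_weight s) w - U_mean X Z s) ^+ 2)%:E <=
   (n%:R^-1 * (4 * M ^+ 2 * s))%:E)%E.
Proof.
move=> s0.
have Ub y : 0 <= U_weight s y <= 2 * Num.sqrt s.
  rewrite U_weight_ge0//= ler_pM2l//.
  by have := sqrtr_holder y s0; rewrite !subr0.
apply: (empirical_variance Z_ge0 M_gt0 Z_bounded copies indep n_gt0).
- exact: measurable_U_weight.
- by move=> y; have /andP[] := Ub y.
- by apply: (expect_stat_lty _ Ub); exact: measurable_U_weight.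
- apply: expect_le_cst => [|w|w].
  + apply/measurable_EFinP; apply: measurable_funX.
    apply: (measurableT_comp _ (measurable_planar_copy X Z)).
    by apply: measurable_clipped_stat; exact: measurable_U_weight.
  + by rewrite lee_fin sqr_ge0.
  + rewrite lee_fin /clipped_stat.
    rewrite [leRHS](_ : _ = (M * (2 * Num.sqrt s)) ^+ 2); last first.
      by rewrite !exprMn sqr_sqrtr//; ring.
    set y := planar_sqr _; have /andP[U0 U1] := Ub y.
    rewrite ler_pXn2r// ?nnegrE; first by rewrite ler_pM ?clip_ge0 ?clip_le.
      by rewrite mulr_ge0 ?clip_ge0.
    by rewrite !mulr_ge0 ?sqrtr_ge0// ltW.
Qed.

(* With this cut the near part has mean O(sqrt h) = O(1 / n), while ln (1 / h)
   = 2 ln n is still of the order of ln n. *)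
Let h : R := n%:R ^- 2.

Let h0 : 0 < h. Proof. by rewrite invr_gt0 exprn_gt0. Qed.

Definition far_deviation (p : R * T) : R :=
  `|empirical (far_kernel h p.1) p.2 - stat_mean (far_kernel h p.1)|.

Definition near_deviation (p : R * T) : R :=
  empirical (near_kernel h p.1) p.2 + stat_mean (near_kernel h p.1).

Let stat_mean_ge0 (k : R -> R) : (forall y, 0 <= k y) -> 0 <= stat_mean k.
Proof.
move=> k0; apply: fine_ge0; apply: integral_ge0 => w _.
by rewrite lee_fin mulr_ge0.
Qed.

Lemma measurable_far_deviation : measurable_fun setT far_deviation.
Proof.
apply: measurableT_comp => //; apply: measurable_funB.
  exact: (measurable_empirical _ X1 X2 Zs n (measurable_far_kernel h)).
have := measurable_stat_mean X Z_ge0 (measurable_far_kernel h) (@far_kernel_ge0 R h).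
by move=> m; exact: (measurableT_comp m (@measurable_fst _ _ R T)).
Qed.

Lemma measurable_near_deviation : measurable_fun setT near_deviation.
Proof.
apply: measurable_funD.
  exact: (measurable_empirical _ X1 X2 Zs n (measurable_near_kernel h)).
have := measurable_stat_mean X Z_ge0 (measurable_near_kernel h) (@near_kernel_ge0 R h).
by move=> m; exact: (measurableT_comp m (@measurable_fst _ _ R T)).
Qed.

Lemma near_deviation_ge0 p : 0 <= near_deviation p.
Proof.
rewrite addr_ge0 ?stat_mean_ge0//; last by move=> y; exact: near_kernel_ge0.
by apply: empirical_ge0 => // y; exact: near_kernel_ge0.
Qed.

Let far_le u y : 0 <= far_kernel h u y <= isq h.
Proof.
rewrite far_kernel_ge0/= /far_kernel; have [hy|hy] /= := leP h (y - u).
  by rewrite mulr1 isq_nincr.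
by rewrite mulr0 isq_ge0.
Qed.

Let far_lty u : (\int[P0]_w (Z w * far_kernel h u (Y w))%:E < +oo)%E.
Proof. by apply: (expect_stat_lty _ (far_le u)); exact: measurable_far_kernel1. Qed.

Variables (x e D : R).
Hypotheses (e_gt0 : 0 < e) (e_x : e < x) (D_ge0 : 0 <= D).
Hypothesis local_le : forall k : R -> \bar R, measurable_fun setT k ->
  (forall t, (0 <= k t)%E) ->
  (forall t, ~ (x - e < t < x + 2 * e) -> k t = 0%E) ->
  (\int[P0]_w ((Z w)%:E * k (Y w)) <= D%:E * \int[mu]_v k v)%E.
Hypotheses (h_le : h <= e) (ln_ge1 : 1 <= ln n%:R :> R).

(** Chosen so that both deviations have moments at most moment_bound * ln n / n
    as soon as ln n >= 1. *)
Definition moment_bound : R :=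
  1 + M * D * (`|ln e| + 2) + M ^+ 2 / e + 4 * D.

Lemma moment_bound_ge1 : 1 <= moment_bound.
Proof.
have Me : 0 <= M ^+ 2 / e by rewrite divr_ge0 ?sqr_ge0// ltW.
have MD : 0 <= M * D * (`|ln e| + 2) by rewrite !mulr_ge0 ?addr_ge0// ltW.
by have D0 := D_ge0; rewrite /moment_bound; lra.
Qed.

Let sqrt_h : Num.sqrt h = n%:R^-1.
Proof. by rewrite /h sqrtrV ?sqr_ge0// sqrtr_sqr ger0_norm// ltW. Qed.

Let near_le u : x - e <= u <= x + e ->
  (\int[P0]_w (Z w * near_kernel h u (Y w))%:E <= (2 * D / n%:R)%:E)%E.
Proof.
move=> uN; apply: le_trans (expect_near_kernel_le local_le h0 h_le uN) _.
by rewrite sqrt_h lee_fin mulrA (mulrC D).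
Qed.

Let near_lty u : x - e <= u <= x + e ->
  (\int[P0]_w (Z w * near_kernel h u (Y w))%:E < +oo)%E.
Proof. by move=> uN; apply: le_lt_trans (near_le uN) _; exact: ltry. Qed.

Lemma expect_far_deviation_sqr_le u : x - e <= u <= x + e ->
  (\int[P]_w (far_deviation (u, w) ^+ 2)%:E <=
   (moment_bound * (ln n%:R / n%:R))%:E)%E.
Proof.
move=> uN.
have := expect_far_kernel_sqr_le M_gt0 Z_ge0 e_gt0 local_le h0 h_le uN.
move=> /(empirical_variance Z_ge0 M_gt0 Z_bounded copies indep n_gt0
  (measurable_far_kernel1 h u) (fun y => far_kernel_ge0 h u y) (far_lty u)) H.
under eq_integral do rewrite /far_deviation real_normK ?num_real//.
apply: le_trans H _; rewrite lee_fin mulrC mulrA ler_pM2r ?invr_gt0//.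
have -> : ln h = - (2 * ln n%:R).
  by rewrite /h lnV ?posrE ?exprn_gt0// lnXn// mulr_natl.
have MD : 0 <= M * D by rewrite mulr_ge0// ltW.
have Me : 0 <= M ^+ 2 / e by rewrite divr_ge0 ?sqr_ge0// ltW.
have le1 := ln_ge1; set l := ln n%:R in le1 *.
have h1 : ln e <= `|ln e| * l.
  by apply: le_trans (ler_norm _) _; rewrite ler_peMr.
have h2 : M ^+ 2 / e <= M ^+ 2 / e * l by rewrite ler_peMr.
have h3 : M * D * (ln e - - (2 * l)) <= M * D * (`|ln e| * l + 2 * l).
  by apply: ler_wpM2l => //; lra.
have h4 : 0 <= (1 + 4 * D) * l.
  by rewrite mulr_ge0 ?addr_ge0 ?mulr_ge0//; lra.
rewrite [leRHS](_ : _ = M * D * (`|ln e| * l + 2 * l) + M ^+ 2 / e * l + (1 + 4 * D) * l).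
  lra.
by rewrite /moment_bound; ring.
Qed.

Lemma expect_near_deviation_le u : x - e <= u <= x + e ->
  (\int[P]_w (near_deviation (u, w))%:E <=
   (moment_bound * (ln n%:R / n%:R))%:E)%E.
Proof.
move=> uN; pose k := near_kernel h u.
have k0 y : 0 <= k y := near_kernel_ge0 h u y.
have mk : measurable_fun setT k := measurable_near_kernel1 h u.
have ky := near_lty uN.
have km : (stat_mean k <= 2 * D / n%:R)%R.
  rewrite -lee_fin fineK ?near_le// ge0_fin_numE//.
  by apply: integral_ge0 => w _; rewrite lee_fin mulr_ge0.
have me : measurable_fun setT (fun w => (empirical k w)%:E).
  apply/measurable_EFinP.
  exact: (measurableT_comp (measurable_empirical _ X1 X2 Zs n (measurable_near_kernel h))
    (@pair1_measurable _ _ R T u)).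
have e0 w : setT w -> (0 <= (empirical k w)%:E)%E.
  by move=> _; rewrite lee_fin; exact: empirical_ge0.
have m0 (w : T) : setT w -> (0 <= (stat_mean k)%:E)%E.
  by move=> _; rewrite lee_fin; exact: stat_mean_ge0.
rewrite /near_deviation/=.
under eq_integral do rewrite EFinD.
rewrite (ge0_integralD P measurableT e0 me m0 (measurable_cst _)).
rewrite integral_cst// [X in (_ + _ * X)%E]probability_setT mule1.
rewrite (empirical_expectation Z_ge0 M_gt0 Z_bounded copies n_gt0 mk k0 ky) -EFinD lee_fin.
have Me : 0 <= M ^+ 2 / e by rewrite divr_ge0 ?sqr_ge0// ltW.
have MD : 0 <= M * D * (`|ln e| + 2) by rewrite !mulr_ge0 ?addr_ge0// ltW.
apply: (@le_trans _ _ (4 * D / n%:R)); first by rewrite mulrAC in km *; lra.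
rewrite mulrA ler_pM2r ?invr_gt0//.
have D0 := D_ge0.
have : 4 * D <= moment_bound by rewrite /moment_bound; lra.
move=> /le_trans; apply; rewrite ler_peMr//.
exact: le_trans ler01 moment_bound_ge1.
Qed.

(** The far part is compared with its mean, whereas the near part and its mean
    are simply added, being small each. *)
Lemma Psi_sharp_deviation_le u w : (forall i, 0 <= Zs i w <= M) ->
  x - e <= u <= x + e ->
  `|Psi_sharp (Ysample w) (Zsample w) n u - fine (Psi_mean X Z u)| <=
  far_deviation (u, w) + near_deviation (u, w).
Proof.
move=> Zw uN.
have u0 : 0 <= u by have ex := e_x; case/andP: uN => ? ?; lra.
have E1 : Psi_sharp (Ysample w) (Zsample w) n u =
    empirical (far_kernel h u) w + empirical (near_kernel h u) w.
  rewrite Psi_sharpE// !empirical_clipped// -mulrDr -big_split/=.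
  by congr (_ * _); apply: eq_bigr => i _; rewrite -mulrDr far_near_kernel.
have E2 : fine (Psi_mean X Z u) =
    stat_mean (far_kernel h u) + stat_mean (near_kernel h u).
  rewrite /Psi_mean -fineD.
  - rewrite -ge0_integralD//.
    + by congr fine; apply: eq_integral => v _; rewrite -EFinD -mulrDr far_near_kernel.
    + by move=> v _; rewrite lee_fin mulr_ge0// far_kernel_ge0.
    + apply/measurable_EFinP; apply: measurable_funM => //.
      exact: (measurableT_comp (measurable_far_kernel1 h u) mY).
    + by move=> v _; rewrite lee_fin mulr_ge0// near_kernel_ge0.
    + apply/measurable_EFinP; apply: measurable_funM => //.
      exact: (measurableT_comp (measurable_near_kernel1 h u) mY).
  - rewrite ge0_fin_numE ?far_lty//; apply: integral_ge0 => v _.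
    by rewrite lee_fin mulr_ge0// far_kernel_ge0.
  - rewrite ge0_fin_numE ?near_lty//; apply: integral_ge0 => v _.
    by rewrite lee_fin mulr_ge0// near_kernel_ge0.
have e0 : 0 <= empirical (near_kernel h u) w.
  by apply: empirical_ge0 => // y; exact: near_kernel_ge0.
have m0 : 0 <= stat_mean (near_kernel h u).
  by apply: stat_mean_ge0 => y; exact: near_kernel_ge0.
rewrite E1 E2 opprD addrACA; apply: le_trans (ler_normD _ _) _; apply: lerD => //=.
by rewrite /near_deviation/= ler_norml; apply/andP; split; lra.
Qed.

End sample_deviation.

(** * Control of the smoothed difference on a likely event *)

Section good_sample.
Context {R : realType} d0 (T0 : measurableType d0) (P0 : probability T0 R).
Local Notation mu := (@lebesgue_measure R).
Variables (X : 'I_3 -> {RV P0 >-> R}) (Z : {RV P0 >-> R}).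
Hypothesis Z_ge0 : forall w, 0 <= Z w.
Variables (nu : {sigma_finite_measure set R -> \bar R}) (rho : R -> R -> R).
Hypothesis rho_ge0 : forall r z : R, 0 <= r -> 0 <= z -> 0 <= rho r z.
Hypothesis rho_measurable :
  measurable_fun [set p : R * R | 0 <= p.1 /\ 0 <= p.2]
    (fun p : R * R => rho p.1 p.2).
Hypothesis XZ_density : has_radial_density P0 X Z nu rho.
Variable M : R.
Hypothesis M_gt0 : 0 < M.
Hypothesis Z_bounded : {ae P0, forall w, Z w <= M}.
Variables (x e pl pu : R).
Hypotheses (e_gt0 : 0 < e) (e_le : 3 * e <= x) (pl_gt0 : 0 < pl).
Hypothesis phi_near : forall v, `|v - x| < 3 * e ->
  (pl%:E <= phi nu rho v)%E /\ (phi nu rho v <= pu%:E)%E.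

Context d (T : measurableType d) (P : probability T R).
Variables X1 X2 Zs : nat -> {RV P >-> R}.
Hypothesis copies : forall i, same_law P (fun w => (X1 i w, X2 i w, Zs i w))
  P0 (planar_copy X Z).
Hypothesis indep : mutually_independent P (fun i w => (X1 i w, X2 i w, Zs i w)).

Variable K : R -> R.
Hypotheses (K'_derivable : forall t, derivable K^`()%classic t 1)
  (K_support : closure [set t | K t != 0] = `[-1, 1]%classic).
Variable CK : R.
Hypothesis K'_lipschitz :
  forall s t, `|K^`()%classic s - K^`()%classic t| <= CK * `|s - t|.

Local Notation Ysample w := (fun i => X1 i w ^+ 2 + X2 i w ^+ 2).
Local Notation Zsample w := (fun i => Zs i w).
Local Notation c := (slope pl).
Local Notation D := (Num.max (weighted_density_bound nu rho x e pu) 0).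
Local Notation eta := (c * e ^+ 2 / 16).
Local Notation S := (Num.max (4 * x) ((4 * M / (c * e)) ^+ 2)).

Variables (n : nat) (b q L : R) (N : nat).
Hypotheses (n_gt0 : (0 < n)%N) (b_gt0 : 0 < b) (b_x : 2 * b < x) (N_gt0 : (0 < N)%N).
Hypothesis N_large : 2 * M * Num.sqrt (S / N%:R) <= eta / 2.
Local Notation be := (scale b q L).
Hypothesis scale_le : 4 * be <= e.
Hypothesis h_le : n%:R ^- 2 <= e.
Local Notation far := (far_deviation X Z M X1 X2 Zs n).
Local Notation near := (near_deviation X Z M X1 X2 Zs n).
Local Notation grid_error j w :=
  (empirical M X1 X2 Zs n (U_weight (j%:R * (S / N%:R))) w
   - U_mean X Z (j%:R * (S / N%:R))).
Local Notation I := (`[x - 4 * be, x + 4 * be]%classic : set R).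

Let x_gt0 : 0 < x. Proof. by have := e_gt0; have := e_le; lra. Qed.

Let S_gt0 : 0 < S. Proof. by rewrite lt_max mulr_gt0. Qed.

Let c_gt0 : 0 < c. Proof. exact: slope_gt0. Qed.

Let local_le (k : R -> \bar R) : measurable_fun setT k ->
  (forall t, (0 <= k t)%E) ->
  (forall t, ~ (x - e < t < x + 2 * e) -> k t = 0%E) ->
  (\int[P0]_w ((Z w)%:E * k (X 0 w ^+ 2 + X 1 w ^+ 2)%R) <= D%:E * \int[mu]_v k v)%E.
Proof.
move=> mk k0 ksupp.
apply: le_trans (expect_local Z_ge0 rho_ge0 rho_measurable XZ_density M_gt0
  Z_bounded e_gt0 e_le phi_near mk k0 ksupp) _.
by apply: lee_wpmul2r; [exact: integral_ge0|rewrite lee_fin le_max lexx].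
Qed.

(** The deterministic part of the argument: the three inequalities are those
    which Markov's inequality makes likely. *)
Lemma good_sample_bound (w : T) (A : R) :
  (forall i, 0 <= Zs i w <= M) ->
  (\int[mu]_u ((far (u, w) + near (u, w)) * local_weight x e be u)%:E
    <= (c / 16)%:E)%E ->
  (\sum_(j < N.+1) (grid_error j w) ^+ 2 <= (eta / 2) ^+ 2) ->
  (\int[mu]_u (averaged_bound b c q L far near (u, w) * \1_I u)%:E <= A%:E)%E ->
  `|smoothed_derivative K b (Psi_tilde (Ysample w) (Zsample w) n) x -
    smoothed_derivative K b (Psi_sharp (Ysample w) (Zsample w) n) x| <=
  CK / b ^+ 3 * A.
Proof.
move=> Zw weight_small grid_small average_small.
have Z0 i : 0 <= Zs i w by have /andP[] := Zw i.
have ZM i : Zs i w <= M by have /andP[] := Zw i.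
have ex : e < x by have := e_gt0; have := e_le; lra.
have c0 := c_gt0; have e0 := e_gt0; have b0 := b_gt0.
have be0 : 0 < be by exact: scale_gt0.
have eta0 : 0 < eta by rewrite divr_gt0// mulr_gt0// exprn_gt0.
have mfar : measurable_fun setT (fun u => far (u, w)).
  exact: (measurableT_comp (measurable_far_deviation X Z_ge0 M X1 X2 Zs n)
    (@pair2_measurable _ _ R T w)).
have mnear : measurable_fun setT (fun u => near (u, w)).
  exact: (measurableT_comp (measurable_near_deviation X Z_ge0 M X1 X2 Zs n)
    (@pair2_measurable _ _ R T w)).
have far0 u : 0 <= far (u, w) by exact: normr_ge0.
have near0 u : 0 <= near (u, w) by exact: near_deviation_ge0.
pose Us := U_sharp (Ysample w) (Zsample w) n.
have Us_near s : 0 <= s <= S -> `|Us s - U_mean X Z s| <= eta.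
  apply: (grid_uniform_bound N_gt0 S_gt0 _ _ (ltW M_gt0) N_large).
  - move=> s' t s0 st; apply/andP; split; last exact: U_sharp_holder.
    by rewrite subr_ge0; exact: U_sharp_ndecr.
  - by move=> s' t s0 st; exact: (U_mean_holder X Z_ge0 M_gt0 Z_bounded s0 st).
  - move=> j; rewrite /Us (U_sharp_empirical X1 X2 n Zw); last first.
      by rewrite mulr_ge0// ltW// divr_gt0// ltr0n.
    have eta2 : 0 <= eta / 2 by apply: divr_ge0 => //; exact: ltW.
    rewrite -(@ler_pXn2r _ 2) ?nnegrE//.
    rewrite real_normK ?num_real//; apply: le_trans grid_small.
    by rewrite (bigD1 j)//= lerDl; apply: sumr_ge0 => i _; exact: sqr_ge0.
have tilde_le t : `|t - x| <= 2 * be ->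
    ((U_tilde (Ysample w) (Zsample w) n t - Us t)%:E <=
     \int[mu]_(u in `[(x - 4 * be)%R, (x + 4 * be)%R])
       (excess c (fun u => far (u, w)) (fun u => near (u, w)) t u)%:E)%E.
  apply: (tilde_minus_sharp_le Z0 ZM n_gt0 c0 be0 scale_le ex
    (psi := fun u => fine (Psi_mean X Z u)) (U := U_mean X Z) (S := S) (eta := eta)).
  - by move=> u; exact: fine_Psi_mean_ge0.
  - exact: (fine_Psi_mean_decr Z_ge0 M_gt0 Z_bounded rho_ge0 rho_measurable
      XZ_density e_gt0 e_le pl_gt0 phi_near).
  - exact: mfar.
  - exact: mnear.
  - exact: far0.
  - exact: near0.
  - move=> u uN; exact: (Psi_sharp_deviation_le Z_ge0 M_gt0 Z_bounded X1 X2 n_gt0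
      ex local_le h_le Zw uN).
  - exact: weight_small.
  - exact: Us_near.
  - move=> s t' /andP[s0 _] se tx.
    exact: (U_mean_below Z_ge0 M_gt0 Z_bounded rho_ge0 rho_measurable
      XZ_density e_gt0 e_le pl_gt0 phi_near scale_le s0 se tx).
  - by rewrite le_max; apply/orP; left; lra.
  - move=> s t'; rewrite gt_max => /andP[xs Ms] tx.
    exact: (far_bound_below Z_ge0 M_gt0 Z_bounded rho_ge0 rho_measurable
      XZ_density e_gt0 e_le pl_gt0 phi_near scale_le (ltW xs) (ltW Ms) tx).
apply: (smoothed_derivative_le K'_derivable K_support K'_lipschitz Z0 ZM n_gt0 b0 b_x).
pose exc t u := excess c (fun u => far (u, w)) (fun u => near (u, w)) t u.
have exc0 t u : 0 <= exc t u by exact: excess_ge0.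
have W0 t : `[x - 2 * b, x + 2 * b]%classic t -> 0 <= t.
  by rewrite /= in_itv/= => /andP[? _]; have := b_x; lra.
have mexc : measurable_fun setT (fun t : R => \int[mu]_(u in I) (exc t u)%:E)%E.
  rewrite (_ : (fun t => _) =
      (fun t => \int[mu]_u (exc t u * \1_I u)%:E)%E); last first.
    by apply/funext => t; rewrite integral_mkcond epatch_indic.
  pose k (p : R * R) := (exc p.1 p.2 * \1_I p.2)%:E.
  have mk : measurable_fun setT k.
    apply/measurable_EFinP; apply: measurable_funM.
      exact: (measurable_excess c mfar mnear).
    by apply: measurableT_comp => //; exact: measurable_indic.
  by apply: (measurable_fun_fubini_tonelli_F (m2 := mu) _ mk) => p;
    rewrite lee_fin mulr_ge0.
apply: (@le_trans _ _ (\int[mu]_(t in `[(x - 2 * b)%R, (x + 2 * b)%R])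
    \int[mu]_(u in I) (exc t u)%:E)%E).
  apply: ge0_le_integral => //.
  - move=> t /W0 t0; rewrite lee_fin subr_ge0; exact: (U_sharp_le_tilde _ Z0 ZM n_gt0).
  - apply/measurable_EFinP; apply: measurable_funB.
      by apply: measurable_funS (measurable_U_tilde (Ysample w) Z0 ZM n_gt0) => // t /W0 t0;
        rewrite /= in_itv/= t0.
    by apply: measurable_funS (measurable_U_sharp (Ysample w) n Z0) => // t /W0 t0;
        rewrite /= in_itv/= t0.
  - exact: measurable_funTS.
  - move=> t /=; rewrite in_itv/= => /andP[t1 t2]; apply: tilde_le.
    have bb : b <= be by rewrite /scale le_max lexx.
    by rewrite ler_norml; apply/andP; split; lra.
apply: le_trans _ average_small.
have mB : measurable_fun setT (fun u => averaged_bound b c q L far near (u, w)).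
  exact: (measurableT_comp (measurable_averaged_bound b c q L
    (measurable_far_deviation X Z_ge0 M X1 X2 Zs n)
    (measurable_near_deviation X Z_ge0 M X1 X2 Zs n)) (@pair2_measurable _ _ R T w)).
rewrite [leRHS](_ : _ = \int[mu]_(u in I) (averaged_bound b c q L far near (u, w))%:E)%E; last first.
  by rewrite [RHS]integral_mkcond epatch_indic.
apply: averaged_excess_le => // u; rewrite /averaged_bound.
case: (L * Num.sqrt q <= b).
  exact: (integral_excess_le_sqr x b0 c0 mfar mnear far0 near0 u).
exact: (integral_excess_le_linear x c b0 mfar mnear far0 near0 u).
Qed.

Local Notation Km := (moment_bound M e D).

Hypotheses (qE : q = ln n%:R / n%:R) (ln_ge1 : 1 <= ln n%:R :> R).
Variable eps : R.
Hypotheses (eps_gt0 : 0 < eps) (L_gt0 : 0 < L).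
Hypothesis L_large : 4 * pi * Km / L <= c / 16 * eps.
Hypothesis n_large : N.+1%:R * (n%:R^-1 * (4 * M ^+ 2 * S)) <= (eta / 2) ^+ 2 * eps.

Let mU s : measurable_fun setT (fun w => empirical M X1 X2 Zs n (U_weight s) w).
Proof.
have mk : measurable_fun setT (fun p : R * R => U_weight s p.2).
  exact: (measurableT_comp (measurable_U_weight s) (@measurable_snd _ _ R R)).
exact: (measurableT_comp
  (measurable_empirical M X1 X2 Zs n (k := fun=> U_weight s) mk)
  (@pair1_measurable _ _ R T 0)).
Qed.

Let grid_expectation :
  (\int[P]_w (\sum_(j < N.+1) (grid_error j w) ^+ 2)%:E <= ((eta / 2) ^+ 2 * eps)%:E)%E.
Proof.
under eq_integral do rewrite -sumEFin.
rewrite ge0_integral_sum//; last 2 first.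
- move=> j; apply/measurable_EFinP; apply: measurable_funX.
  by apply: measurable_funB => //; exact: mU.
- by move=> j w _; rewrite lee_fin sqr_ge0.
apply: le_trans (_ : _ <= \sum_(j < N.+1) (n%:R^-1 * (4 * M ^+ 2 * S))%:E)%E _.
  apply: lee_sum => j _.
  have s0 : 0 <= j%:R * (S / N%:R) by rewrite mulr_ge0// ltW// divr_gt0// ltr0n.
  apply: le_trans (U_sharp_variance Z_ge0 M_gt0 Z_bounded copies indep n_gt0 s0) _.
  rewrite lee_fin; apply: ler_wpM2l; first by rewrite invr_ge0.
  apply: ler_wpM2l; first by rewrite mulr_ge0 ?sqr_ge0.
  rewrite mulrCA ler_piMr ?(ltW S_gt0)// ler_pdivrMr ?ltr0n// mul1r ler_nat.
  by rewrite -ltnS.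
by rewrite sumEFin lee_fin sumr_const card_ord -[leLHS]mulr_natl.
Qed.

(** Off a null event, each of the three inequalities fails with probability at
    most eps. *)
Lemma good_event : exists E : set T, [/\ measurable E, (P E <= (3 * eps)%:E)%E &
  forall w, ~ E w ->
  `|smoothed_derivative K b (Psi_tilde (Ysample w) (Zsample w) n) x -
    smoothed_derivative K b (Psi_sharp (Ysample w) (Zsample w) n) x| <=
  CK / b ^+ 3 * (64 * Km * (c^-1 + e + L) * b * q / eps)].
Proof.
have c0 := c_gt0; have n0 : 0 < n%:R :> R by rewrite ltr0n.
have eta0 : 0 < eta by rewrite divr_gt0// mulr_gt0// exprn_gt0.
have q0 : 0 < q by rewrite qE divr_gt0// (lt_le_trans ltr01).
have q1 : q <= 1 by rewrite qE ler_pdivrMr// mul1r ltW// ln_sublinear.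
have D0 : 0 <= D by rewrite le_max lexx orbT.
have K1 : 1 <= Km := moment_bound_ge1 M_gt0 e_gt0 D0.
have mfar := measurable_far_deviation X Z_ge0 M X1 X2 Zs n.
have mnear := measurable_near_deviation X Z_ge0 M X1 X2 Zs n.
have far0 p : 0 <= far p by exact: normr_ge0.
have near0 p : 0 <= near p by exact: near_deviation_ge0.
have far2 u : x - e <= u <= x + e ->
    (\int[P]_w (far (u, w) ^+ 2)%:E <= (Km * q)%:E)%E.
  rewrite qE; exact: (expect_far_deviation_sqr_le Z_ge0 M_gt0 Z_bounded copies
    indep n_gt0 e_gt0 D0 local_le h_le ln_ge1).
have near1 u : x - e <= u <= x + e ->
    (\int[P]_w (near (u, w))%:E <= (Km * q)%:E)%E.
  rewrite qE; exact: (expect_near_deviation_le Z_ge0 M_gt0 Z_bounded copies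
    n_gt0 e_gt0 D0 local_le h_le ln_ge1).
have [E0 [mE0 PE0 E0P]] := Zs_out_negligible Z_ge0 Z_bounded copies.
have fn0 (p : R * T) : 0 <= far p + near p by rewrite addr_ge0.
have lw0 u : 0 <= local_weight x e be u by exact: local_weight_ge0.
have c16 : 0 < c / 16 by rewrite divr_gt0.
have F1 w : (0 <= \int[mu]_u
    ((far (u, w) + near (u, w)) * local_weight x e be u)%:E)%E.
  by apply: integral_ge0 => u _; rewrite lee_fin mulr_ge0.
have A1 : (\int[P]_w \int[mu]_u
    ((far (u, w) + near (u, w)) * local_weight x e be u)%:E <= (c / 16 * eps)%:E)%E.
  apply: le_trans (expect_weighted_deviation_le mfar mnear far0 near0 b_gt0 L_gt0
    q0 q1 K1 far2 near1) _.
  by rewrite lee_fin.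
have [mE1 PE1] := @markov_event _ _ _ P
  (fun w => \int[mu]_u ((far (u, w) + near (u, w)) * local_weight x e be u)%:E)%E
  (c / 16) eps c16
  (measurable_weighted_integral (measurable_funD mfar mnear) fn0
    (measurable_local_weight x e be) lw0)
  F1
  A1.
set E1 := [set w | _] in mE1 PE1.
have eta2 : 0 < (eta / 2) ^+ 2 by rewrite exprn_gt0// divr_gt0.
have mG : measurable_fun setT (fun w => (\sum_(j < N.+1) (grid_error j w) ^+ 2)%:E).
  apply/measurable_EFinP; apply: measurable_sum => j; apply: measurable_funX.
  by apply: measurable_funB => //; exact: mU.
have G0 w : (0 <= (\sum_(j < N.+1) (grid_error j w) ^+ 2)%:E)%E.
  by rewrite lee_fin; apply: sumr_ge0 => j _; exact: sqr_ge0.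
have [mE2 PE2] := markov_event eta2 mG G0 grid_expectation.
set E2 := [set w | _] in mE2 PE2.
pose A := 64 * Km * (c^-1 + e + L) * b * q / eps.
have A0 : 0 < A.
  have cV : 0 < c^-1 by rewrite invr_gt0.
  have s0 : 0 < c^-1 + e + L by rewrite !addr_gt0.
  by rewrite !mulr_gt0 ?invr_gt0 ?(lt_le_trans ltr01 K1).
have mI : measurable (I : set (measurableTypeR R)) by [].
have I0 u : 0 <= (\1_I u : R) by [].
have ab0 p : 0 <= averaged_bound b c q L far near p by exact: averaged_bound_ge0.
have Aeps : (\int[P]_w \int[mu]_u (averaged_bound b c q L far near (u, w) * \1_I u)%:E
    <= (A * eps)%:E)%E.
  rewrite /A mulfVK ?gt_eqF//.
  exact: (expect_averaged_bound_le mfar mnear far0 near0 b_gt0 c0 e_gt0 L_gt0 q0 q1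
    K1 far2 near1 scale_le).
have F3 w : (0 <= \int[mu]_u
    (averaged_bound b c q L far near (u, w) * \1_I u)%:E)%E.
  by apply: integral_ge0 => u _; rewrite lee_fin mulr_ge0.
have [mE3 PE3] := markov_event A0
  (measurable_weighted_integral (measurable_averaged_bound b c q L mfar mnear) ab0
    (measurable_indic mI) I0)
  F3 Aeps.
set E3 := [set w | _] in mE3 PE3.
have m01 := measurableU _ _ mE0 mE1; have m23 := measurableU _ _ mE2 mE3.
exists ((E0 `|` E1) `|` (E2 `|` E3)); split.
- exact: measurableU.
- apply: le_trans (measureU2 P m01 m23) _.
  apply: le_trans (leeD (measureU2 P mE0 mE1) (measureU2 P mE2 mE3)) _.
  have -> : 3 * eps = (0 + eps) + (eps + eps) by ring.
  rewrite !EFinD; apply: leeD; apply: leeD; [|exact: PE1|exact: PE2|exact: PE3].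
  by rewrite le_eqVlt; apply/orP; left; apply/eqP; exact: PE0.
- move=> w nE; apply: good_sample_bound.
  + move=> i; apply: contrapT => Zi; apply: nE; left; left; apply: E0P.
    by exists i.
  + by rewrite leNgt; apply/negP => h; apply: nE; left; right.
  + by rewrite -lee_fin leNgt; apply/negP => h; apply: nE; right; left.
  + by rewrite leNgt; apply/negP => h; apply: nE; right; right.
Qed.

End good_sample.

(** * Rate of convergence *)

Lemma near_infty_natr_ge (R : realType) (a : R) : \forall n \near \oo, a <= n%:R.
Proof. by near do apply: ltW; exact: nbhs_infty_gtr. Unshelve. all: by end_near. Qed.

Lemma ln_div_le_invr_sqrt (R : realType) (y : R) : 0 < y -> ln y / y <= 2 / Num.sqrt y.
Proof.
move=> y0; have s0 : 0 < Num.sqrt y by rewrite sqrtr_gt0.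
have yE : y = Num.sqrt y ^+ 2 by rewrite sqr_sqrtr// ltW.
move: s0 yE; move: (Num.sqrt y) => s s0 ->.
rewrite lnXn// ler_pdivrMr ?exprn_gt0// mulr2n.
rewrite [leRHS](_ : _ = s + s); last by field; rewrite gt_eqF.
by rewrite lerD// ltW// ln_sublinear.
Qed.

Lemma continuous_fin_near (R : realType) (f : R -> \bar R) (x : R) :
  f x \is a fin_num -> (0 < f x)%E -> {for x, continuous f} ->
  exists2 dl : R, 0 < dl & forall v, `|v - x| < dl ->
    ((fine (f x) / 2)%:E <= f v)%E /\ (f v <= (2 * fine (f x))%:E)%E.
Proof.
move=> fin f0 cf; have fxE := fineK fin; set p := fine (f x) in fxE *.
have p0 : 0 < p by rewrite -lte_fin fxE.
have lo : \forall v \near x, ((p / 2)%:E < f v)%E.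
  suff /cf : nbhs (f x) [set t | ((p / 2)%:E < t)%E] by [].
  apply: open_nbhs_nbhs.
  split; first exact: open_ereal_gt_ereal.
  by rewrite /= -fxE lte_fin; lra.
have hi : \forall v \near x, (f v < (2 * p)%:E)%E.
  suff /cf : nbhs (f x) [set t | (t < (2 * p)%:E)%E] by [].
  apply: open_nbhs_nbhs.
  split; first exact: open_ereal_lt_ereal.
  by rewrite /= -fxE lte_fin; lra.
have /nbhs_ballP[dl /= dl0 H] : \forall v \near x, ((p / 2)%:E < f v)%E /\ (f v < (2 * p)%:E)%E.
  by near=> v; split; near: v.
exists dl => // v vx; have [|h1 h2] := H v.
  by rewrite /ball/= distrC.
by split; exact: ltW.
Unshelve. all: by end_near. Qed.

Lemma fine_grid (R : realType) (S M eta : R) : 0 < M -> 0 < eta ->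
  exists2 N : nat, (0 < N)%N & 2 * M * Num.sqrt (S / N%:R) <= eta / 2.
Proof.
move=> M0 eta0; pose N := (Num.truncn (S * (4 * M / eta) ^+ 2)).+1.
exists N => //; have N0 : 0 < N%:R :> R by rewrite ltr0n.
have a0 : 0 < eta / (4 * M) by rewrite divr_gt0 ?mulr_gt0.
have h : Num.sqrt (S / N%:R) <= eta / (4 * M).
  rewrite -[leRHS]ger0_norm ?(ltW a0)// -sqrtr_sqr; apply: ler_wsqrtr.
  rewrite ler_pdivrMr// mulrC -ler_pdivrMr ?exprn_gt0//.
  by rewrite -exprVn invf_div; apply: ltW; exact: truncnS_gt.
rewrite [leRHS](_ : _ = 2 * M * (eta / (4 * M))); last by field; rewrite gt_eqF.
by rewrite ler_pM2l// mulr_gt0.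
Qed.

Lemma near_scale_le (R : realType) (b : R^nat) (L e : R) : 0 < L -> 0 < e ->
  (\forall n \near \oo, b n < e / 4) ->
  \forall n \near \oo, 4 * scale (b n) (ln n%:R / n%:R) L <= e.
Proof.
move=> L0 e0 be; near=> n.
have bn : b n < e / 4 by near: n.
have nR : 0 < n%:R :> R by rewrite (lt_le_trans ltr01)//; near: n; exact: near_infty_natr_ge.
pose a := e / (4 * L); have a0 : 0 < a by rewrite divr_gt0// mulr_gt0.
have a2 : 0 < a ^+ 2 by rewrite exprn_gt0.
set q := ln _ / _; have qa : q <= a ^+ 2.
  apply: le_trans (ln_div_le_invr_sqrt nR) _.
  have n2 : (2 / a ^+ 2) ^+ 2 <= n%:R by near: n; exact: near_infty_natr_ge.
  rewrite ler_pdivrMr ?sqrtr_gt0// -ler_pdivrMl// mulrC.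
  rewrite -[leLHS]ger0_norm ?divr_ge0 ?(ltW a2)// -sqrtr_sqr.
  exact: ler_wsqrtr.
have qs : Num.sqrt q <= a.
  by rewrite -[leRHS]ger0_norm ?(ltW a0)// -sqrtr_sqr; exact: ler_wsqrtr.
rewrite ler_pdivlMr ?mulr_gt0// in qs.
have : scale (b n) q L <= e / 4 by rewrite ge_max (ltW bn)/=; lra.
lra.
Unshelve. all: by end_near. Qed.

Theorem theorem3p3 (R : realType)
    (d0 : measure_display) (T0 : measurableType d0) (P0 : probability T0 R)
    (X : 'I_3 -> {RV P0 >-> R}) (Z : {RV P0 >-> R})
    (Z_ge0 : forall w, 0 <= Z w)
    (XZ_invariant : orthogonally_invariant P0 X Z)
    (nu : {sigma_finite_measure set R -> \bar R})
    (nu_nneg : nu `]-oo, 0[%classic = 0%E)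
    (rho : R -> R -> R)
    (rho_ge0 : forall r z : R, 0 <= r -> 0 <= z -> 0 <= rho r z)
    (rho_measurable : measurable_fun [set p : R * R | 0 <= p.1 /\ 0 <= p.2]
       (fun p : R * R => rho p.1 p.2))
    (XZ_density : has_radial_density P0 X Z nu rho)
    (d : measure_display) (T : measurableType d) (P : probability T R)
    (X1 X2 Zs : nat -> {RV P >-> R})
    (copies : forall i, same_law P (fun w => (X1 i w, X2 i w, Zs i w))
                                 P0 (fun w => (X 0 w, X 1 w, Z w)))
    (indep : mutually_independent P (fun i w => (X1 i w, X2 i w, Zs i w)))
    (K : R -> R)
    (K_derivable : forall t, derivable K t 1)
    (K'_derivable : forall t, derivable K^`()%classic t 1)
    (K''_continuous : continuous K^`()^`()%classic)
    (K_support : closure [set t | K t != 0] = `[-1, 1]%classic)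
    (Z_bounded : exists M : R, {ae P0, forall w, Z w <= M})
    (x : R) (x_gt0 : 0 < x)
    (phi_x_fin : phi nu rho x \is a fin_num)
    (phi_x_gt0 : (0 < phi nu rho x)%E)
    (phi_continuous : {for x, continuous (phi nu rho)})
    (b : nat -> R) (b_gt0 : forall n, 0 < b n)
    (b_cvg : b n @[n --> \oo] --> 0)
    (nb_cvg : n%:R * b n @[n --> \oo] --> +oo) :
  let Y := fun w i => X1 i w ^+ 2 + X2 i w ^+ 2 in
  let Z' := fun w i => Zs i w in
  bigO_in_probability P
    (fun n w =>
       `|smoothed_derivative K (b n) (Psi_tilde (Y w) (Z' w) n) x
         - smoothed_derivative K (b n) (Psi_sharp (Y w) (Z' w) n) x|)
    (fun n => ln n%:R / (n%:R * b n ^+ 2)).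
Proof.
move=> Y Z' eps eps0.
have [CK CK0 K'_lip] := kernel_derivative_lipschitz K'_derivable K''_continuous K_support.
have [M0 Z_M0] := Z_bounded.
pose M := Num.max M0 1.
have M_gt0 : 0 < M by rewrite lt_max ltr01 orbT.
have Z_M : {ae P0, forall w, Z w <= M}.
  by apply: filterS Z_M0 => w /le_trans; apply; rewrite le_max lexx.
have [dl dl0 phi_dl] := continuous_fin_near phi_x_fin phi_x_gt0 phi_continuous.
set pl := fine (phi nu rho x) / 2 in phi_dl; set pu := 2 * fine (phi nu rho x) in phi_dl.
have pl_gt0 : 0 < pl by rewrite divr_gt0// -lte_fin fineK.
(* The interval ]x - 3 e, x + 3 e[ lies in the half-line, and phi is between pl
   and pu on it. *)
pose e := Num.min dl x / 3.
have e_gt0 : 0 < e by rewrite divr_gt0// lt_min dl0.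
have e_le : 3 * e <= x by rewrite /e mulrC mulfVK// ge_min lexx orbT.
have phi_near v : `|v - x| < 3 * e ->
    (pl%:E <= phi nu rho v)%E /\ (phi nu rho v <= pu%:E)%E.
  move=> vx; apply: phi_dl; apply: lt_le_trans vx _.
  by rewrite /e mulrC mulfVK// ge_min lexx.
pose c := slope pl; have c_gt0 : 0 < c by exact: slope_gt0.
pose eta := c * e ^+ 2 / 16.
have eta_gt0 : 0 < eta by rewrite divr_gt0// mulr_gt0// exprn_gt0.
pose D := Num.max (weighted_density_bound nu rho x e pu) 0.
have D_ge0 : 0 <= D by rewrite le_max lexx orbT.
pose Km := moment_bound M e D.
have Km1 : 1 <= Km by exact: moment_bound_ge1.
have Km0 : 0 < Km by exact: lt_le_trans Km1.
pose S := Num.max (4 * x) ((4 * M / (c * e)) ^+ 2).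
have S_gt0 : 0 < S by rewrite lt_max mulr_gt0.
(* One third for each of the three inequalities of good_sample_bound. *)
pose eps' := eps / 3; have eps'0 : 0 < eps' by rewrite divr_gt0.
(* With this value the mean of the weighted deviation is at most c eps' / 16. *)
pose L := 64 * pi * Km / (c * eps').
have L_gt0 : 0 < L.
  apply: divr_gt0; last exact: mulr_gt0.
  by apply: mulr_gt0 => //; apply: mulr_gt0 => //; exact: pi_gt0.
have L_large : 4 * pi * Km / L <= c / 16 * eps'.
  have E (k c' p s : R) : k != 0 -> c' != 0 -> p != 0 -> s != 0 ->
      4 * p * k / (64 * p * k / (c' * s)) = c' / 16 * s.
    by move=> k0 c0 p0 s0; field; rewrite k0 c0 p0 s0.
  by rewrite /L E// gt_eqF// pi_gt0.
have [N N_gt0 N_large] := fine_grid S M_gt0 eta_gt0.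
pose C0 := 64 * Km * (c^-1 + e + L) / eps'.
have C0_gt0 : 0 < C0.
  have cV : 0 < c^-1 by rewrite invr_gt0.
  have s0 : 0 < c^-1 + e + L by do 2 apply: addr_gt0 => //.
  by apply: divr_gt0 => //; apply: mulr_gt0 => //; exact: mulr_gt0.
exists (CK * C0 + 1).
  by apply: ltr_wpDl => //; apply: mulr_ge0 => //; exact: ltW.
have b_small a : 0 < a -> \forall n \near \oo, b n < a.
  move=> a0; have /cvgrPdist_lt/(_ a a0) := b_cvg.
  apply: filterS => n; rewrite sub0r normrN; apply: le_lt_trans; exact: ler_norm.
near=> n.
have n_gt0 : (0 < n)%N.
  rewrite -(ltr_nat R); apply: (@lt_le_trans _ _ 1) => //.
  by near: n; exact: near_infty_natr_ge.
have nR : 0 < n%:R :> R by rewrite ltr0n.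
have ln_ge1 : 1 <= ln n%:R :> R.
  rewrite -[leLHS](expRK 1) ler_ln ?posrE ?expR_gt0//.
  by near: n; exact: near_infty_natr_ge.
have h_le : n%:R ^- 2 <= e.
  have ne : e^-1 <= n%:R by near: n; exact: near_infty_natr_ge.
  apply: (@le_trans _ _ n%:R^-1).
    by rewrite lef_pV2 ?posrE ?exprn_gt0// expr2 ler_peMr ?ler1n// ltW.
  by rewrite -[leRHS]invrK lef_pV2 ?posrE ?invr_gt0.
have b_x : 2 * b n < x.
  have : b n < x / 2 by near: n; apply: b_small; rewrite divr_gt0.
  lra.
have scale_le : 4 * scale (b n) (ln n%:R / n%:R) L <= e.
  by near: n; apply: near_scale_le => //; apply: b_small; rewrite divr_gt0.
have n_large : N.+1%:R * (n%:R^-1 * (4 * M ^+ 2 * S)) <= (eta / 2) ^+ 2 * eps'.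
  have g0 : 0 < (eta / 2) ^+ 2 * eps' by rewrite mulr_gt0// exprn_gt0// divr_gt0.
  have : N.+1%:R * (4 * M ^+ 2 * S) / ((eta / 2) ^+ 2 * eps') <= n%:R.
    by near: n; exact: near_infty_natr_ge.
  rewrite ler_pdivrMr// => h.
  rewrite mulrCA -ler_pdivlMl ?invr_gt0// invrK; exact: h.
have [E [mE PE goodE]] := good_event Z_ge0 rho_ge0 rho_measurable XZ_density M_gt0
  Z_M e_gt0 e_le pl_gt0 phi_near copies indep K'_derivable K_support K'_lip n_gt0
  (b_gt0 n) b_x N_gt0 N_large scale_le h_le erefl ln_ge1 eps'0 L_gt0 L_large n_large.
exists E; split => //; first by rewrite (_ : eps = 3 * eps')// /eps'; field.
move=> w /= large; apply: contrapT => /goodE.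
apply/negP; rewrite -ltNge; apply: le_lt_trans _ (lt_le_trans large _); last first.
  by rewrite normr_id.
have b0 := b_gt0 n; have lb0 : 0 <= ln n%:R / (n%:R * b n ^+ 2).
  by rewrite divr_ge0 ?mulr_ge0 ?sqr_ge0 ?(le_trans ler01 ln_ge1)// ltW.
rewrite [leLHS](_ : _ = CK * C0 * (ln n%:R / (n%:R * b n ^+ 2))); last first.
  rewrite /C0 -/c -/D -/Km; field.
  by rewrite !gt_eqF.
by rewrite ler_wpM2r// lerDl.
Unshelve. all: by end_near. Qed.
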